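(* Let $\omega:[0,1)\to(0,\infty)$ be a doubling function. Then there exist analytic functions $f_0,f_1$ on the unit disc $\mathbb{D}$ such that $$|f_0(z)|+|f_1(z)|\asymp \omega(|z|),\quad z\in\mathbb{D},$$ where both functions $f_j$, $j=0,1$, satisfy $n(r,f_j,0)=\mathrm{O}\left((1-r)^{-1}\right)$ as $r\to1^-$. Moreover, for $j=0,1$, $$M_p(r,f_j)\asymp\omega(r),\quad r\to1^-,$$ for all $0<p\le\infty$, and $$T(r,f_j)\asymp N(r,f_j,a)\asymp\log\omega(r),\quad r\to1^-,$$ for all $a\in\mathbb{C}$.
   Context: $\mathbb{D}=\{z\in\mathbb{C}:|z|<1\}$. A function $\omega:[0,1)\to(0,\infty)$ is called doubling if it is non-decreasing, continuous and unbounded, and there exists a constant $B>1$ such that $\omega(1-r/2)\le B\,\omega(1-r)$ for all $0<r\le1$. The notation $a\lesssim b$ means that there exists a constant $C>0$ such that $a\le Cb$ (on the indicated range of the variable; when ''$r\to1^-$'' is indicated, for all $r<1$ sufficiently close to $1$), and $a\asymp b$ means $a\lesssim b$ and $b\lesssim a$. For $f$ analytic in $\mathbb{D}$, $0<r<1$ and $a\in\mathbb{C}$: $n(r,f,a)$ is the number of zeros of $f-a$ in $\{z:|z|\le r\}$, counted with multiplicity (so $n(r,f,0)$ counts the zeros of $f$); the integrated counting function of $a$-points is $$N(r,f,a)=\int_0^r\frac{n(t,f,a)-n(0,f,a)}{t}\,dt+n(0,f,a)\log r;$$ the maximum modulus is $M_\infty(r,f)=\max_{|z|=r}|f(z)|$;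 the $L^p$-mean for $0<p<\infty$ is $M_p(r,f)=\left(\frac1{2\pi}\int_0^{2\pi}|f(re^{i\theta})|^p\,d\theta\right)^{1/p}$; and the Nevanlinna characteristic is $T(r,f)=\frac1{2\pi}\int_0^{2\pi}\log^+|f(re^{i\theta})|\,d\theta$, where $\log^+x=\max\{\log x,0\}$ with $\log^+0=0$. *)

(* Defs.v *)
From Stdlib Require Import Reals List.
From Coquelicot Require Import Coquelicot.
Open Scope R_scope.

Definition unit_disc (z : C) : Prop := Cmod z < 1.

(* [ex_derive] is taken over the field [C]: complex differentiability. *)
Definition analytic_on_disc (f : C -> C) : Prop :=
  forall z : C, unit_disc z -> ex_derive (K := C_AbsRing) f z.

(* A function on [0,1) is represented by a total function whose values
   outside [0,1) are irrelevant; continuity at 0 is one-sided. *)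
Definition doubling (omega : R -> R) : Prop :=
  (forall r, 0 <= r < 1 -> 0 < omega r) /\
  (forall r s, 0 <= r -> r <= s -> s < 1 -> omega r <= omega s) /\
  continuous_on (fun r => 0 <= r < 1) omega /\
  (forall M : R, exists r, 0 <= r < 1 /\ M < omega r) /\
  (exists B, 1 < B /\
     forall r, 0 < r <= 1 -> omega (1 - r / 2) <= B * omega (1 - r)).

Definition lesssim_on {T : Type} (D : T -> Prop) (a b : T -> R) : Prop :=
  exists K, 0 < K /\ forall x, D x -> a x <= K * b x.

Definition asymp_on {T : Type} (D : T -> Prop) (a b : T -> R) : Prop :=
  lesssim_on D a b /\ lesssim_on D b a.

(* The versions "as r -> 1-": for all r < 1 sufficiently close to 1. *)
Definition lesssim_near1 (a b : R -> R) : Prop :=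
  exists K, 0 < K /\ at_left 1 (fun r => a r <= K * b r).

Definition asymp_near1 (a b : R -> R) : Prop :=
  lesssim_near1 a b /\ lesssim_near1 b a.

(* f has a zero of multiplicity exactly m at z0 (m = 0: f z0 <> 0).  No m
   qualifies when f vanishes identically near z0. *)
Definition has_multiplicity (f : C -> C) (z0 : C) (m : nat) : Prop :=
  exists g : C -> C,
    locally z0 (fun z : C => ex_derive (K := C_AbsRing) g z) /\
    g z0 <> RtoC 0 /\
    locally z0 (fun z : C => f z = ((z - z0) ^ m * g z)%C).

Definition counted_points (r : R) (f : C -> C) (a : C)
    (l : list (C * nat)) : Prop :=
  NoDup (map fst l) /\
  List.Forall (fun p => Cmod (fst p) <= r /\
                        has_multiplicity (fun z => (f z - a)%C) (fst p) (snd p)) l.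

(* n(r,f,a): the sum of the multiplicities of the zeros of f - a in |z| <= r,
   as the supremum over finite families of distinct zeros.  For f constantly
   equal to a, multiplicities are undefined and the value is 0. *)
Definition n_count (r : R) (f : C -> C) (a : C) : Rbar :=
  Lub_Rbar (fun x => exists l, counted_points r f a l /\
                               x = INR (list_sum (map snd l))).

(* For f analytic on the disc, not constantly a, and 0 <= t < 1, the value
   n(t,f,a) is finite, so that [real] loses nothing. *)
Definition N_count (r : R) (f : C -> C) (a : C) : R :=
  RInt (fun t => (real (n_count t f a) - real (n_count 0 f a)) / t) 0 r
  + real (n_count 0 f a) * ln r.

Definition circle_pt (r theta : R) : C := (r * cos theta, r * sin theta).

(* x^p for x >= 0 and p > 0; [Rpower 0 p] is 1 and not 0. *)
Definition rpow (x p : R) : R := if Req_EM_T x 0 then 0 else Rpower x p.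

(* For f analytic on the disc and 0 < r < 1 the supremum is a maximum, hence
   finite. *)
Definition M_infty (r : R) (f : C -> C) : R :=
  real (Lub_Rbar (fun x => exists z : C, Cmod z = r /\ x = Cmod (f z))).

(* M_p(r,f) for 0 < p <= oo; the value at m_infty is irrelevant. *)
Definition M_mean (p : Rbar) (r : R) (f : C -> C) : R :=
  match p with
  | Finite q =>
      rpow (/ (2 * PI) *
            RInt (fun theta => rpow (Cmod (f (circle_pt r theta))) q) 0 (2 * PI))
           (/ q)
  | p_infty => M_infty r f
  | m_infty => 0
  end.

(* [ln 0] is 0, so that log^+ 0 = 0. *)
Definition log_plus (x : R) : R := Rmax (ln x) 0.

Definition T_char (r : R) (f : C -> C) : R :=
  / (2 * PI) *
  RInt (fun theta => log_plus (Cmod (f (circle_pt r theta)))) 0 (2 * PI).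

(* Main.v *)
(** The functions are lacunary series: f0 and f1 collect the even and the odd
    terms of sum_k lam^k z^(n_k), where omega(1 - 1/n_k) is about lam^k.  Since
    omega is doubling, for lam large the gaps n_(k+1)/n_k are so large that on
    the circle |z| = r, with K the last index such that r^(n_K) >= 1/2, all
    terms beyond K+1 are negligible, omega(r) is about lam^K, and the series
    containing the index K is dominated by that single term.  The other series
    may vanish there, but it too is dominated by one term on a circle of radius
    s >= r with 1 - s comparable to 1 - r, and it has a coefficient a_n with
    |a_n| r^n comparable to omega(r), which bounds its M_1 from below.

    With f = O(omega), the bound on M_1 yields all M_p and T by a Chebyshev
    argument.  N(r,f,a) is controlled without logarithmic integrals: the
    maximum principle, applied to f - a and to its reciprocal after the zeros
    are replaced by Blaschke factors, compares N(r,f,a) with the logarithms of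
    the maximum and of the minimum of |f - a| on a circle, and the circles of
    radius s make the two agree up to O(1).  Finally n(r,f,0) log(s/r) <=
    N(s,f,0) - N(r,f,0) = O(1) with s = (1 + r)/2 gives the bound on n. *)

Require Import Defs.
From Stdlib Require Import Reals List Lra Lia Psatz Bool PeanoNat.
From Stdlib Require Import Classical ClassicalEpsilon.
From Coquelicot Require Import Coquelicot.
Open Scope R_scope.

(** The parity split answers an obstacle: beyond the threshold index K the factor r^(n_(K+1)) may be
    anything below 1/2, so the terms K and K+1 can have equal size and cancel. Within one parity
    class the neighbours of a dominant index k are absent: the earlier terms sum to at most lam^k /
    90, and the term k+2 is at most lam^2 eps lam^k once its power has decayed to eps. Hence the
    requirement lam^2 eps <= 1/100, where eps comes from a gap that lam itself creates. It can be
    met because lam = B^(t+1) is exponential in the number t of halvings of the distance to the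
    boundary guaranteed between frequencies, while eps = 2^(1 - 2^t) is doubly exponentially small.
    Inequalities can replace Jensen's formula because ln omega tends to infinity, so bounded errors
    disappear in the comparisons. For n(r,f,0) a bounded increment of N is needed, and there
    doubling bounds ln omega(s) - ln omega(r). Doubling also pays for good circles: going back from
    r to one costs a fixed number of doublings. *)

(** * Complex differentiability *)

Lemma Cmod_minus_sym (a b : C) : Cmod (a - b) = Cmod (b - a).
Proof. rewrite <- Cmod_opp. f_equal. ring. Qed.

Lemma Cmod_triangle_minus (a b : C) : Cmod (a - b) <= Cmod a + Cmod b.
Proof. unfold Cminus. rewrite <- (Cmod_opp b). apply Cmod_triangle. Qed.

Lemma Cmod_triangle_rev (a b : C) : Cmod a - Cmod b <= Cmod (a - b).
Proof.
  replace a with ((a - b) + b)%C at 1 by ring.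
  generalize (Cmod_triangle (a - b) b); lra.
Qed.

Lemma Re_le_Cmod (z : C) : Re z <= Cmod z.
Proof. eapply Rle_trans; [apply Rle_abs | apply re_le_Cmod]. Qed.

Lemma Rabs_Re_le_Cmod (z : C) : Rabs (fst z) <= Cmod z.
Proof. eapply Rle_trans; [apply Rmax_l | apply Rmax_Cmod]. Qed.

Lemma Rabs_Im_le_Cmod (z : C) : Rabs (snd z) <= Cmod z.
Proof. eapply Rle_trans; [apply Rmax_r | apply Rmax_Cmod]. Qed.

Lemma Cmod_le_Re_Im (z : C) : Cmod z <= Rabs (fst z) + Rabs (snd z).
Proof.
  destruct z as [x y]; simpl.
  replace ((x, y) : C) with (RtoC x + Ci * RtoC y)%C.
  - eapply Rle_trans; [apply Cmod_triangle|].
    rewrite Cmod_mult, Cmod_Ci, !Cmod_R. lra.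
  - apply injective_projections; simpl; ring.
Qed.

(** The balls of the uniform structure are squares; squares and discs contain each other up to the
    factor sqrt 2. *)
Lemma locally_Cmod (z : C) (P : C -> Prop) :
  locally z P <-> exists d, 0 < d /\ forall w, Cmod (w - z) < d -> P w.
Proof.
  split.
  - intros [e H]. exists e. split; [apply cond_pos|].
    intros w Hw. apply H. apply C_NormedModule_mixin_compat1. exact Hw.
  - intros [d [Hd H]].
    assert (Hs : 0 < sqrt 2) by (apply sqrt_lt_R0; lra).
    assert (Hd2 : 0 < d / sqrt 2) by (apply Rdiv_lt_0_compat; lra).
    exists (mkposreal _ Hd2). intros w Hw. apply H.
    apply C_NormedModule_mixin_compat2 in Hw.
    simpl in Hw. replace (sqrt 2 * (d / sqrt 2)) with d in Hw by (field; lra).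
    exact Hw.
Qed.

Definition ccont (f : C -> C) (z : C) : Prop :=
  forall e, 0 < e -> exists d, 0 < d /\
    forall w, Cmod (w - z) < d -> Cmod (f w - f z) < e.

Lemma ccont_const (c z : C) : ccont (fun _ => c) z.
Proof.
  intros e He. exists 1. split; [lra|]. intros w _.
  replace (c - c)%C with (RtoC 0) by ring. rewrite Cmod_0; lra.
Qed.

Lemma ccont_id (z : C) : ccont (fun w => w) z.
Proof. intros e He. exists e. auto. Qed.

Lemma ccont_plus (f g : C -> C) (z : C) :
  ccont f z -> ccont g z -> ccont (fun w => f w + g w)%C z.
Proof.
  intros Hf Hg e He.
  destruct (Hf (e / 2)) as [d1 [Hd1 H1]]; [lra|].
  destruct (Hg (e / 2)) as [d2 [Hd2 H2]]; [lra|].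
  exists (Rmin d1 d2). split; [apply Rmin_pos; lra|].
  intros w Hw.
  replace (f w + g w - (f z + g z))%C with ((f w - f z) + (g w - g z))%C by ring.
  eapply Rle_lt_trans; [apply Cmod_triangle|].
  specialize (H1 w ltac:(eapply Rlt_le_trans; [exact Hw|apply Rmin_l])).
  specialize (H2 w ltac:(eapply Rlt_le_trans; [exact Hw|apply Rmin_r])). lra.
Qed.

Lemma ccont_mult (f g : C -> C) (z : C) :
  ccont f z -> ccont g z -> ccont (fun w => f w * g w)%C z.
Proof.
  intros Hf Hg e He.
  set (A := Cmod (f z) + 1). set (B := Cmod (g z) + 1).
  assert (HA : 0 < A) by (unfold A; generalize (Cmod_ge_0 (f z)); lra).
  assert (HB : 0 < B) by (unfold B; generalize (Cmod_ge_0 (g z)); lra).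
  destruct (Hf (e / (2 * B))) as [d1 [Hd1 H1]]; [apply Rdiv_lt_0_compat; lra|].
  destruct (Hg (Rmin 1 (e / (2 * A)))) as [d2 [Hd2 H2]].
  { apply Rmin_pos; [lra|apply Rdiv_lt_0_compat; lra]. }
  exists (Rmin d1 d2). split; [apply Rmin_pos; lra|].
  intros w Hw.
  specialize (H1 w ltac:(eapply Rlt_le_trans; [exact Hw|apply Rmin_l])).
  specialize (H2 w ltac:(eapply Rlt_le_trans; [exact Hw|apply Rmin_r])).
  replace (f w * g w - f z * g z)%C
    with ((f w - f z) * g w + f z * (g w - g z))%C by ring.
  eapply Rle_lt_trans; [apply Cmod_triangle|]. rewrite !Cmod_mult.
  assert (Hgw : Cmod (g w) <= B).
  { replace (g w) with ((g w - g z) + g z)%C by ring.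
    eapply Rle_trans; [apply Cmod_triangle|]. unfold B.
    generalize (Rmin_l 1 (e / (2 * A))); lra. }
  assert (H2' : Cmod (g w - g z) < e / (2 * A))
    by (generalize (Rmin_r 1 (e / (2 * A))); lra).
  assert (E1 : Cmod (f w - f z) * Cmod (g w) <= e / (2 * B) * B).
  { apply Rmult_le_compat; try apply Cmod_ge_0; lra. }
  assert (E2 : Cmod (f z) * Cmod (g w - g z) < A * (e / (2 * A))).
  { apply Rle_lt_trans with (Cmod (f z) * (e / (2 * A))).
    - apply Rmult_le_compat_l; [apply Cmod_ge_0|lra].
    - apply Rmult_lt_compat_r; [|unfold A; lra].
      apply Rdiv_lt_0_compat; lra. }
  replace (e / (2 * B) * B) with (e / 2) in E1 by (field; lra).
  replace (A * (e / (2 * A))) with (e / 2) in E2 by (field; lra).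
  lra.
Qed.

Lemma ccont_neq0 (f : C -> C) (z : C) :
  ccont f z -> f z <> RtoC 0 ->
  exists d, 0 < d /\ forall w, Cmod (w - z) < d -> Cmod (f z) / 2 < Cmod (f w).
Proof.
  intros Hf Hz. apply Cmod_gt_0 in Hz.
  destruct (Hf (Cmod (f z) / 2)) as [d [Hd H]]; [lra|].
  exists d. split; [exact Hd|]. intros w Hw. specialize (H w Hw).
  rewrite Cmod_minus_sym in H. generalize (Cmod_triangle_rev (f z) (f w)); lra.
Qed.

Lemma ccont_inv (f : C -> C) (z : C) :
  ccont f z -> f z <> RtoC 0 -> ccont (fun w => / f w)%C z.
Proof.
  intros Hf Hz e He.
  destruct (ccont_neq0 f z Hf Hz) as [d1 [Hd1 H1]].
  pose proof (proj1 (Cmod_gt_0 _) Hz) as Hm. set (m := Cmod (f z)) in *.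
  destruct (Hf (e * (m * m / 2))) as [d2 [Hd2 H2]].
  { apply Rmult_lt_0_compat; nra. }
  exists (Rmin d1 d2). split; [apply Rmin_pos; lra|].
  intros w Hw.
  specialize (H1 w ltac:(eapply Rlt_le_trans; [exact Hw|apply Rmin_l])).
  specialize (H2 w ltac:(eapply Rlt_le_trans; [exact Hw|apply Rmin_r])).
  assert (Hw0 : f w <> RtoC 0) by (apply Cmod_gt_0; lra).
  replace (/ f w - / f z)%C with ((f z - f w) / (f w * f z))%C
    by (field; split; assumption).
  rewrite Cmod_div by (apply Cmult_neq_0; assumption).
  rewrite Cmod_mult, Cmod_minus_sym. fold m.
  apply Rmult_lt_reg_r with (Cmod (f w) * m); [nra|].
  unfold Rdiv. rewrite Rmult_assoc, Rinv_l, Rmult_1_r by nra.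
  eapply Rlt_le_trans; [exact H2|].
  apply Rmult_le_compat_l; [lra|]. nra.
Qed.

(* Caratheodory's form of complex differentiability: products and inverses
   reduce to the continuity of products and inverses. *)
Definition cder (h : C -> C) (z l : C) : Prop :=
  exists phi, ccont phi z /\ phi z = l /\
    exists d, 0 < d /\ forall w, Cmod (w - z) < d ->
      (h w - h z = (w - z) * phi w)%C.

Lemma ccont_ext_loc (f g : C -> C) (z : C) :
  (exists d, 0 < d /\ forall w, Cmod (w - z) < d -> f w = g w) ->
  ccont f z -> ccont g z.
Proof.
  intros [d0 [Hd0 E]] Hf e He. destruct (Hf e He) as [d [Hd H]].
  exists (Rmin d0 d). split; [apply Rmin_pos; lra|]. intros w Hw.
  rewrite <- !E.
  - apply H. eapply Rlt_le_trans; [exact Hw|apply Rmin_r].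
  - replace (z - z)%C with (RtoC 0) by ring. rewrite Cmod_0; lra.
  - eapply Rlt_le_trans; [exact Hw|apply Rmin_l].
Qed.

Lemma cder_cont (h : C -> C) (z l : C) : cder h z l -> ccont h z.
Proof.
  intros [phi [Hc [_ [d [Hd E]]]]].
  apply ccont_ext_loc with (fun w => h z + (w + - z) * phi w)%C.
  - exists d. split; [exact Hd|]. intros w Hw.
    change (w + - z)%C with (w - z)%C. rewrite <- E by exact Hw. ring.
  - apply ccont_plus; [apply ccont_const|].
    apply ccont_mult; [|exact Hc].
    apply ccont_plus; [apply ccont_id|apply ccont_const].
Qed.

Lemma cder_const (c z : C) : cder (fun _ => c) z 0.
Proof.
  exists (fun _ => RtoC 0). split; [apply ccont_const|]. split; [reflexivity|].
  exists 1. split; [lra|]. intros. ring.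
Qed.

Lemma cder_id (z : C) : cder (fun w => w) z 1.
Proof.
  exists (fun _ => RtoC 1). split; [apply ccont_const|]. split; [reflexivity|].
  exists 1. split; [lra|]. intros. ring.
Qed.

Lemma cder_plus (f g : C -> C) (z l m : C) :
  cder f z l -> cder g z m -> cder (fun w => f w + g w)%C z (l + m)%C.
Proof.
  intros [p [Hp [Ep [d1 [Hd1 E1]]]]] [q [Hq [Eq [d2 [Hd2 E2]]]]].
  exists (fun w => p w + q w)%C. split; [apply ccont_plus; assumption|].
  split; [congruence|].
  exists (Rmin d1 d2). split; [apply Rmin_pos; lra|]. intros w Hw.
  specialize (E1 w ltac:(eapply Rlt_le_trans; [exact Hw|apply Rmin_l])).
  specialize (E2 w ltac:(eapply Rlt_le_trans; [exact Hw|apply Rmin_r])).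
  replace (f w + g w - (f z + g z))%C with ((f w - f z) + (g w - g z))%C by ring.
  rewrite E1, E2. ring.
Qed.

Lemma cder_mult (f g : C -> C) (z l m : C) :
  cder f z l -> cder g z m ->
  cder (fun w => f w * g w)%C z (l * g z + f z * m)%C.
Proof.
  intros Hf Hg. pose proof (cder_cont _ _ _ Hg) as Hgc.
  destruct Hf as [p [Hp [Ep [d1 [Hd1 E1]]]]].
  destruct Hg as [q [Hq [Eq [d2 [Hd2 E2]]]]].
  exists (fun w => p w * g w + f z * q w)%C. split.
  { apply ccont_plus; apply ccont_mult; try assumption. apply ccont_const. }
  split; [congruence|].
  exists (Rmin d1 d2). split; [apply Rmin_pos; lra|]. intros w Hw.
  specialize (E1 w ltac:(eapply Rlt_le_trans; [exact Hw|apply Rmin_l])).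
  specialize (E2 w ltac:(eapply Rlt_le_trans; [exact Hw|apply Rmin_r])).
  replace (f w * g w - f z * g z)%C
    with ((f w - f z) * g w + f z * (g w - g z))%C by ring.
  rewrite E1, E2. ring.
Qed.

Lemma cder_inv (f : C -> C) (z l : C) :
  cder f z l -> f z <> RtoC 0 ->
  cder (fun w => / f w)%C z (- l * (/ f z * / f z))%C.
Proof.
  intros Hf Hz. pose proof (cder_cont _ _ _ Hf) as Hc.
  destruct (ccont_neq0 f z Hc Hz) as [d2 [Hd2 H2]].
  destruct Hf as [p [Hp [Ep [d1 [Hd1 E1]]]]].
  exists (fun w => (- (1) * p w) * (/ f w * / f z))%C. split.
  { apply ccont_mult; apply ccont_mult;
      try apply ccont_const; try assumption.
    apply ccont_inv; assumption. }
  split; [rewrite Ep; ring|].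
  exists (Rmin d1 d2). split; [apply Rmin_pos; lra|]. intros w Hw.
  specialize (E1 w ltac:(eapply Rlt_le_trans; [exact Hw|apply Rmin_l])).
  specialize (H2 w ltac:(eapply Rlt_le_trans; [exact Hw|apply Rmin_r])).
  assert (Hw0 : f w <> RtoC 0)
    by (apply Cmod_gt_0; generalize (Cmod_ge_0 (f z)); lra).
  replace (/ f w - / f z)%C with (- (f w - f z) * (/ f w * / f z))%C
    by (field; split; assumption).
  rewrite E1. ring.
Qed.

(** A quadratic remainder survives limits of partial sums, so this is the form in which power series
    deliver their derivative. *)
Lemma cder_quadratic (f : C -> C) (z l : C) (d M : R) :
  0 < d -> 0 <= M ->
  (forall w, Cmod (w - z) < d ->
     Cmod (f w - f z - (w - z) * l) <= M * Cmod (w - z) ^ 2) ->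
  cder f z l.
Proof.
  intros Hd HM H.
  (* The difference quotient, completed by [l] at [z]: its continuity at [z] is the
     differentiability of [f]. *)
  set (phi := fun w => if excluded_middle_informative (w = z) then l
                       else ((f w - f z) / (w - z))%C).
  assert (Hz : phi z = l)
    by (unfold phi; destruct (excluded_middle_informative (z = z)); tauto).
  exists phi. split; [|split; [exact Hz|]].
  - intros e He. exists (Rmin d (e / (M + 1))).
    split; [apply Rmin_pos; [lra|apply Rdiv_lt_0_compat; lra]|].
    intros w Hw. rewrite Hz. unfold phi.
    destruct (excluded_middle_informative (w = z)) as [->|Hne].
    { replace (l - l)%C with (RtoC 0) by ring. rewrite Cmod_0; lra. }
    assert (Hne' : (w - z <> 0)%C).
    { intros E. apply Hne. replace w with ((w - z) + z)%C by ring.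
      rewrite E. ring. }
    pose proof (proj1 (Cmod_gt_0 _) Hne') as Hp.
    replace ((f w - f z) / (w - z) - l)%C
      with ((f w - f z - (w - z) * l) / (w - z))%C by (field; exact Hne').
    rewrite Cmod_div by exact Hne'.
    specialize (H w ltac:(eapply Rlt_le_trans; [exact Hw|apply Rmin_l])).
    apply Rle_lt_trans with (M * Cmod (w - z)).
    + apply Rmult_le_reg_r with (Cmod (w - z)); [exact Hp|].
      unfold Rdiv. rewrite Rmult_assoc, Rinv_l, Rmult_1_r by lra.
      eapply Rle_trans; [exact H|]. right; ring.
    + assert (Hw2 : Cmod (w - z) < e / (M + 1))
        by (eapply Rlt_le_trans; [exact Hw|apply Rmin_r]).
      apply Rle_lt_trans with ((M + 1) * Cmod (w - z)); [nra|].
      replace e with ((M + 1) * (e / (M + 1))) by (field; lra).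
      apply Rmult_lt_compat_l; lra.
  - exists 1. split; [lra|]. intros w _. unfold phi.
    destruct (excluded_middle_informative (w = z)) as [->|Hne]; [ring|].
    field. intros E. apply Hne. replace w with ((w - z) + z)%C by ring.
    rewrite E. ring.
Qed.

Lemma cder_is_derive (f : C -> C) (z l : C) :
  cder f z l -> is_derive (K := C_AbsRing) (V := C_NormedModule) f z l.
Proof.
  intros [p [Hp [Ep [d1 [Hd1 E1]]]]].
  split; [apply is_linear_scal_l|].
  intros x Hx. 
  apply (is_filter_lim_locally_unique (V := AbsRing_NormedModule C_AbsRing)) in Hx.
  subst x.
  intros e. apply (locally_C z).
  apply locally_Cmod. destruct (Hp e (cond_pos e)) as [d2 [Hd2 H2]].
  exists (Rmin d1 d2). split; [apply Rmin_pos; lra|]. intros w Hw.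
  specialize (E1 w ltac:(eapply Rlt_le_trans; [exact Hw|apply Rmin_l])).
  specialize (H2 w ltac:(eapply Rlt_le_trans; [exact Hw|apply Rmin_r])).
  change (Cmod ((f w - f z) - (w - z) * l) <= e * Cmod (w - z)).
  rewrite E1, <- Ep.
  replace ((w - z) * p w - (w - z) * p z)%C with ((w - z) * (p w - p z))%C by ring.
  rewrite Cmod_mult, Rmult_comm. apply Rmult_le_compat_r; [apply Cmod_ge_0|lra].
Qed.

Lemma is_derive_ccont (f : C -> C) (z l : C) :
  is_derive (K := C_AbsRing) (V := C_NormedModule) f z l -> ccont f z.
Proof.
  intros [_ H]. specialize (H z (fun P HP => HP) (mkposreal 1 Rlt_0_1)).
  apply (locally_C z) in H. apply locally_Cmod in H. destruct H as [d [Hd H]].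
  assert (HL : 0 < 1 + Cmod l) by (generalize (Cmod_ge_0 l); lra).
  intros e He. exists (Rmin d (e / (1 + Cmod l))).
  split; [apply Rmin_pos; [lra|apply Rdiv_lt_0_compat; lra]|]. intros w Hw.
  specialize (H w ltac:(eapply Rlt_le_trans; [exact Hw|apply Rmin_l])).
  change (Cmod ((f w - f z) - (w - z) * l) <= 1 * Cmod (w - z)) in H.
  assert (Hw2 : Cmod (w - z) < e / (1 + Cmod l))
    by (eapply Rlt_le_trans; [exact Hw|apply Rmin_r]).
  replace (f w - f z)%C with ((f w - f z - (w - z) * l) + (w - z) * l)%C by ring.
  eapply Rle_lt_trans; [apply Cmod_triangle|]. rewrite Cmod_mult.
  apply Rle_lt_trans with ((1 + Cmod l) * Cmod (w - z)); [nra|].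
  replace e with ((1 + Cmod l) * (e / (1 + Cmod l))) by (field; lra).
  apply Rmult_lt_compat_l; lra.
Qed.

(** * Power series on the unit disc *)

Definition clim (u : nat -> C) (l : C) : Prop :=
  is_lim_seq (fun n => Cmod (u n - l)) 0.

Lemma is_lim_seq_squeeze0 (u v : nat -> R) :
  (forall n, 0 <= u n <= v n) -> is_lim_seq v 0 -> is_lim_seq u 0.
Proof.
  intros H Hv. apply is_lim_seq_le_le with (fun _ => 0) v;
    [exact H|apply is_lim_seq_const|exact Hv].
Qed.

Lemma clim_ext (u v : nat -> C) (l : C) :
  (forall n, u n = v n) -> clim u l -> clim v l.
Proof. intros E. apply is_lim_seq_ext. intros n. now rewrite E. Qed.

Lemma clim_const (c : C) : clim (fun _ => c) c.
Proof.
  apply is_lim_seq_ext with (fun _ => 0); [|apply is_lim_seq_const].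
  intros _. replace (c - c)%C with (RtoC 0) by ring. now rewrite Cmod_0.
Qed.

Lemma clim_plus (u v : nat -> C) (l m : C) :
  clim u l -> clim v m -> clim (fun n => u n + v n)%C (l + m)%C.
Proof.
  intros Hu Hv. apply is_lim_seq_squeeze0
    with (fun n => Cmod (u n - l) + Cmod (v n - m)).
  - intros n. split; [apply Cmod_ge_0|].
    replace (u n + v n - (l + m))%C with ((u n - l) + (v n - m))%C by ring.
    apply Cmod_triangle.
  - replace (Finite 0) with (Finite (0 + 0)) by (f_equal; ring).
    apply (is_lim_seq_plus' _ _ 0 0); assumption.
Qed.

Lemma clim_scal (c : C) (u : nat -> C) (l : C) :
  clim u l -> clim (fun n => c * u n)%C (c * l)%C.
Proof.
  intros Hu. apply is_lim_seq_ext with (fun n => Cmod c * Cmod (u n - l)).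
  - intros n. rewrite <- Cmod_mult. f_equal. ring.
  - replace (Finite 0) with (Rbar_mult (Cmod c) 0) by (simpl; f_equal; ring).
    apply is_lim_seq_scal_l. exact Hu.
Qed.

Lemma clim_incr_1 (u : nat -> C) (l : C) :
  clim u l <-> clim (fun n => u (S n)) l.
Proof. apply (is_lim_seq_incr_1 (fun n => Cmod (u n - l))). Qed.

Lemma clim_subseq (u : nat -> C) (l : C) (d : nat -> nat) :
  (forall n, (d n < d (S n))%nat) -> clim u l -> clim (fun n => u (d n)) l.
Proof.
  intros Hd Hu. apply (is_lim_seq_subseq (fun n => Cmod (u n - l)) 0 d);
    [|exact Hu].
  apply eventually_subseq. exact Hd.
Qed.

Lemma clim_bound (u : nat -> C) (l w : C) (K : R) (N : nat) :
  clim u l -> (forall n, (N <= n)%nat -> Cmod (u n - w) <= K) ->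
  Cmod (l - w) <= K.
Proof.
  intros Hu H.
  assert (HL : is_lim_seq (fun n => Cmod (u n - l) + K) (0 + K))
    by (apply (is_lim_seq_plus' _ _ 0 K); [exact Hu|apply is_lim_seq_const]).
  rewrite Rplus_0_l in HL.
  apply (is_lim_seq_le_loc (fun _ => Cmod (l - w))
           (fun n => Cmod (u n - l) + K) (Cmod (l - w)) K).
  - exists N. intros n Hn. specialize (H n Hn).
    replace (l - w)%C with (- (u n - l) + (u n - w))%C by ring.
    eapply Rle_trans; [apply Cmod_triangle|]. rewrite Cmod_opp. lra.
  - apply is_lim_seq_const.
  - exact HL.
Qed.

Lemma clim_unique (u : nat -> C) (l m : C) : clim u l -> clim u m -> l = m.
Proof.
  intros Hl Hm.
  assert (Cmod (l - m) <= 0).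
  { assert (HL : is_lim_seq (fun n => Cmod (u n - l) + Cmod (u n - m)) (0 + 0))
      by (apply (is_lim_seq_plus' _ _ 0 0); assumption).
    rewrite Rplus_0_l in HL.
    apply (is_lim_seq_le (fun _ => Cmod (l - m))
             (fun n => Cmod (u n - l) + Cmod (u n - m)) (Cmod (l - m)) 0);
      [|apply is_lim_seq_const|exact HL].
    intros n. replace (l - m)%C with (- (u n - l) + (u n - m))%C by ring.
    eapply Rle_trans; [apply Cmod_triangle|]. rewrite Cmod_opp. lra. }
  assert (E : (l - m)%C = 0)
    by (apply Cmod_eq_0; generalize (Cmod_ge_0 (l - m)); lra).
  replace l with ((l - m) + m)%C by ring. rewrite E. ring.
Qed.

Lemma ex_lim_geometric (u : nat -> R) (M q : R) :
  0 <= q < 1 -> (forall n, Rabs (u (S n) - u n) <= M * q ^ n) ->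
  exists l, is_lim_seq u (Finite l).
Proof.
  intros Hq H.
  assert (Hex : ex_series (fun n => u (S n) - u n)).
  { apply (ex_series_le (K := R_AbsRing) (V := R_CompleteNormedModule) _
             (fun n => M * q ^ n) H).
    apply (ex_series_scal_l M (fun n => q ^ n)).
    apply ex_series_geom. rewrite Rabs_pos_eq; lra. }
  destruct Hex as [l Hl]. exists (u 0%nat + l).
  apply is_lim_seq_incr_1.
  apply is_lim_seq_ext with (fun n => u 0%nat + sum_n (fun n => u (S n) - u n) n).
  - intros n. induction n as [|n IH].
    + rewrite sum_O. ring.
    + rewrite sum_Sn. unfold plus; simpl. rewrite <- Rplus_assoc, IH. ring.
  - apply (is_lim_seq_plus' _ _ (u 0%nat) l); [apply is_lim_seq_const|exact Hl].
Qed.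

Lemma clim_geometric (u : nat -> C) (M q : R) :
  0 <= M -> 0 <= q < 1 -> (forall n, Cmod (u (S n) - u n) <= M * q ^ n) ->
  exists l, clim u l.
Proof.
  intros HM Hq H.
  destruct (ex_lim_geometric (fun n => fst (u n)) M q Hq) as [a Ha].
  { intros n. eapply Rle_trans; [|apply (H n)]. apply (Rabs_Re_le_Cmod (u (S n) - u n)). }
  destruct (ex_lim_geometric (fun n => snd (u n)) M q Hq) as [b Hb].
  { intros n. eapply Rle_trans; [|apply (H n)]. apply (Rabs_Im_le_Cmod (u (S n) - u n)). }
  exists (a, b). apply is_lim_seq_squeeze0
    with (fun n => Rabs (fst (u n) - a) + Rabs (snd (u n) - b)).
  - intros n. split; [apply Cmod_ge_0|]. apply (Cmod_le_Re_Im (u n - (a, b))).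
  - replace (Finite 0) with (Finite (0 + 0)) by (f_equal; ring).
    apply (is_lim_seq_plus' _ _ 0 0); apply -> is_lim_seq_abs_0.
    + replace 0 with (a - a) by ring.
      apply (is_lim_seq_minus' _ _ a a); [exact Ha|apply is_lim_seq_const].
    + replace 0 with (b - b) by ring.
      apply (is_lim_seq_minus' _ _ b b); [exact Hb|apply is_lim_seq_const].
Qed.

Fixpoint psum (a : nat -> C) (z : C) (n : nat) : C :=
  match n with
  | O => 0
  | S m => (psum a z m + a m * z ^ m)%C
  end.

(** A radius of convergence of at least 1, put without a limsup so that shifts and derivatives
    inherit it easily. *)
Definition coef_bd (a : nat -> C) : Prop :=
  forall s, 0 < s < 1 -> exists M, 0 <= M /\ forall n, Cmod (a n) * s ^ n <= M.

Definition has_pseries (f : C -> C) (a : nat -> C) : Prop :=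
  coef_bd a /\ forall z, Cmod z < 1 -> clim (psum a z) (f z).

(** The bound at the larger radius s = (1 + r) / 2 leaves the ratio q = r / s < 1. *)
Lemma coef_bd_geom (a : nat -> C) (r : R) :
  coef_bd a -> 0 <= r < 1 ->
  exists M q, 0 <= M /\ 0 <= q < 1 /\
    forall n, Cmod (a n) * r ^ n <= M * q ^ n.
Proof.
  intros Ha Hr. destruct (Ha ((1 + r) / 2)) as [M [HM H]]; [lra|].
  set (s := (1 + r) / 2) in *. assert (Hs : 0 < s < 1) by (unfold s; lra).
  exists M, (r / s). split; [exact HM|]. split.
  { split; [apply Rdiv_le_0_compat; lra|].
    apply Rmult_lt_reg_r with s; [lra|]. unfold Rdiv.
    rewrite Rmult_assoc, Rinv_l by lra. unfold s; lra. }
  intros n. replace (r ^ n) with (s ^ n * (r / s) ^ n).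
  - rewrite <- Rmult_assoc. apply Rmult_le_compat_r; [|apply H].
    apply pow_le. apply Rdiv_le_0_compat; lra.
  - rewrite <- Rpow_mult_distr. f_equal. field. lra.
Qed.

Lemma coef_bd_succ_mult (a : nat -> C) :
  coef_bd a -> coef_bd (fun n => INR (S n) * a n)%C.
Proof.
  intros Ha s Hs. destruct (coef_bd_geom a s Ha) as [M [q [HM [Hq H]]]]; [lra|].
  exists (M / (1 - q)). split; [apply Rdiv_le_0_compat; lra|].
  intros n. rewrite Cmod_mult, Cmod_R, Rabs_pos_eq by apply pos_INR.
  (* This says (k + 1) q^k <= 1 + q + ... + q^k, multiplied by 1 - q. *)
  assert (G : forall k, INR (S k) * q ^ k * (1 - q) + q ^ (S k) <= 1).
  { induction k as [|k IH]; [simpl; lra|].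
    replace (INR (S (S k)) * q ^ S k * (1 - q) + q ^ S (S k))
      with (q * (INR (S k) * q ^ k * (1 - q) + q ^ S k) + q ^ S k * (1 - q))
      by (rewrite (S_INR (S k)); simpl (q ^ _); ring).
    assert (0 <= q ^ S k <= 1).
    { split; [apply pow_le; lra|].
      rewrite <- (pow1 (S k)). apply pow_incr; lra. }
    nra. }
  specialize (G n). specialize (H n).
  apply Rmult_le_reg_r with (1 - q); [lra|].
  unfold Rdiv. rewrite (Rmult_assoc M), Rinv_l, Rmult_1_r by lra.
  pose proof (pow_le q (S n) ltac:(lra)).
  pose proof (pos_INR (S n)).
  apply Rle_trans with (INR (S n) * (M * q ^ n) * (1 - q)).
  - apply Rmult_le_compat_r; [lra|]. rewrite Rmult_assoc.
    apply Rmult_le_compat_l; lra.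
  - replace (INR (S n) * (M * q ^ n) * (1 - q))
      with (M * (INR (S n) * q ^ n * (1 - q))) by ring.
    rewrite <- (Rmult_1_r M) at 2. apply Rmult_le_compat_l; lra.
Qed.

Lemma coef_bd_shift (a : nat -> C) (p : nat) :
  coef_bd a -> coef_bd (fun n => a (n + p)%nat).
Proof.
  intros Ha s Hs. destruct (Ha s Hs) as [M [HM H]].
  assert (Hp : 0 < s ^ p) by (apply pow_lt; lra).
  exists (M / s ^ p). split; [apply Rdiv_le_0_compat; lra|].
  intros n. apply Rmult_le_reg_r with (s ^ p); [exact Hp|].
  unfold Rdiv. rewrite (Rmult_assoc M), Rinv_l, Rmult_1_r by lra.
  rewrite Rmult_assoc, <- pow_add. apply H.
Qed.

Lemma psum_step (a : nat -> C) (z : C) (n : nat) :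
  Cmod (psum a z (S n) - psum a z n) = Cmod (a n) * Cmod z ^ n.
Proof.
  simpl. replace (psum a z n + a n * z ^ n - psum a z n)%C with (a n * z ^ n)%C by ring.
  now rewrite Cmod_mult, Cmod_pow.
Qed.

Lemma psum_geom_bound (a : nat -> C) (z : C) (M q : R) :
  0 <= M -> 0 <= q < 1 -> (forall n, Cmod (a n) * Cmod z ^ n <= M * q ^ n) ->
  forall n, Cmod (psum a z n) <= M / (1 - q).
Proof.
  intros HM Hq H n.
  assert (G : Cmod (psum a z n) <= M * (1 - q ^ n) / (1 - q)).
  { induction n as [|n IH].
    - simpl. rewrite Cmod_0. right. field. lra.
    - simpl psum. eapply Rle_trans; [apply Cmod_triangle|].
      rewrite Cmod_mult, Cmod_pow. specialize (H n).
      eapply Rle_trans; [apply Rplus_le_compat; [apply IH|apply H]|].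
      right. simpl. field. lra. }
  eapply Rle_trans; [exact G|]. apply Rmult_le_compat_r.
  - left; apply Rinv_0_lt_compat; lra.
  - pose proof (pow_le q n ltac:(lra)). nra.
Qed.

(** The limit is chosen point by point; outside the disc the condition on it is vacuous. *)
Lemma has_pseries_exists (a : nat -> C) :
  coef_bd a -> exists f, has_pseries f a.
Proof.
  intros Ha.
  assert (E : forall z, exists l, Cmod z < 1 -> clim (psum a z) l).
  { intros z. destruct (Rlt_dec (Cmod z) 1) as [Hz|Hz];
      [|exists 0; intros; contradiction].
    destruct (coef_bd_geom a (Cmod z) Ha) as [M [q [HM [Hq H]]]];
      [split; [apply Cmod_ge_0|exact Hz]|].
    destruct (clim_geometric (psum a z) M q HM Hq) as [l Hl].
    { intros n. rewrite psum_step. apply H. }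
    exists l; auto. }
  exists (fun z => proj1_sig (constructive_indefinite_description _ (E z))).
  split; [exact Ha|]. intros z Hz.
  exact (proj2_sig (constructive_indefinite_description _ (E z)) Hz).
Qed.

(** The quotient r^(k+1) / r^2 stands for r^(k-1) and avoids truncated subtraction. In the induction
    the coefficient N^2 grows by N, within (N + 1)^2. *)
Lemma Cpow_first_order (w z : C) (r : R) (k : nat) :
  0 < r -> Cmod w <= r -> Cmod z <= r ->
  Cmod (w ^ S k - z ^ S k - INR (S k) * (w - z) * z ^ k)
    <= INR (S k) ^ 2 * r ^ S k / r ^ 2 * Cmod (w - z) ^ 2.
Proof.
  intros Hr Hw Hz. induction k as [|k IH].
  - replace (w ^ 1 - z ^ 1 - INR 1 * (w - z) * z ^ 0)%C with (RtoC 0)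
      by (simpl; ring).
    rewrite Cmod_0. apply Rmult_le_pos; [|apply pow2_ge_0].
    apply Rdiv_le_0_compat; [|apply pow_lt; lra].
    apply Rmult_le_pos; [apply pow2_ge_0|apply pow_le; lra].
  - replace (w ^ S (S k) - z ^ S (S k) - INR (S (S k)) * (w - z) * z ^ S k)%C
      with (w * (w ^ S k - z ^ S k - INR (S k) * (w - z) * z ^ k)
            + INR (S k) * (w - z) * (w - z) * z ^ k)%C
      by (rewrite (S_INR (S k)), RtoC_plus, !Cpow_S; ring).
    eapply Rle_trans; [apply Cmod_triangle|].
    rewrite !Cmod_mult, Cmod_R, Rabs_pos_eq, Cmod_pow by apply pos_INR.
    set (h := Cmod (w - z)) in *. set (N := INR (S k)) in *.
    assert (HN : 0 <= N) by apply pos_INR.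
    assert (Hzk : Cmod z ^ k <= r ^ k)
      by (apply pow_incr; split; [apply Cmod_ge_0|exact Hz]).
    assert (E1 : Cmod w * Cmod (w ^ S k - z ^ S k - N * (w - z) * z ^ k)
                 <= r * (N ^ 2 * r ^ S k / r ^ 2 * h ^ 2))
      by (apply Rmult_le_compat; try apply Cmod_ge_0; assumption).
    assert (E2 : N * h * h * Cmod z ^ k <= N * h * h * r ^ k).
    { apply Rmult_le_compat_l; [|exact Hzk].
      pose proof (Cmod_ge_0 (w - z)). fold h in H.
      repeat apply Rmult_le_pos; assumption. }
    eapply Rle_trans; [apply Rplus_le_compat; [exact E1|exact E2]|].
    replace (INR (S (S k))) with (N + 1) by (unfold N; rewrite (S_INR (S k)); ring).
    replace (r * (N ^ 2 * r ^ S k / r ^ 2 * h ^ 2) + N * h * h * r ^ k)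
      with ((N ^ 2 + N) * (r ^ S (S k) / r ^ 2 * h ^ 2)) by (simpl; field; lra).
    replace ((N + 1) ^ 2 * r ^ S (S k) / r ^ 2 * h ^ 2)
      with ((N + 1) ^ 2 * (r ^ S (S k) / r ^ 2 * h ^ 2)) by (simpl; field; lra).
    apply Rmult_le_compat_r; [|nra].
    apply Rmult_le_pos; [|apply pow2_ge_0].
    apply Rdiv_le_0_compat; [apply pow_le; lra|apply pow_lt; lra].
Qed.

Definition ps_deriv (a : nat -> C) (n : nat) : C := (INR (S n) * a (S n))%C.

Lemma coef_bd_deriv (a : nat -> C) : coef_bd a -> coef_bd (ps_deriv a).
Proof.
  intros Ha. apply (coef_bd_shift _ 1) in Ha as Hs.
  apply coef_bd_succ_mult in Hs. intros s H.
  destruct (Hs s H) as [M [HM B]]. exists M. split; [exact HM|].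
  intros n. specialize (B n). unfold ps_deriv.
  replace (n + 1)%nat with (S n) in B by lia. exact B.
Qed.

(** The partial sums satisfy the quadratic remainder estimate with a constant independent of n,
    which then passes to the limit. *)
Lemma has_pseries_cder (f g : C -> C) (a : nat -> C) (z : C) :
  has_pseries f a -> has_pseries g (ps_deriv a) -> Cmod z < 1 ->
  cder f z (g z).
Proof.
  intros [Ha Hf] [_ Hg] Hz.
  set (r := (1 + Cmod z) / 2).
  assert (Hr : 0 < r < 1) by (unfold r; generalize (Cmod_ge_0 z); lra).
  (* Two factors n + 1 are absorbed, since [Cpow_first_order] costs the square of the exponent. *)
  destruct (coef_bd_geom _ r
              (coef_bd_succ_mult _ (coef_bd_succ_mult _ Ha)))
    as [M [q [HM [Hq H]]]]; [lra|].
  apply cder_quadratic with (r - Cmod z) (M / (1 - q) / r ^ 2).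
  { unfold r; lra. }
  { repeat apply Rdiv_le_0_compat; try lra. apply pow_lt; lra. }
  intros w Hw.
  assert (Hwr : Cmod w <= r).
  { replace w with ((w - z) + z)%C by ring.
    eapply Rle_trans; [apply Cmod_triangle|]. lra. }
  assert (Hzr : Cmod z <= r) by (unfold r; lra).
  set (h := Cmod (w - z)) in *.
  replace (f w - f z - (w - z) * g z)%C
    with ((f w + (- (1) * f z + - (w - z) * g z)) - 0)%C by ring.
  (* The sums of [a] have one term more than those of [ps_deriv a], because differentiation lowers
     the degree by one. *)
  apply (clim_bound
    (fun n => psum a w (S n) + (- (1) * psum a z (S n)
                + - (w - z) * psum (ps_deriv a) z n))%C _ _ _ 0).
  { apply clim_plus; [apply clim_incr_1 with (u := psum a w); apply Hf; lra|].
    apply clim_plus; apply clim_scal;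
      [apply clim_incr_1 with (u := psum a z); apply Hf; lra|apply Hg; lra]. }
  intros n _.
  replace (psum a w (S n) + (- (1) * psum a z (S n)
            + - (w - z) * psum (ps_deriv a) z n) - 0)%C
    with (psum a w (S n) - psum a z (S n) - (w - z) * psum (ps_deriv a) z n)%C
    by ring.
  assert (G : Cmod (psum a w (S n) - psum a z (S n)
                    - (w - z) * psum (ps_deriv a) z n)
              <= M * (1 - q ^ S n) / (1 - q) / r ^ 2 * h ^ 2).
  { induction n as [|n IH].
    - replace (psum a w 1 - psum a z 1 - (w - z) * psum (ps_deriv a) z 0)%C
        with (RtoC 0) by (simpl; ring).
      rewrite Cmod_0. apply Rmult_le_pos; [|apply pow2_ge_0].
      apply Rdiv_le_0_compat; [|apply pow_lt; lra].
      apply Rdiv_le_0_compat; [|lra]. simpl. nra.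
    - replace (psum a w (S (S n)) - psum a z (S (S n))
               - (w - z) * psum (ps_deriv a) z (S n))%C
        with ((psum a w (S n) - psum a z (S n)
               - (w - z) * psum (ps_deriv a) z n)
              + a (S n) * (w ^ S n - z ^ S n - INR (S n) * (w - z) * z ^ n))%C
        by (cbn [psum]; unfold ps_deriv; ring).
      eapply Rle_trans; [apply Cmod_triangle|].
      rewrite Cmod_mult.
      assert (E : Cmod (a (S n))
                  * Cmod (w ^ S n - z ^ S n - INR (S n) * (w - z) * z ^ n)
                  <= M * q ^ S n / r ^ 2 * h ^ 2).
      { eapply Rle_trans;
          [apply Rmult_le_compat_l; [apply Cmod_ge_0|];
           apply (Cpow_first_order w z r n); lra|].
        fold h. specialize (H (S n)).
        rewrite !Cmod_mult, !Cmod_R, !Rabs_pos_eq in H by apply pos_INR.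
        replace (Cmod (a (S n)) * (INR (S n) ^ 2 * r ^ S n / r ^ 2 * h ^ 2))
          with (INR (S n) * (INR (S n) * Cmod (a (S n))) * r ^ S n * (h ^ 2 / r ^ 2))
          by (field; lra).
        replace (M * q ^ S n / r ^ 2 * h ^ 2) with (M * q ^ S n * (h ^ 2 / r ^ 2))
          by (field; lra).
        apply Rmult_le_compat_r;
          [apply Rdiv_le_0_compat; [apply pow2_ge_0|apply pow_lt; lra]|].
        eapply Rle_trans; [|exact H].
        apply Rmult_le_compat_r; [apply pow_le; lra|].
        assert (S1 : INR (S n) <= INR (S (S n))) by (apply le_INR; lia).
        pose proof (pos_INR (S n)). pose proof (Cmod_ge_0 (a (S n))).
        apply Rmult_le_compat; try nra. }
      eapply Rle_trans; [apply Rplus_le_compat; [exact IH|exact E]|].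
      right. simpl. field. lra. }
  eapply Rle_trans; [exact G|].
  apply Rmult_le_compat_r; [apply pow2_ge_0|].
  apply Rmult_le_compat_r; [left; apply Rinv_0_lt_compat, pow_lt; lra|].
  apply Rmult_le_compat_r; [left; apply Rinv_0_lt_compat; lra|].
  pose proof (pow_le q (S n) ltac:(lra)). nra.
Qed.

Lemma has_pseries_shift (f : C -> C) (a : nat -> C) (p : nat) :
  has_pseries f a ->
  exists g, has_pseries g (fun n => a (n + p)%nat) /\
    forall z, Cmod z < 1 -> f z = (psum a z p + z ^ p * g z)%C.
Proof.
  intros [Ha Hf].
  destruct (has_pseries_exists _ (coef_bd_shift a p Ha)) as [g Hg].
  exists g. split; [exact Hg|]. intros z Hz.
  assert (E : forall n, psum a z (n + p)
     = (psum a z p + z ^ p * psum (fun n => a (n + p)%nat) z n)%C).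
  { induction n as [|n IH]; [simpl; ring|].
    cbn [psum Nat.add]. rewrite IH, Cpow_add_r. ring. }
  apply clim_unique with (fun n => psum a z (n + p)).
  - apply (clim_subseq (psum a z) (f z) (fun n => (n + p)%nat));
      [intros; lia|apply Hf, Hz].
  - eapply clim_ext; [intros n; symmetry; apply E|].
    apply clim_plus; [apply clim_const|]. apply clim_scal. apply Hg, Hz.
Qed.

Lemma has_pseries_0 (f : C -> C) (a : nat -> C) :
  has_pseries f a -> f (RtoC 0) = a 0%nat.
Proof.
  intros [_ Hf]. specialize (Hf (RtoC 0)). rewrite Cmod_0 in Hf.
  specialize (Hf ltac:(lra)). apply clim_incr_1 in Hf.
  eapply clim_unique; [exact Hf|]. eapply clim_ext; [|apply clim_const].
  intros n. simpl. induction n as [|n IH]; [simpl; ring|].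
  cbn [psum]. rewrite <- IH, !Cpow_S. ring.
Qed.

Lemma has_pseries_minus_const (f : C -> C) (a : nat -> C) (c : C) :
  has_pseries f a ->
  has_pseries (fun z => f z - c)%C
    (fun n => match n with O => a O - c | S _ => a n end)%C.
Proof.
  intros [Ha Hf]. split.
  - intros s Hs. destruct (Ha s Hs) as [M [HM H]].
    exists (M + Cmod c). pose proof (Cmod_ge_0 c). split; [lra|].
    intros [|n].
    + specialize (H 0%nat). simpl in *. generalize (Cmod_triangle_minus (a 0%nat) c). lra.
    + specialize (H (S n)). lra.
  - intros z Hz. apply clim_incr_1.
    apply clim_ext with (fun n => psum a z (S n) + (- c))%C.
    + intros n. induction n as [|n IH]; [simpl; ring|].
      cbn [psum] in *. rewrite <- IH. ring.
    + apply (clim_plus (fun n => psum a z (S n)) (fun _ => (- c)%C));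
        [apply clim_incr_1 with (u := psum a z); auto|apply clim_const].
Qed.

(** Horner division: with c_n = sum_k a_(n+k) z0^k one has c_n = a_n + z0 c_(n+1) and c_0 = f(z0) =
    0, so the quotient has the coefficients c_(n+1). *)
Lemma has_pseries_divide (f : C -> C) (a : nat -> C) (z0 : C) :
  has_pseries f a -> Cmod z0 < 1 -> f z0 = RtoC 0 ->
  exists g b, has_pseries g b /\
    forall z, Cmod z < 1 -> f z = ((z - z0) * g z)%C.
Proof.
  intros [Ha Hf] Hz0 E0.
  assert (Hex : forall n, exists l, clim (psum (fun k => a (k + n)%nat) z0) l).
  { intros n. destruct (has_pseries_exists _ (coef_bd_shift a n Ha)) as [g [_ Hg]].
    exists (g z0). auto. }
  set (c := fun n => proj1_sig (constructive_indefinite_description _ (Hex n))).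
  assert (Hc : forall n, clim (psum (fun k => a (k + n)%nat) z0) (c n))
    by (intros n; exact (proj2_sig (constructive_indefinite_description _ (Hex n)))).
  clearbody c.
  assert (Hc0 : c 0%nat = RtoC 0).
  { rewrite <- E0. eapply clim_unique; [apply Hc|].
    eapply clim_ext; [|apply Hf, Hz0].
    intros n. induction n as [|n IH]; [reflexivity|].
    cbn [psum]. rewrite IH. now replace (n + 0)%nat with n by lia. }
  assert (Hrec : forall n, c n = (a n + z0 * c (S n))%C).
  { intros n. eapply clim_unique; [exact (proj1 (clim_incr_1 _ _) (Hc n))|].
    apply clim_ext with
      (fun m => a n + z0 * psum (fun k => a (k + S n)%nat) z0 m)%C.
    - intros m. induction m as [|m IH]; [simpl; ring|].
      cbn [psum] in *. rewrite <- IH.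
      replace (S m + n)%nat with (m + S n)%nat by lia. rewrite Cpow_S. ring.
    - apply clim_plus; [apply clim_const|]. apply clim_scal, Hc. }
  assert (Hcb : coef_bd c).
  { intros s Hs. set (t := Rmax s ((1 + Cmod z0) / 2)).
    assert (Hst : s <= t) by apply Rmax_l.
    assert (Hzt : Cmod z0 < t)
      by (eapply Rlt_le_trans; [|apply Rmax_r]; lra).
    assert (Ht : t < 1) by (apply Rmax_lub_lt; lra).
    destruct (Ha t) as [M [HM B]]; [lra|].
    assert (Hq : 0 <= Cmod z0 / t < 1).
    { split; [apply Rdiv_le_0_compat; [apply Cmod_ge_0|lra]|].
      apply Rmult_lt_reg_r with t; [lra|]. unfold Rdiv.
      rewrite Rmult_assoc, Rinv_l; lra. }
    exists (M / (1 - Cmod z0 / t)).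
    split; [apply Rdiv_le_0_compat; lra|]. intros n.
    assert (Htn : 0 < t ^ n) by (apply pow_lt; lra).
    assert (Hn : Cmod (c n) <= M / t ^ n / (1 - Cmod z0 / t)).
    { replace (c n) with (c n - 0)%C by ring.
      apply (clim_bound _ _ _ _ 0 (Hc n)). intros m _.
      replace (psum (fun k => a (k + n)%nat) z0 m - 0)%C
        with (psum (fun k => a (k + n)%nat) z0 m) by ring.
      apply psum_geom_bound; [apply Rdiv_le_0_compat; lra|exact Hq|].
      intros k. specialize (B (k + n)%nat). rewrite pow_add in B.
      apply Rmult_le_reg_r with (t ^ n * t ^ k);
        [apply Rmult_lt_0_compat; [lra|apply pow_lt; lra]|].
      unfold Rdiv at 2. rewrite Rpow_mult_distr, pow_inv.
      replace (M / t ^ n * (Cmod z0 ^ k * / t ^ k) * (t ^ n * t ^ k))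
        with (M * Cmod z0 ^ k)
        by (field; split; apply Rgt_not_eq; [apply pow_lt|]; lra).
      pose proof (pow_le (Cmod z0) k (Cmod_ge_0 _)).
      replace (Cmod (a (k + n)%nat) * Cmod z0 ^ k * (t ^ n * t ^ k))
        with (Cmod (a (k + n)%nat) * (t ^ k * t ^ n) * Cmod z0 ^ k) by ring.
      apply Rmult_le_compat_r; assumption. }
    assert (Hsn : 0 <= s ^ n <= t ^ n)
      by (split; [apply pow_le|apply pow_incr]; lra).
    eapply Rle_trans;
      [apply Rmult_le_compat; [apply Cmod_ge_0|lra|exact Hn|apply Hsn]|].
    right. field. split; lra. }
  assert (Hb : coef_bd (fun n => c (S n))).
  { intros s Hs. destruct (coef_bd_shift c 1 Hcb s Hs) as [M [HM B]].
    exists M. split; [exact HM|]. intros n. specialize (B n).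
    now replace (n + 1)%nat with (S n) in B by lia. }
  destruct (has_pseries_exists _ Hb) as [g Hg].
  exists g, (fun n => c (S n)). split; [exact Hg|]. intros z Hz.
  eapply clim_unique; [apply Hf, Hz|].
  (* Telescoping leaves the boundary term - c_n z^n, which tends to 0 in the disc. *)
  apply clim_ext with (fun n => (z - z0) * psum (fun n => c (S n)) z n
                                + (- (1)) * (c n * z ^ n))%C.
  - intros n. induction n as [|n IH].
    + simpl. rewrite Hc0. ring.
    + cbn [psum]. rewrite <- IH, (Hrec n), Cpow_S. ring.
  - replace ((z - z0) * g z)%C with ((z - z0) * g z + (- (1)) * 0)%C by ring.
    apply clim_plus; apply clim_scal; [apply Hg, Hz|].
    destruct (coef_bd_geom c (Cmod z) Hcb) as [M [q [HM [Hq B]]]];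
      [split; [apply Cmod_ge_0|exact Hz]|].
    apply is_lim_seq_squeeze0 with (fun n => M * q ^ n).
    + intros n. split; [apply Cmod_ge_0|].
      replace (c n * z ^ n - 0)%C with (c n * z ^ n)%C by ring.
      rewrite Cmod_mult, Cmod_pow. apply B.
    + replace (Finite 0) with (Rbar_mult M 0) by (simpl; f_equal; ring).
      apply is_lim_seq_scal_l. apply is_lim_seq_geom. rewrite Rabs_pos_eq; lra.
Qed.

(** * Mean value property and maximum principle *)

(** Continuity of the derivative is included because the mean value property differentiates under
    the integral sign. The class is closed under products and inverses, as the Blaschke argument
    requires. *)
Definition C1_on (D : C -> Prop) (h : C -> C) : Prop :=
  exists h', forall z, D z -> cder h z (h' z) /\ ccont h' z.

Lemma C1_on_const (D : C -> Prop) (c : C) : C1_on D (fun _ => c).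
Proof.
  exists (fun _ => RtoC 0). intros z _. split; [apply cder_const|apply ccont_const].
Qed.

Lemma C1_on_id (D : C -> Prop) : C1_on D (fun z => z).
Proof.
  exists (fun _ => RtoC 1). intros z _. split; [apply cder_id|apply ccont_const].
Qed.

Lemma C1_on_plus (D : C -> Prop) (f g : C -> C) :
  C1_on D f -> C1_on D g -> C1_on D (fun z => f z + g z)%C.
Proof.
  intros [f' Hf] [g' Hg]. exists (fun z => f' z + g' z)%C. intros z Hz.
  destruct (Hf z Hz), (Hg z Hz).
  split; [apply cder_plus|apply ccont_plus]; assumption.
Qed.

Lemma C1_on_mult (D : C -> Prop) (f g : C -> C) :
  C1_on D f -> C1_on D g -> C1_on D (fun z => f z * g z)%C.
Proof.
  intros [f' Hf] [g' Hg]. exists (fun z => f' z * g z + f z * g' z)%C. intros z Hz.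
  destruct (Hf z Hz) as [H1 H2], (Hg z Hz) as [H3 H4].
  split; [apply cder_mult; assumption|].
  apply ccont_plus; apply ccont_mult; try assumption; eapply cder_cont; eassumption.
Qed.

Lemma C1_on_inv (D : C -> Prop) (f : C -> C) :
  C1_on D f -> (forall z, D z -> f z <> RtoC 0) -> C1_on D (fun z => / f z)%C.
Proof.
  intros [f' Hf] Hn. exists (fun z => - f' z * (/ f z * / f z))%C. intros z Hz.
  destruct (Hf z Hz) as [H1 H2]. specialize (Hn z Hz).
  split; [apply cder_inv; assumption|].
  apply ccont_mult.
  - apply ccont_ext_loc with (fun w => (- (1)) * f' w)%C.
    + exists 1. split; [lra|]. intros; ring.
    + apply ccont_mult; [apply ccont_const|assumption].
  - apply ccont_mult; apply ccont_inv; try assumption; eapply cder_cont; eassumption.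
Qed.

(** The derivative is continuous because it is itself a differentiable power series. *)
Lemma has_pseries_C1 (f : C -> C) (a : nat -> C) (R0 : R) :
  has_pseries f a -> R0 < 1 -> C1_on (fun z => Cmod z <= R0) f.
Proof.
  intros Hf HR.
  destruct (has_pseries_exists _ (coef_bd_deriv a (proj1 Hf))) as [f1 H1].
  destruct (has_pseries_exists _ (coef_bd_deriv _ (proj1 H1))) as [f2 H2].
  exists f1. intros z Hz. split.
  - apply has_pseries_cder with a; [assumption|assumption|lra].
  - apply cder_cont with (f2 z).
    apply has_pseries_cder with (ps_deriv a); [assumption|assumption|lra].
Qed.

Lemma Cmod_circle_pt (r t : R) : Cmod (circle_pt r t) = Rabs r.
Proof.
  unfold Cmod, circle_pt; simpl.
  replace (r * cos t * (r * cos t * 1) + r * sin t * (r * sin t * 1))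
    with (Rsqr r * (Rsqr (sin t) + Rsqr (cos t))) by (unfold Rsqr; ring).
  rewrite sin2_cos2, Rmult_1_r. apply sqrt_Rsqr_abs.
Qed.

Lemma ccont_2d (h : C -> C) (X Y : R -> R -> R) (x y : R) :
  ccont h (X x y, Y x y) -> continuity_2d_pt X x y -> continuity_2d_pt Y x y ->
  continuity_2d_pt (fun u v => fst (h (X u v, Y u v))) x y /\
  continuity_2d_pt (fun u v => snd (h (X u v, Y u v))) x y.
Proof.
  intros Hh HX HY.
  assert (G : forall e : posreal, exists d : posreal, forall u v,
    Rabs (u - x) < d -> Rabs (v - y) < d ->
    Cmod (h (X u v, Y u v) - h (X x y, Y x y)) < e).
  { intros e. destruct (Hh e (cond_pos e)) as [d [Hd H]].
    assert (Hd2 : 0 < d / 2) by lra.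
    destruct (HX (mkposreal _ Hd2)) as [d1 H1].
    destruct (HY (mkposreal _ Hd2)) as [d2 H2].
    assert (Hm : 0 < Rmin d1 d2) by (apply Rmin_pos; apply cond_pos).
    exists (mkposreal _ Hm). simpl. intros u v Hu Hv. apply H.
    eapply Rle_lt_trans; [apply Cmod_le_Re_Im|]. simpl.
    specialize (H1 u v ltac:(eapply Rlt_le_trans; [exact Hu|apply Rmin_l])
                       ltac:(eapply Rlt_le_trans; [exact Hv|apply Rmin_l])).
    specialize (H2 u v ltac:(eapply Rlt_le_trans; [exact Hu|apply Rmin_r])
                       ltac:(eapply Rlt_le_trans; [exact Hv|apply Rmin_r])).
    simpl in H1, H2.
    replace (X u v + - X x y) with (X u v - X x y) by ring.
    replace (Y u v + - Y x y) with (Y u v - Y x y) by ring. lra. }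
  split; intros e; destruct (G e) as [d H]; exists d; intros u v Hu Hv;
    (eapply Rle_lt_trans; [|apply (H u v Hu Hv)]).
  - apply (Rabs_Re_le_Cmod (h (X u v, Y u v) - h (X x y, Y x y))).
  - apply (Rabs_Im_le_Cmod (h (X u v, Y u v) - h (X x y, Y x y))).
Qed.

Lemma continuity_2d_circle (r t : R) :
  continuity_2d_pt (fun u v => u * cos v) r t /\
  continuity_2d_pt (fun u v => u * sin v) r t.
Proof.
  split; apply continuity_2d_pt_mult; try apply continuity_2d_pt_id1.
  - apply (continuity_1d_2d_pt_comp cos (fun _ v => v));
      [apply continuity_cos|apply continuity_2d_pt_id2].
  - apply (continuity_1d_2d_pt_comp sin (fun _ v => v));
      [apply continuity_sin|apply continuity_2d_pt_id2].
Qed.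

(** The Cauchy-Riemann equations enter here: the differentials of Re h and Im h are (Re l, - Im l)
    and (Im l, Re l). The lemma is applied along radii and along circles. *)
Lemma cder_path (h : C -> C) (f1 f2 : R -> R) (t l1 l2 : R) (l : C) :
  cder h (f1 t, f2 t) l -> is_derive f1 t l1 -> is_derive f2 t l2 ->
  is_derive (fun s => fst (h (f1 s, f2 s))) t (fst l * l1 + - snd l * l2) /\
  is_derive (fun s => snd (h (f1 s, f2 s))) t (snd l * l1 + fst l * l2).
Proof.
  intros [p [Hp [Ep [d1 [Hd1 E1]]]]] H1 H2.
  apply is_derive_Reals in H1. apply is_derive_Reals in H2.
  assert (G : forall e : posreal, exists d : posreal, forall u v,
    Rabs (u - f1 t) < d -> Rabs (v - f2 t) < d ->
    Cmod (h (u, v) - h (f1 t, f2 t) - ((u, v) - (f1 t, f2 t)) * l)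
      <= e * Rmax (Rabs (u - f1 t)) (Rabs (v - f2 t))).
  { intros e.
    destruct (Hp (e / 2)) as [d2 [Hd2 K2]]; [generalize (cond_pos e); lra|].
    assert (Hm : 0 < Rmin d1 d2 / 2) by (generalize (Rmin_pos d1 d2 Hd1 Hd2); lra).
    exists (mkposreal _ Hm). simpl. intros u v Hu Hv.
    assert (Hw : Cmod ((u, v) - (f1 t, f2 t)) <=
                 2 * Rmax (Rabs (u - f1 t)) (Rabs (v - f2 t))).
    { eapply Rle_trans; [apply Cmod_le_Re_Im|]. simpl.
      generalize (Rmax_l (Rabs (u - f1 t)) (Rabs (v - f2 t)))
                 (Rmax_r (Rabs (u - f1 t)) (Rabs (v - f2 t))).
      unfold Rminus. lra. }
    assert (Hw1 : Cmod ((u, v) - (f1 t, f2 t)) < Rmin d1 d2).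
    { eapply Rle_lt_trans; [apply Cmod_le_Re_Im|]. simpl.
      unfold Rminus in *. lra. }
    rewrite E1 by (eapply Rlt_le_trans; [exact Hw1|apply Rmin_l]).
    specialize (K2 (u, v) ltac:(eapply Rlt_le_trans; [exact Hw1|apply Rmin_r])).
    rewrite <- Ep.
    replace (((u, v) - (f1 t, f2 t)) * p (u, v)
             - ((u, v) - (f1 t, f2 t)) * p (f1 t, f2 t))%C
      with ((p (u, v) - p (f1 t, f2 t)) * ((u, v) - (f1 t, f2 t)))%C by ring.
    rewrite Cmod_mult.
    eapply Rle_trans; [apply Rmult_le_compat; try apply Cmod_ge_0;
                       [left; exact K2|exact Hw]|]. right; field. }
  split; apply is_derive_Reals;
    [apply (derivable_pt_lim_comp_2d (fun u v => fst (h (u, v))))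
    |apply (derivable_pt_lim_comp_2d (fun u v => snd (h (u, v))))];
    try assumption;
    intros e; destruct (G e) as [d H]; exists d; intros u v Hu Hv;
    (eapply Rle_trans; [|apply (H u v Hu Hv)]).
  - eapply Rle_trans; [|apply Rabs_Re_le_Cmod]. right. f_equal. simpl. ring.
  - eapply Rle_trans; [|apply Rabs_Im_le_Cmod]. right. f_equal. simpl. ring.
Qed.

Lemma continuity_2d_pt_snd (f : R -> R -> R) (x y : R) :
  continuity_2d_pt f x y -> continuous (f x) y.
Proof.
  intros H. apply continuity_pt_filterlim. intros e He.
  destruct (H (mkposreal e He)) as [d Hd]. exists d.
  split; [apply cond_pos|]. intros v [_ Hv].
  apply Hd; [|exact Hv]. rewrite Rminus_diag, Rabs_R0. apply cond_pos.
Qed.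

Section MeanValue.
Variables (h h' : C -> C) (R0 : R).
Hypothesis HR0 : 0 < R0.
Hypothesis Hh : forall z, Cmod z <= R0 -> cder h z (h' z) /\ ccont h' z.

Let u (r t : R) : R := fst (h (circle_pt r t)).
Let du (r t : R) : R :=
  fst (h' (circle_pt r t)) * cos t + - snd (h' (circle_pt r t)) * sin t.

Lemma circle_cont r t : Rabs r <= R0 -> continuity_2d_pt u r t.
Proof.
  intros Hr. destruct (continuity_2d_circle r t) as [H1 H2].
  apply (ccont_2d h (fun u v => u * cos v) (fun u v => u * sin v));
    try assumption.
  destruct (Hh (circle_pt r t)) as [Hd _]; [now rewrite Cmod_circle_pt|].
  exact (cder_cont _ _ _ Hd).
Qed.

Lemma circle_deriv_cont r t : Rabs r <= R0 -> continuity_2d_pt du r t.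
Proof.
  intros Hr. destruct (continuity_2d_circle r t) as [H1 H2].
  destruct (ccont_2d h' (fun u v => u * cos v) (fun u v => u * sin v) r t)
    as [H3 H4]; try assumption.
  { apply (Hh (circle_pt r t)). now rewrite Cmod_circle_pt. }
  apply continuity_2d_pt_plus; apply continuity_2d_pt_mult.
  - exact H3.
  - apply (continuity_1d_2d_pt_comp cos (fun _ v => v));
      [apply continuity_cos|apply continuity_2d_pt_id2].
  - apply continuity_2d_pt_opp. exact H4.
  - apply (continuity_1d_2d_pt_comp sin (fun _ v => v));
      [apply continuity_sin|apply continuity_2d_pt_id2].
Qed.

Lemma circle_derive r t : Rabs r <= R0 -> is_derive (fun r => u r t) r (du r t).
Proof.
  intros Hr. destruct (Hh (circle_pt r t)) as [Hd _]; [now rewrite Cmod_circle_pt|].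
  refine (proj1 (cder_path h (fun r => r * cos t) (fun r => r * sin t) r
                   (cos t) (sin t) _ Hd _ _)); auto_derive; trivial; ring.
Qed.

(** The radial derivative of Re h, times r, is the angular derivative of Im h, whose integral over a
    full turn vanishes. *)
Lemma RInt_du r : r <> 0 -> Rabs r <= R0 -> RInt (du r) 0 (2 * PI) = 0.
Proof.
  intros Hr0 Hr.
  assert (H : is_RInt (fun t => r * du r t) 0 (2 * PI)
     (minus (snd (h (circle_pt r (2 * PI)))) (snd (h (circle_pt r 0))))).
  { apply (is_RInt_derive (fun t => snd (h (circle_pt r t)))).
    - intros t _. destruct (Hh (circle_pt r t)) as [Hd _];
        [now rewrite Cmod_circle_pt|].
      replace (r * du r t) with
        (snd (h' (circle_pt r t)) * (r * - sin t)
         + fst (h' (circle_pt r t)) * (r * cos t)) by (unfold du; ring).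
      refine (proj2 (cder_path h (fun t => r * cos t) (fun t => r * sin t) t
                       _ _ _ Hd _ _)); auto_derive; trivial; ring.
    - intros t _. apply (continuous_scal_r r (du r)).
      apply continuity_2d_pt_snd, circle_deriv_cont, Hr. }
  replace (circle_pt r (2 * PI)) with (circle_pt r 0) in H
    by (unfold circle_pt; rewrite cos_2PI, sin_2PI, cos_0, sin_0; reflexivity).
  rewrite (minus_eq_zero (G := R_AbelianGroup)) in H.
  apply (is_RInt_scal _ _ _ (/ r)) in H.
  apply is_RInt_unique.
  replace 0 with (scal (/ r) (zero : R)) at 2
    by (unfold scal, zero; simpl; unfold mult; simpl; ring).
  eapply is_RInt_ext; [|exact H].
  intros t _. unfold scal; simpl; unfold mult; simpl. field. exact Hr0.
Qed.

Lemma ex_RInt_u r : Rabs r <= R0 -> ex_RInt (u r) 0 (2 * PI).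
Proof.
  intros Hr. apply (ex_RInt_continuous (V := R_CompleteNormedModule)). intros t _.
  apply continuity_2d_pt_snd, circle_cont, Hr.
Qed.

Lemma mean_derive r : Rabs r < R0 ->
  is_derive (fun r => RInt (u r) 0 (2 * PI)) r (RInt (du r) 0 (2 * PI)).
Proof.
  intros Hr.
  assert (Hp : 0 < R0 - Rabs r) by lra.
  assert (Hl : forall s, Rabs (s - r) < R0 - Rabs r -> Rabs s <= R0).
  { intros s Hs. replace s with ((s - r) + r) by ring.
    eapply Rle_trans; [apply Rabs_triang|]. lra. }
  rewrite (RInt_ext (du r) (fun t => Derive (fun r => u r t) r)).
  2:{ intros t _. symmetry. apply is_derive_unique, circle_derive. lra. }
  apply is_derive_RInt_param.
  - exists (mkposreal _ Hp). intros s Hs t _. exists (du s t). apply circle_derive, Hl, Hs.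
  - intros t _. apply continuity_2d_pt_ext_loc with du.
    + exists (mkposreal _ Hp). intros s v Hs _. symmetry.
      apply is_derive_unique, circle_derive, Hl, Hs.
    + apply circle_deriv_cont. lra.
  - exists (mkposreal _ Hp). intros s Hs. apply ex_RInt_u, Hl, Hs.
Qed.

(** The circular integral has derivative 0 in the radius and is known at radius 0. The radius stays
    below [R0] because differentiation under the integral needs a neighbourhood. *)
Lemma mean_const r : 0 <= r < R0 -> RInt (u r) 0 (2 * PI) = 2 * PI * fst (h (RtoC 0)).
Proof.
  intros Hr.
  assert (E0 : RInt (u 0) 0 (2 * PI) = 2 * PI * fst (h (RtoC 0))).
  { rewrite (RInt_ext (u 0) (fun _ => fst (h (RtoC 0)))).
    - rewrite RInt_const. unfold scal; simpl; unfold mult; simpl. ring.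
    - intros t _. unfold u, circle_pt, RtoC. now rewrite !Rmult_0_l. }
  destruct (Req_dec r 0) as [->|Hr0]; [exact E0|].
  destruct (MVT_gen (fun r => RInt (u r) 0 (2 * PI)) 0 r (fun _ => 0))
    as [c [_ E]].
  - rewrite Rmin_left, Rmax_right by lra. intros s Hs.
    assert (Hs' : Rabs s < R0) by (rewrite Rabs_pos_eq; lra).
    pose proof (mean_derive s Hs') as Hd. rewrite RInt_du in Hd by lra. exact Hd.
  - rewrite Rmin_left, Rmax_right by lra. intros s Hs.
    apply continuity_pt_filterlim.
    apply (ex_derive_continuous (K := R_AbsRing) (V := R_NormedModule)
             (fun r => RInt (u r) 0 (2 * PI))).
    exists (RInt (du s) 0 (2 * PI)). apply mean_derive. rewrite Rabs_pos_eq; lra.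
  - lra.
Qed.

(** The boundary circle is reached by uniform continuity: a discrepancy [D] would be bounded by |D|
    / 2 on comparing with a circle slightly inside. *)
Lemma mean_closed : is_RInt (u R0) 0 (2 * PI) (2 * PI * fst (h (RtoC 0))).
Proof.
  assert (HR : Rabs R0 <= R0) by (rewrite Rabs_pos_eq; lra).
  replace (2 * PI * fst (h (RtoC 0))) with (RInt (u R0) 0 (2 * PI));
    [apply (RInt_correct (u R0)), ex_RInt_u, HR|].
  apply Rminus_diag_uniq.
  destruct (Req_dec (RInt (u R0) 0 (2 * PI) - 2 * PI * fst (h (RtoC 0))) 0)
    as [E|E]; [exact E|exfalso].
  set (D := RInt (u R0) 0 (2 * PI) - 2 * PI * fst (h (RtoC 0))) in *.
  pose proof PI_RGT_0 as HPI.
  assert (He : 0 < Rabs D / (4 * PI))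
    by (apply Rdiv_lt_0_compat; [apply Rabs_pos_lt, E|lra]).
  destruct (uniform_continuity_2d_1d' u 0 (2 * PI) R0
              (fun t _ => circle_cont R0 t HR) (mkposreal _ He)) as [d Hd].
  (* Closer to [R0] than the modulus of continuity [d], yet positive. *)
  set (r := Rmax (R0 / 2) (R0 - d / 2)).
  pose proof (cond_pos d) as Hdp.
  assert (Hr : 0 <= r < R0)
    by (unfold r; split; [eapply Rle_trans; [|apply Rmax_l]; lra
                         |apply Rmax_lub_lt; lra]).
  assert (Hr2 : R0 - d / 2 <= r) by apply Rmax_r.
  assert (G : Rabs (RInt (fun t => u R0 t - u r t) 0 (2 * PI))
              <= (2 * PI - 0) * (Rabs D / (4 * PI))).
  { apply abs_RInt_le_const; [lra| |].
    - apply (ex_RInt_minus (V := R_NormedModule)); apply ex_RInt_u;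
        rewrite Rabs_pos_eq; lra.
    - intros t Ht. left. apply (Hd t r t R0); try lra.
      rewrite Rminus_diag, Rabs_R0; lra. }
  rewrite (RInt_minus (V := R_CompleteNormedModule)) in G
    by (apply ex_RInt_u; rewrite Rabs_pos_eq; lra).
  rewrite (mean_const r Hr) in G.
  change (Rabs D <= (2 * PI - 0) * (Rabs D / (4 * PI))) in G.
  replace ((2 * PI - 0) * (Rabs D / (4 * PI))) with (Rabs D / 2) in G
    by (field; lra).
  generalize (Rabs_pos_lt D E); lra.
Qed.

End MeanValue.

Lemma mean_value (h : C -> C) (r : R) :
  0 < r -> C1_on (fun z => Cmod z <= r) h ->
  is_RInt (fun t => Re (h (circle_pt r t))) 0 (2 * PI) (2 * PI * Re (h (RtoC 0))).
Proof. intros Hr [h' Hh]. exact (mean_closed h h' r Hr Hh). Qed.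

(** Multiply h by the unimodular constant that makes h(0) real and nonnegative, and apply the mean
    value property to the real part. Only the value at the centre is needed later. *)
Lemma max_principle (h : C -> C) (r M : R) :
  0 < r -> C1_on (fun z => Cmod z <= r) h ->
  (forall z, Cmod z = r -> Cmod (h z) <= M) -> Cmod (h (RtoC 0)) <= M.
Proof.
  intros Hr Hh HM.
  destruct (Req_dec (Cmod (h (RtoC 0))) 0) as [E|E].
  { rewrite E. eapply Rle_trans; [apply Cmod_ge_0|apply (HM (RtoC r))].
    rewrite Cmod_R, Rabs_pos_eq; lra. }
  assert (Hp : 0 < Cmod (h (RtoC 0))) by (generalize (Cmod_ge_0 (h (RtoC 0))); lra).
  set (w := (Cconj (h (RtoC 0)) / Cmod (h (RtoC 0)))%C).
  assert (Hne : RtoC (Cmod (h (RtoC 0))) <> RtoC 0)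
    by (intros Ec; apply RtoC_inj in Ec; lra).
  assert (Hw : Cmod w = 1).
  { unfold w. rewrite Cmod_div, Cmod_conj, Cmod_R, Rabs_pos_eq by (assumption || lra).
    field. lra. }
  pose proof (mean_value (fun z => w * h z)%C r Hr
                (C1_on_mult _ _ _ (C1_on_const _ w) Hh)) as Hm.
  assert (E0 : (w * h (RtoC 0))%C = RtoC (Cmod (h (RtoC 0)))).
  { unfold w. replace (Cconj (h (RtoC 0)) / Cmod (h (RtoC 0)) * h (RtoC 0))%C
      with ((h (RtoC 0) * Cconj (h (RtoC 0))) / Cmod (h (RtoC 0)))%C
      by (field; exact Hne).
    rewrite <- Cmod2_conj, RtoC_pow. simpl. field. exact Hne. }
  cbv beta in Hm. rewrite E0 in Hm.
  change (Re (RtoC (Cmod (h (RtoC 0))))) with (Cmod (h (RtoC 0))) in Hm.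
  pose proof PI_RGT_0 as HPI.
  assert (HI : is_RInt (fun _ : R => M) 0 (2 * PI) ((2 * PI - 0) * M))
    by apply (is_RInt_const (V := R_NormedModule)).
  assert (2 * PI * Cmod (h (RtoC 0)) <= (2 * PI - 0) * M).
  { eapply is_RInt_le; [|exact Hm|exact HI|]; [lra|].
    intros t _. eapply Rle_trans; [apply Re_le_Cmod|].
    rewrite Cmod_mult, Hw, Rmult_1_l. apply HM.
    rewrite Cmod_circle_pt, Rabs_pos_eq; lra. }
  nra.
Qed.

(** * Zeros and Blaschke products *)

Definition Ceq_dec (x y : C) : {x = y} + {x <> y} :=
  excluded_middle_informative (x = y).

Fixpoint cprod (zs : list C) (z : C) : C :=
  match zs with
  | nil => 1
  | w :: l => ((z - w) * cprod l z)%C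
  end.

Fixpoint mod_prod (zs : list C) : R :=
  match zs with
  | nil => 1
  | w :: l => Cmod w * mod_prod l
  end.

Lemma Cmod_cprod_0 (zs : list C) : Cmod (cprod zs 0) = mod_prod zs.
Proof.
  induction zs as [|w l IH]; simpl; [apply Cmod_1|].
  rewrite Cmod_mult, IH. f_equal. rewrite <- (Cmod_opp w). f_equal. ring.
Qed.

(* [z - w] divided by the Blaschke factor [r (z - w) / (r^2 - conj w z)], hence
   of the same modulus as [z - w] on the circle of radius [r]. *)
Definition bfactor (r : R) (w z : C) : C :=
  ((RtoC (r * r) + - Cconj w * z) * RtoC (/ r))%C.

Lemma bfactor_0 (r : R) (w : C) : 0 < r -> bfactor r w 0 = RtoC r.
Proof.
  intros Hr. unfold bfactor.
  replace (RtoC (r * r) + - Cconj w * 0)%C with (RtoC (r * r)) by ring.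
  rewrite <- RtoC_mult. f_equal. field. lra.
Qed.

Lemma Cmod_bfactor_circle (r : R) (w z : C) :
  0 < r -> Cmod z = r -> Cmod (bfactor r w z) = Cmod (z - w).
Proof.
  intros Hr Hz. unfold bfactor.
  replace (RtoC (r * r) + - Cconj w * z)%C with (z * Cconj (z - w))%C.
  - rewrite !Cmod_mult, Cmod_conj, Hz, Cmod_R, Rabs_pos_eq
      by (left; apply Rinv_0_lt_compat, Hr).
    field. lra.
  - rewrite <- Hz. replace (Cmod z * Cmod z) with (Cmod z ^ 2) by ring.
    rewrite Cmod2_conj. unfold Cminus. rewrite Cplus_conj, Copp_conj. ring.
Qed.

Lemma bfactor_neq0 (r : R) (w z : C) :
  0 < r -> Cmod w < r -> Cmod z <= r -> bfactor r w z <> RtoC 0.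
Proof.
  intros Hr Hw Hz. unfold bfactor. apply Cmult_neq_0.
  - intros E.
    assert (E2 : Cmod (Cconj w * z) = r * r).
    { replace (Cconj w * z)%C with (RtoC (r * r) - (RtoC (r * r) + - Cconj w * z))%C
        by ring.
      rewrite E. replace (RtoC (r * r) - 0)%C with (RtoC (r * r)) by ring.
      rewrite Cmod_R, Rabs_pos_eq; nra. }
    rewrite Cmod_mult, Cmod_conj in E2.
    pose proof (Cmod_ge_0 w). pose proof (Cmod_ge_0 z). nra.
  - intros E. apply RtoC_inj in E. generalize (Rinv_0_lt_compat r Hr); lra.
Qed.

Fixpoint bprod (r : R) (zs : list C) (z : C) : C :=
  match zs with
  | nil => 1
  | w :: l => (bfactor r w z * bprod r l z)%C
  end.

Lemma C1_on_bprod (D : C -> Prop) (r : R) (zs : list C) : C1_on D (bprod r zs).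
Proof.
  induction zs as [|w l IH]; simpl; [apply C1_on_const|].
  apply C1_on_mult; [|exact IH].
  apply C1_on_mult; [|apply C1_on_const].
  apply C1_on_plus; [apply C1_on_const|].
  apply C1_on_mult; [apply C1_on_const|apply C1_on_id].
Qed.

Lemma bprod_0 (r : R) (zs : list C) :
  0 < r -> Cmod (bprod r zs 0) = r ^ length zs.
Proof.
  intros Hr. induction zs as [|w l IH]; simpl; [apply Cmod_1|].
  rewrite Cmod_mult, IH, bfactor_0, Cmod_R, Rabs_pos_eq by lra. reflexivity.
Qed.

Lemma Cmod_bprod_circle (r : R) (zs : list C) (z : C) :
  0 < r -> Cmod z = r -> Cmod (bprod r zs z) = Cmod (cprod zs z).
Proof.
  intros Hr Hz. induction zs as [|w l IH]; simpl; [reflexivity|].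
  now rewrite !Cmod_mult, IH, Cmod_bfactor_circle.
Qed.

Lemma bprod_neq0 (r : R) (zs : list C) (z : C) :
  0 < r -> (forall w, In w zs -> Cmod w < r) -> Cmod z <= r ->
  bprod r zs z <> RtoC 0.
Proof.
  intros Hr. induction zs as [|w l IH]; intros Hw Hz; simpl.
  - intros E. apply RtoC_inj in E. lra.
  - apply Cmult_neq_0.
    + apply bfactor_neq0; auto. apply Hw. now left.
    + apply IH; [|exact Hz]. intros v Hv. apply Hw. now right.
Qed.

(** One half of Jensen's formula: [bprod] has the modulus of [cprod] on the circle but modulus r^m
    at 0, where m is the number of zeros, so the maximum principle for [bprod] times g involves no
    integral of a logarithm. *)
Lemma blaschke_upper (g : C -> C) (zs : list C) (r M : R) :
  0 < r -> C1_on (fun z => Cmod z <= r) g ->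
  (forall z, Cmod z = r -> Cmod (cprod zs z * g z) <= M) ->
  Cmod (g (RtoC 0)) * r ^ length zs <= M.
Proof.
  intros Hr Hg HM.
  rewrite <- (bprod_0 r zs Hr), Rmult_comm, <- Cmod_mult.
  apply (max_principle (fun z => bprod r zs z * g z)%C r M Hr).
  - apply C1_on_mult; [apply C1_on_bprod|exact Hg].
  - intros z Hz. rewrite Cmod_mult, Cmod_bprod_circle, <- Cmod_mult by assumption.
    apply HM, Hz.
Qed.

(** The other half of Jensen's formula: after the replacement the product is zero-free, so the
    maximum principle applies to its reciprocal. The zeros must lie strictly inside, as
    [bfactor r w] vanishes at w if |w| = r. *)
Lemma blaschke_lower (g : C -> C) (zs : list C) (r m : R) :
  0 < r -> 0 < m -> C1_on (fun z => Cmod z <= r) g ->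
  (forall z, Cmod z <= r -> g z <> RtoC 0) ->
  (forall w, In w zs -> Cmod w < r) ->
  (forall z, Cmod z = r -> m <= Cmod (cprod zs z * g z)) ->
  m <= Cmod (g (RtoC 0)) * r ^ length zs.
Proof.
  intros Hr Hm Hg Hg0 Hzs HM.
  assert (Hn : forall z, Cmod z <= r -> (bprod r zs z * g z)%C <> RtoC 0)
    by (intros z Hz; apply Cmult_neq_0; [apply bprod_neq0|apply Hg0]; assumption).
  assert (H0 : Cmod (RtoC 0) <= r) by (rewrite Cmod_0; lra).
  rewrite <- (bprod_0 r zs Hr), Rmult_comm, <- Cmod_mult.
  rewrite <- (Rinv_inv m), <- (Rinv_inv (Cmod _)).
  apply Rinv_le_contravar; [apply Rinv_0_lt_compat, Cmod_gt_0, Hn, H0|].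
  rewrite <- Cmod_inv by (apply Hn, H0).
  apply (max_principle (fun z => / (bprod r zs z * g z))%C r (/ m) Hr).
  - apply C1_on_inv; [|exact Hn].
    apply C1_on_mult; [apply C1_on_bprod|exact Hg].
  - intros z Hz. rewrite Cmod_inv by (apply Hn; lra).
    apply Rinv_le_contravar; [exact Hm|].
    rewrite Cmod_mult, Cmod_bprod_circle, <- Cmod_mult by assumption.
    apply HM, Hz.
Qed.

Lemma has_pseries_bounded (f : C -> C) (a : nat -> C) (r : R) :
  has_pseries f a -> 0 <= r < 1 ->
  exists M, 0 <= M /\ forall z, Cmod z <= r -> Cmod (f z) <= M.
Proof.
  intros [Ha Hf] Hr. destruct (coef_bd_geom a r Ha Hr) as [M [q [HM [Hq H]]]].
  exists (M / (1 - q)). split; [apply Rdiv_le_0_compat; lra|].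
  intros z Hz. replace (f z) with (f z - 0)%C by ring.
  apply (clim_bound (psum a z) (f z) 0 _ 0); [apply Hf; lra|]. intros n _.
  replace (psum a z n - 0)%C with (psum a z n) by ring.
  apply psum_geom_bound; try assumption. intros k.
  eapply Rle_trans; [|apply H]. apply Rmult_le_compat_l; [apply Cmod_ge_0|].
  apply pow_incr. split; [apply Cmod_ge_0|exact Hz].
Qed.

Lemma mod_prod_le (zs : list C) (r : R) :
  (forall w, In w zs -> Cmod w <= r) -> mod_prod zs <= r ^ length zs.
Proof.
  induction zs as [|w l IH]; intros H; simpl; [lra|].
  apply Rmult_le_compat.
  - apply Cmod_ge_0.
  - rewrite <- Cmod_cprod_0. apply Cmod_ge_0.
  - apply H. now left.
  - apply IH. intros v Hv. apply H. now right.
Qed.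

(** Divide out zeros one after another. If this never ended, n zeros in |z| <= r would give |f(0)|
    <= M (r / r1)^n for every n, by [blaschke_upper] on a larger circle. *)
Lemma zeros_finite (f : C -> C) (a : nat -> C) (r : R) :
  has_pseries f a -> f (RtoC 0) <> RtoC 0 -> 0 < r < 1 ->
  exists zs g b, has_pseries g b /\
    (forall z, Cmod z < 1 -> f z = (cprod zs z * g z)%C) /\
    (forall w, In w zs -> Cmod w <= r) /\
    (forall z, Cmod z <= r -> g z <> RtoC 0).
Proof.
  intros Hf H0 Hr. apply NNPP. intros Hno.
  assert (P : forall n, exists zs g b, has_pseries g b /\
    (forall z, Cmod z < 1 -> f z = (cprod zs z * g z)%C) /\
    (forall w, In w zs -> Cmod w <= r) /\ length zs = n).
  { induction n as [|n [zs [g [b [Hg [E [Hzs Hl]]]]]]].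
    - exists nil, f, a. split; [exact Hf|]. split; [intros; simpl; ring|].
      split; [intros w []|reflexivity].
    - assert (Hz : exists z, Cmod z <= r /\ g z = RtoC 0).
      { apply NNPP. intros Hn. apply Hno. exists zs, g, b.
        split; [exact Hg|]. split; [exact E|]. split; [exact Hzs|].
        intros z Hz Ez. apply Hn. exists z. auto. }
      destruct Hz as [z0 [Hz0 Ez0]].
      destruct (has_pseries_divide g b z0 Hg) as [g1 [b1 [Hg1 E1]]];
        [lra|exact Ez0|].
      exists (z0 :: zs), g1, b1. split; [exact Hg1|]. split.
      + intros z Hz. rewrite E, E1 by exact Hz. simpl. ring.
      + split; [|simpl; congruence]. intros w [<-|Hw]; [exact Hz0|auto]. }
  set (r1 := (1 + r) / 2). assert (Hr1 : r < r1 < 1) by (unfold r1; lra).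
  destruct (has_pseries_bounded f a r1 Hf) as [M [HM HMb]]; [lra|].
  apply Cmod_gt_0 in H0.
  assert (B : forall n, Cmod (f (RtoC 0)) <= M * (r / r1) ^ n).
  { intros n. destruct (P n) as [zs [g [b [Hg [E [Hzs Hl]]]]]].
    assert (U : Cmod (g (RtoC 0)) * r1 ^ length zs <= M).
    { apply blaschke_upper; [lra|apply has_pseries_C1 with b; [exact Hg|lra]|].
      intros z Hz. rewrite <- E by lra. apply HMb. lra. }
    rewrite E by (rewrite Cmod_0; lra). rewrite Cmod_mult, Cmod_cprod_0.
    pose proof (mod_prod_le zs r Hzs) as Hm. rewrite Hl in *.
    assert (Hp : 0 < r1 ^ n) by (apply pow_lt; lra).
    pose proof (Cmod_ge_0 (g (RtoC 0))).
    unfold Rdiv. rewrite Rpow_mult_distr, pow_inv.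
    apply Rmult_le_reg_r with (r1 ^ n); [exact Hp|].
    replace (M * (r ^ n * / r1 ^ n) * r1 ^ n) with (r ^ n * M) by (field; lra).
    rewrite Rmult_assoc. apply Rmult_le_compat.
    - rewrite <- Cmod_cprod_0. apply Cmod_ge_0.
    - apply Rmult_le_pos; lra.
    - exact Hm.
    - exact U. }
  assert (Hq : 0 < r / r1 < 1).
  { split; [apply Rdiv_lt_0_compat; lra|].
    apply Rmult_lt_reg_r with r1; [lra|]. unfold Rdiv.
    rewrite Rmult_assoc, Rinv_l; lra. }
  assert (Hlim : is_lim_seq (fun n => M * (r / r1) ^ n) 0).
  { replace (Finite 0) with (Rbar_mult M 0) by (simpl; f_equal; ring).
    apply is_lim_seq_scal_l, is_lim_seq_geom. rewrite Rabs_pos_eq; lra. }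
  assert (Cmod (f (RtoC 0)) <= 0); [|lra].
  apply (is_lim_seq_le (fun _ => Cmod (f (RtoC 0))) (fun n => M * (r / r1) ^ n)
           (Cmod (f (RtoC 0))) 0 B); [apply is_lim_seq_const|exact Hlim].
Qed.

(** * Multiplicities of zeros and the value of the counting function n *)

Lemma cprod_split (L : list C) (z0 : C) : exists L',
  ~ In z0 L' /\
  forall z, cprod L z = ((z - z0) ^ count_occ Ceq_dec L z0 * cprod L' z)%C.
Proof.
  induction L as [|w l [L' [Hn E]]].
  - exists nil. split; [intros []|]. intros z. simpl. ring.
  - simpl. destruct (Ceq_dec w z0) as [->|Hne].
    + exists L'. split; [exact Hn|]. intros z. rewrite E, Cpow_S. ring.
    + exists (w :: L'). split; [intros [Hw|Hw]; [congruence|tauto]|].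
      intros z. rewrite E. simpl. ring.
Qed.

Lemma cprod_eq0 (L : list C) (z : C) : cprod L z = RtoC 0 -> In z L.
Proof.
  induction L as [|w l IH]; simpl.
  - intros E. apply RtoC_inj in E. lra.
  - intros E. destruct (Ceq_dec w z) as [|Hne]; [now left|right].
    apply IH. apply NNPP. intros Hc.
    apply (Cmult_neq_0 (z - w) (cprod l z)); [|exact Hc|exact E].
    intros E2. apply Hne. replace w with (z - (z - w))%C by ring. rewrite E2. ring.
Qed.

Lemma C1_on_cprod (D : C -> Prop) (zs : list C) : C1_on D (cprod zs).
Proof.
  induction zs as [|w l IH]; simpl; [apply C1_on_const|].
  apply C1_on_mult; [|exact IH].
  apply (C1_on_plus D (fun z => z) (fun _ => (- w)%C));
    [apply C1_on_id|apply C1_on_const].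
Qed.

Lemma C1_on_is_derive (D : C -> Prop) (h : C -> C) (z : C) :
  C1_on D h -> D z -> ex_derive (K := C_AbsRing) (V := C_NormedModule) h z.
Proof.
  intros [h' Hh] Hz. exists (h' z). apply cder_is_derive. apply Hh, Hz.
Qed.

(** Cancelling the smaller power gives u = (z - z0)^(n-m) v off z0, which is small near z0 although
    u(z0) is nonzero. *)
Lemma order_unique_lt (u v : C -> C) (z0 : C) (m n : nat) (d : R) :
  0 < d -> ccont u z0 -> ccont v z0 -> u z0 <> RtoC 0 -> (m < n)%nat ->
  (forall z, Cmod (z - z0) < d ->
     ((z - z0) ^ m * u z)%C = ((z - z0) ^ n * v z)%C) -> False.
Proof.
  intros Hd Hu Hv Hu0 Hmn E.
  destruct (ccont_neq0 u z0 Hu Hu0) as [d1 [Hd1 H1]].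
  apply Cmod_gt_0 in Hu0.
  destruct (Hv 1) as [d2 [Hd2 H2]]; [lra|].
  set (B := Cmod (v z0) + 1).
  assert (HB : 0 < B) by (unfold B; generalize (Cmod_ge_0 (v z0)); lra).
  (* A single test point z0 + e suffices: there |u| > |u(z0)| / 2, while e |v| <= e B < |u(z0)| /
     2. *)
  set (e := Rmin (Rmin d 1) (Rmin (Rmin d1 d2) (Cmod (u z0) / (2 * B))) / 2).
  assert (Hm : 0 < Rmin (Rmin d 1) (Rmin (Rmin d1 d2) (Cmod (u z0) / (2 * B)))).
  { repeat apply Rmin_pos; try lra. apply Rdiv_lt_0_compat; lra. }
  assert (He : 0 < e) by (unfold e; lra).
  assert (Hlt : e < Rmin (Rmin d 1) (Rmin (Rmin d1 d2) (Cmod (u z0) / (2 * B))))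
    by (unfold e; lra).
  apply Rmin_Rgt_l in Hlt. destruct Hlt as [Hl1 Hl2].
  apply Rmin_Rgt_l in Hl1. apply Rmin_Rgt_l in Hl2.
  destruct Hl1 as [Hl3 Hl4], Hl2 as [Hl5 Hl6].
  apply Rmin_Rgt_l in Hl5. destruct Hl5 as [Hl7 Hl8].
  set (z := (z0 + RtoC e)%C).
  assert (Ez : (z - z0)%C = RtoC e) by (unfold z; ring).
  assert (Emod : Cmod (z - z0) = e) by (rewrite Ez, Cmod_R, Rabs_pos_eq; lra).
  specialize (E z ltac:(lra)). specialize (H1 z ltac:(lra)).
  specialize (H2 z ltac:(lra)).
  apply (f_equal Cmod) in E. rewrite !Cmod_mult, !Cmod_pow, Emod in E.
  replace n with (m + (n - m))%nat in E by lia. rewrite pow_add in E.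
  assert (Hpm : 0 < e ^ m) by (apply pow_lt; lra).
  rewrite Rmult_assoc in E. apply Rmult_eq_reg_l in E; [|lra].
  assert (Hvz : Cmod (v z) <= B).
  { replace (v z) with ((v z - v z0) + v z0)%C by ring.
    eapply Rle_trans; [apply Cmod_triangle|]. unfold B. lra. }
  assert (Hen : e ^ (n - m) <= e).
  { destruct (n - m)%nat as [|k] eqn:Ek; [lia|]. simpl.
    rewrite <- (Rmult_1_r e) at 3. apply Rmult_le_compat_l; [lra|].
    rewrite <- (pow1 k). apply pow_incr. lra. }
  assert (Hfin : e * B < Cmod (u z0) / 2).
  { replace (Cmod (u z0) / 2) with (Cmod (u z0) / (2 * B) * B) by (field; lra).
    apply Rmult_lt_compat_r; lra. }
  assert (e ^ (n - m) * Cmod (v z) <= e * B).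
  { apply Rmult_le_compat; try lra; [apply pow_le; lra|apply Cmod_ge_0]. }
  lra.
Qed.

Lemma has_multiplicity_unique (f : C -> C) (z0 : C) (m n : nat) :
  has_multiplicity f z0 m -> has_multiplicity f z0 n -> m = n.
Proof.
  intros [u [Du [Hu Eu]]] [v [Dv [Hv Ev]]].
  apply locally_Cmod in Eu. destruct Eu as [d1 [Hd1 Eu]].
  apply locally_Cmod in Ev. destruct Ev as [d2 [Hd2 Ev]].
  apply locally_singleton in Du. apply locally_singleton in Dv.
  destruct Du as [lu Du], Dv as [lv Dv].
  apply is_derive_ccont in Du. apply is_derive_ccont in Dv.
  assert (Hd : 0 < Rmin d1 d2) by (apply Rmin_pos; lra).
  assert (E : forall z, Cmod (z - z0) < Rmin d1 d2 ->
     ((z - z0) ^ m * u z)%C = ((z - z0) ^ n * v z)%C).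
  { intros z Hz. rewrite <- Eu, <- Ev; [reflexivity| |].
    - eapply Rlt_le_trans; [exact Hz|apply Rmin_r].
    - eapply Rlt_le_trans; [exact Hz|apply Rmin_l]. }
  destruct (Nat.lt_trichotomy m n) as [Hlt|[He|Hlt]]; [exfalso|exact He|exfalso].
  - eapply (order_unique_lt u v); eassumption.
  - apply (order_unique_lt v u z0 n m (Rmin d1 d2)); try assumption.
    intros z Hz. symmetry. apply E, Hz.
Qed.

Lemma has_multiplicity_count (f g : C -> C) (b : nat -> C) (L : list C) (r : R) (z0 : C) :
  r < 1 -> has_pseries g b ->
  (forall z, Cmod z < 1 -> f z = (cprod L z * g z)%C) ->
  (forall z, Cmod z <= r -> g z <> RtoC 0) -> Cmod z0 <= r ->
  has_multiplicity f z0 (count_occ Ceq_dec L z0).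
Proof.
  intros Hr Hg E Hn Hz0. destruct (cprod_split L z0) as [L' [HL' EL]].
  set (s := (1 + r) / 2). assert (Hs : r < s < 1) by (unfold s; lra).
  exists (fun z => cprod L' z * g z)%C. split; [|split].
  - apply locally_Cmod. exists (s - r). split; [lra|]. intros w Hw.
    apply C1_on_is_derive with (fun z => Cmod z <= s).
    + apply C1_on_mult; [apply C1_on_cprod|].
      apply has_pseries_C1 with b; [exact Hg|lra].
    + replace w with ((w - z0) + z0)%C by ring.
      eapply Rle_trans; [apply Cmod_triangle|]. lra.
  - apply Cmult_neq_0; [|apply Hn, Hz0].
    intros E0. apply HL', cprod_eq0, E0.
  - apply locally_Cmod. exists (1 - r). split; [lra|]. intros w Hw.
    rewrite E, EL; [ring|].
    replace w with ((w - z0) + z0)%C by ring.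
    eapply Rle_lt_trans; [apply Cmod_triangle|]. lra.
Qed.

Definition n_le (t : R) (L : list C) : nat :=
  length (filter (fun w => if Rle_dec (Cmod w) t then true else false) L).

Lemma list_sum_count_cons (l : list C) (L : list C) (w : C) : NoDup l ->
  list_sum (map (count_occ Ceq_dec (w :: L)) l) =
  ((if in_dec Ceq_dec w l then 1 else 0)
   + list_sum (map (count_occ Ceq_dec L) l))%nat.
Proof.
  induction l as [|p l IH]; intros HN; [reflexivity|].
  apply NoDup_cons_iff in HN. destruct HN as [Hp HN]. specialize (IH HN).
  change (list_sum (map (count_occ Ceq_dec (w :: L)) (p :: l)))
    with (count_occ Ceq_dec (w :: L) p
          + list_sum (map (count_occ Ceq_dec (w :: L)) l))%nat.
  change (list_sum (map (count_occ Ceq_dec L) (p :: l)))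
    with (count_occ Ceq_dec L p + list_sum (map (count_occ Ceq_dec L) l))%nat.
  rewrite IH. clear IH. simpl count_occ.
  destruct (Ceq_dec w p) as [->|Hne].
  - destruct (in_dec Ceq_dec p l); [contradiction|].
    destruct (in_dec Ceq_dec p (p :: l)) as [|Hc]; [lia|].
    exfalso; apply Hc; now left.
  - destruct (in_dec Ceq_dec w l), (in_dec Ceq_dec w (p :: l)) as [H|H]; try lia.
    + exfalso; apply H; now right.
    + destruct H as [H|H]; [congruence|contradiction].
Qed.

(** Double counting: it turns a sum of multiplicities over distinct points into a number of list
    entries. *)
Lemma list_sum_count (l L : list C) : NoDup l ->
  list_sum (map (count_occ Ceq_dec L) l) =
  length (filter (fun w => if in_dec Ceq_dec w l then true else false) L).
Proof.
  intros HN. induction L as [|w L IH].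
  - simpl. clear HN. induction l; simpl; auto.
  - rewrite list_sum_count_cons, IH by exact HN. simpl.
    destruct (in_dec Ceq_dec w l); reflexivity.
Qed.

Lemma filter_length_mono {A : Type} (p q : A -> bool) (L : list A) :
  (forall w, In w L -> p w = true -> q w = true) ->
  (length (filter p L) <= length (filter q L))%nat.
Proof.
  induction L as [|w L IH]; intros H; [reflexivity|]. simpl.
  assert (IH' : (length (filter p L) <= length (filter q L))%nat)
    by (apply IH; intros v Hv; apply H; now right).
  specialize (H w (or_introl eq_refl)).
  destruct (p w) eqn:Ep.
  - rewrite H by reflexivity. simpl. lia.
  - destruct (q w); simpl; lia.
Qed.

(** The multiplicities in any admissible family are forced by uniqueness, so its sum counts entries
    of [L] in the disc. The family of all distinct entries in the disc attains the supremum. *)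
Lemma n_count_formula (f g : C -> C) (a : C) (b : nat -> C) (L : list C) (r t : R) :
  r < 1 -> has_pseries g b ->
  (forall z, Cmod z < 1 -> (f z - a)%C = (cprod L z * g z)%C) ->
  (forall z, Cmod z <= r -> g z <> RtoC 0) -> t <= r ->
  n_count t f a = Finite (INR (n_le t L)).
Proof.
  intros Hr Hg E Hn Ht.
  assert (Hm : forall z0, Cmod z0 <= t ->
            has_multiplicity (fun z => f z - a)%C z0 (count_occ Ceq_dec L z0))
    by (intros z0 Hz0; apply has_multiplicity_count with g b r; try assumption; lra).
  apply is_lub_Rbar_unique. split.
  - intros x [l [[HN HF] ->]]. apply le_INR.
    rewrite Forall_forall in HF.
    assert (El : map snd l = map (count_occ Ceq_dec L) (map fst l)).
    { rewrite map_map. apply map_ext_in. intros p Hp.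
      destruct (HF p Hp) as [Hpt Hpm].
      eapply has_multiplicity_unique; [exact Hpm|apply Hm, Hpt]. }
    rewrite El, list_sum_count by exact HN.
    apply filter_length_mono. intros w _.
    destruct (in_dec Ceq_dec w (map fst l)) as [Hw|]; [|discriminate].
    apply in_map_iff in Hw. destruct Hw as [p [<- Hp]].
    destruct (HF p Hp) as [Hpt _].
    destruct (Rle_dec (Cmod (fst p)) t); [reflexivity|contradiction].
  - intros B HB. apply HB.
    set (l := nodup Ceq_dec
                (filter (fun w => if Rle_dec (Cmod w) t then true else false) L)).
    exists (map (fun p => (p, count_occ Ceq_dec L p)) l).
    assert (Hl : forall p, In p l <-> In p L /\ Cmod p <= t).
    { intros p. unfold l. rewrite nodup_In, filter_In.
      destruct (Rle_dec (Cmod p) t); intuition discriminate. }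
    assert (E1 : map fst (map (fun p => (p, count_occ Ceq_dec L p)) l) = l)
      by (rewrite map_map; apply map_id).
    split; [split|].
    + rewrite E1. apply NoDup_nodup.
    + apply Forall_forall. intros q Hq. apply in_map_iff in Hq.
      destruct Hq as [p [<- Hp]]. apply Hl in Hp. simpl.
      split; [apply Hp|apply Hm, Hp].
    + replace (map snd (map (fun p => (p, count_occ Ceq_dec L p)) l))
        with (map (count_occ Ceq_dec L) l) by (rewrite map_map; reflexivity).
      rewrite (list_sum_count l L) by apply NoDup_nodup.
      unfold n_le. f_equal. f_equal. apply filter_ext_in. intros w Hw.
      destruct (in_dec Ceq_dec w l) as [Hi|Hi], (Rle_dec (Cmod w) t) as [Hc|Hc];
        try reflexivity.
      * exfalso. apply Hc, Hl, Hi.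
      * exfalso. apply Hi, Hl. auto.
Qed.

(** * Counting functions *)

(** The integrated counting function of points away from 0, that is, the integral of n(t) / t, in
    closed form. *)
Fixpoint ln_sum (r : R) (zs : list C) : R :=
  match zs with
  | nil => 0
  | w :: l => (if Rle_dec (Cmod w) r then ln (r / Cmod w) else 0) + ln_sum r l
  end.

Lemma n_le_cons (t : R) (w : C) (l : list C) :
  n_le t (w :: l) = ((if Rle_dec (Cmod w) t then 1 else 0) + n_le t l)%nat.
Proof. unfold n_le. simpl. destruct (Rle_dec (Cmod w) t); reflexivity. Qed.

Lemma is_RInt_zero (a b : R) : is_RInt (fun _ => 0) a b 0.
Proof.
  pose proof (is_RInt_const (V := R_NormedModule) a b 0) as H.
  unfold scal in H; simpl in H; unfold mult in H; simpl in H.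
  rewrite Rmult_0_r in H. exact H.
Qed.

Lemma is_RInt_step_inv (r s : R) : 0 < r -> 0 < s ->
  is_RInt (fun t => INR (if Rle_dec s t then 1 else 0) / t) 0 r
    (if Rle_dec s r then ln (r / s) else 0).
Proof.
  intros Hr Hs.
  assert (Z : forall b, 0 <= b <= s ->
    is_RInt (fun t => INR (if Rle_dec s t then 1 else 0) / t) 0 b 0).
  { intros b Hb. apply is_RInt_ext with (fun _ => 0).
    - rewrite Rmin_left, Rmax_right by lra. intros t Ht.
      destruct (Rle_dec s t); [lra|]. simpl. field. lra.
    - apply is_RInt_zero. }
  destruct (Rle_dec s r) as [Hsr|Hsr]; [|apply Z; lra].
  replace (ln (r / s)) with (plus 0 (ln r - ln s))
    by (rewrite ln_div by lra; unfold plus; simpl; ring).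
  apply (is_RInt_Chasles (V := R_NormedModule)) with s; [apply Z; lra|].
  apply is_RInt_ext with (fun t => / t).
  - rewrite Rmin_left, Rmax_right by lra. intros t Ht.
    destruct (Rle_dec s t); [|lra]. simpl. field. lra.
  - apply (is_RInt_derive (V := R_CompleteNormedModule) ln).
    + rewrite Rmin_left, Rmax_right by lra. intros t Ht.
      apply is_derive_Reals, derivable_pt_lim_ln. lra.
    + rewrite Rmin_left, Rmax_right by lra. intros t Ht.
      apply continuity_pt_filterlim, continuity_pt_inv;
        [apply continuity_pt_id|lra].
Qed.

Lemma is_RInt_n_le (r : R) (zs : list C) :
  0 < r -> (forall w, In w zs -> 0 < Cmod w) ->
  is_RInt (fun t => INR (n_le t zs) / t) 0 r (ln_sum r zs).
Proof.
  intros Hr. induction zs as [|w l IH]; intros H.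
  - apply is_RInt_ext with (fun _ => 0).
    + intros t _. unfold n_le. simpl. unfold Rdiv. ring.
    + apply is_RInt_zero.
  - simpl ln_sum.
    apply is_RInt_ext with (fun t =>
      plus (INR (if Rle_dec (Cmod w) t then 1 else 0) / t) (INR (n_le t l) / t)).
    + intros t _. rewrite n_le_cons, plus_INR. unfold plus; simpl.
      unfold Rdiv. ring.
    + apply (is_RInt_plus (V := R_NormedModule)).
      * apply is_RInt_step_inv; [exact Hr|]. apply H. now left.
      * apply IH. intros v Hv. apply H. now right.
Qed.

Lemma ln_sum_full (r : R) (zs : list C) :
  0 < r -> (forall w, In w zs -> 0 < Cmod w <= r) ->
  0 < mod_prod zs /\ ln_sum r zs = ln (r ^ length zs) - ln (mod_prod zs).
Proof.
  intros Hr. induction zs as [|w l IH]; intros H; simpl.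
  - rewrite ln_1. lra.
  - destruct IH as [IH1 IH2]; [intros v Hv; apply H; now right|].
    destruct (H w (or_introl eq_refl)) as [Hw1 Hw2]. split; [nra|].
    destruct (Rle_dec (Cmod w) r); [|contradiction].
    rewrite IH2, ln_div, !ln_mult by (try apply pow_lt; lra). ring.
Qed.

(** A point in |w| <= r adds exactly ln s - ln r to the increment; every other point adds a
    nonnegative amount. *)
Lemma ln_sum_increment (r s : R) (zs : list C) :
  0 < r <= s -> (forall w, In w zs -> 0 < Cmod w) ->
  INR (n_le r zs) * ln (s / r) <= ln_sum s zs - ln_sum r zs.
Proof.
  intros Hr. induction zs as [|w l IH]; intros H.
  - unfold n_le. simpl. lra.
  - assert (IH' : INR (n_le r l) * ln (s / r) <= ln_sum s l - ln_sum r l)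
      by (apply IH; intros v Hv; apply H; now right).
    pose proof (H w (or_introl eq_refl)) as Hw.
    rewrite n_le_cons, plus_INR. simpl ln_sum.
    destruct (Rle_dec (Cmod w) r), (Rle_dec (Cmod w) s); simpl; try lra;
      rewrite !ln_div in * by lra; try lra.
    pose proof (ln_le (Cmod w) s Hw). lra.
Qed.

(** The zero at the origin is split off, since the Jensen inequalities evaluate at 0 and [ln_sum]
    requires nonzero points. *)
Lemma leading_factor (f : C -> C) (a : nat -> C) :
  has_pseries f a -> (exists k, a k <> RtoC 0) ->
  exists p g b, has_pseries g b /\ g (RtoC 0) <> RtoC 0 /\
    forall z, Cmod z < 1 -> f z = (z ^ p * g z)%C.
Proof.
  intros Hf [k Hk].
  assert (Hp : exists p, a p <> RtoC 0 /\ forall j, (j < p)%nat -> a j = RtoC 0).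
  { induction k as [k IH] using (well_founded_induction Wf_nat.lt_wf).
    destruct (classic (exists j, (j < k)%nat /\ a j <> RtoC 0)) as [[j [Hj Hn]]|Hno].
    - apply (IH j Hj Hn).
    - exists k. split; [exact Hk|]. intros j Hj. apply NNPP. intros Hn.
      apply Hno. exists j. auto. }
  destruct Hp as [p [Hp0 Hlow]].
  destruct (has_pseries_shift f a p Hf) as [g [Hg E]].
  exists p, g, (fun n => a (n + p)%nat). split; [exact Hg|]. split.
  - rewrite (has_pseries_0 _ _ Hg). exact Hp0.
  - intros z Hz. rewrite E by exact Hz.
    assert (Z : forall n, (n <= p)%nat -> psum a z n = RtoC 0).
    { induction n as [|n IH]; intros Hn; [reflexivity|].
      cbn [psum]. rewrite IH, Hlow by lia. ring. }
    rewrite Z by lia. ring.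
Qed.

Lemma cprod_repeat_0 (p : nat) (zs : list C) (z : C) :
  cprod (repeat (RtoC 0) p ++ zs) z = (z ^ p * cprod zs z)%C.
Proof.
  induction p as [|p IH]; simpl; [ring|]. rewrite IH. ring.
Qed.

Lemma n_le_repeat_0 (t : R) (p : nat) (zs : list C) :
  0 <= t -> n_le t (repeat (RtoC 0) p ++ zs) = (p + n_le t zs)%nat.
Proof.
  intros Ht. induction p as [|p IH]; simpl; [reflexivity|].
  rewrite n_le_cons, IH. destruct (Rle_dec (Cmod 0) t) as [|Hc]; [lia|].
  rewrite Cmod_0 in Hc. lra.
Qed.

(** A nonzero coefficient of positive index keeps f - c from vanishing identically, whatever c is.
    The list of zeros is tied to the largest radius in play and serves all smaller ones. *)
Lemma counting_structure (f : C -> C) (a : nat -> C) (c : C) :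
  has_pseries f a -> (exists k, (0 < k)%nat /\ a k <> RtoC 0) ->
  exists K, 0 < K /\ forall r, 0 < r < 1 -> exists p zs,
    (forall w, In w zs -> 0 < Cmod w <= r) /\
    (forall t, 0 <= t <= r -> n_count t f c = Finite (INR (p + n_le t zs))) /\
    (forall s, 0 < s <= r -> N_count s f c = ln_sum s zs + INR p * ln s) /\
    (forall M, (forall z, Cmod z = r -> Cmod (f z - c) <= M) ->
       N_count r f c <= ln M - ln K) /\
    (forall m, 0 < m -> (forall z, Cmod z = r -> m <= Cmod (f z - c)) ->
       ln m - ln K <= N_count r f c).
Proof.
  intros Hf [k [Hk Hak]].
  destruct (leading_factor _ _ (has_pseries_minus_const f a c Hf))
    as [p [h [bh [Hh [Hh0 Eh]]]]].
  { exists k. destruct k; [lia|exact Hak]. }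
  (* The modulus of the leading coefficient of f - c at 0, which is the same for all [r]. *)
  exists (Cmod (h (RtoC 0))). split; [apply Cmod_gt_0, Hh0|].
  intros r Hr.
  destruct (zeros_finite h bh r Hh Hh0 Hr) as [zs [g [b [Hg [E [Hzs Hgn]]]]]].
  exists p, zs.
  assert (H0 : Cmod (RtoC 0) < 1) by (rewrite Cmod_0; lra).
  assert (Eh0 : Cmod (h (RtoC 0)) = mod_prod zs * Cmod (g (RtoC 0)))
    by (rewrite E, Cmod_mult, Cmod_cprod_0 by exact H0; reflexivity).
  assert (Hw : forall w, In w zs -> 0 < Cmod w <= r).
  { intros w Hw. split; [|apply Hzs, Hw]. apply Cmod_gt_0. intros ->.
    apply Hh0. rewrite E by exact H0.
    clear - Hw. induction zs as [|v l IH]; [contradiction|]. simpl.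
    destruct Hw as [->|Hw]; [ring|].
    replace ((0 - v) * cprod l 0 * g (RtoC 0))%C
      with ((0 - v) * (cprod l 0 * g (RtoC 0)))%C by ring.
    rewrite IH by exact Hw. ring. }
  assert (Hw0 : forall w, In w zs -> 0 < Cmod w) by (intros w H; apply Hw, H).
  assert (Hn : forall t, 0 <= t <= r ->
            n_count t f c = Finite (INR (p + n_le t zs))).
  { intros t Ht. rewrite <- n_le_repeat_0 by lra.
    apply n_count_formula with g b r; try assumption; try lra.
    intros z Hz. rewrite cprod_repeat_0, Eh, E by exact Hz. ring. }
  assert (Hn0 : n_le 0 zs = 0%nat).
  { clear - Hw0. induction zs as [|w l IH]; [reflexivity|].
    rewrite n_le_cons, IH by (intros v Hv; apply Hw0; now right).
    pose proof (Hw0 w (or_introl eq_refl)). destruct (Rle_dec (Cmod w) 0); [lra|lia]. }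
  assert (HN : forall s, 0 < s <= r ->
            N_count s f c = ln_sum s zs + INR p * ln s).
  { intros s Hs. unfold N_count. rewrite (Hn 0) by lra. rewrite Hn0.
    f_equal; [|simpl real; f_equal; f_equal; lia].
    apply is_RInt_unique.
    apply is_RInt_ext with (fun t => INR (n_le t zs) / t);
      [|apply is_RInt_n_le; [lra|exact Hw0]].
    rewrite Rmin_left, Rmax_right by lra. intros t Ht.
    rewrite Hn by lra. cbn [real]. rewrite !plus_INR. simpl (INR 0).
    f_equal. ring. }
  destruct (ln_sum_full r zs ltac:(lra) Hw) as [Hmp Els].
  assert (Hrp : 0 < r ^ p) by (apply pow_lt; lra).
  assert (Hrl : 0 < r ^ length zs) by (apply pow_lt; lra).
  assert (Hg0 : 0 < Cmod (g (RtoC 0))).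
  { apply Cmod_gt_0, Hgn. rewrite Cmod_0; lra. }
  assert (EF : forall z, Cmod z = r ->
            Cmod (cprod zs z * g z) = Cmod (f z - c) / r ^ p).
  { intros z Hz. rewrite Eh, E, (Cmod_mult (z ^ p)), Cmod_pow, Hz by lra.
    field. lra. }
  (* The right-hand side is the logarithm of the quantity that the two Blaschke lemmas estimate, so
     N inherits both bounds. *)
  assert (EN : N_count r f c + ln (Cmod (h (RtoC 0)))
               = ln (Cmod (g (RtoC 0)) * r ^ length zs) + ln (r ^ p)).
  { rewrite HN, Els, Eh0, !ln_mult, (ln_pow r p) by lra. ring. }
  split; [exact Hw|]. split; [exact Hn|]. split; [exact HN|]. split.
  - intros M HM.
    assert (U : Cmod (g (RtoC 0)) * r ^ length zs <= M / r ^ p).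
    { apply blaschke_upper; [lra|apply has_pseries_C1 with b; [exact Hg|lra]|].
      intros z Hz. rewrite EF by exact Hz.
      apply Rmult_le_compat_r; [left; apply Rinv_0_lt_compat, Hrp|apply HM, Hz]. }
    assert (HMp : 0 < M).
    { replace M with (M / r ^ p * r ^ p) by (field; lra).
      apply Rmult_lt_0_compat; [|exact Hrp]. eapply Rlt_le_trans; [|exact U]. nra. }
    apply ln_le in U; [|nra]. rewrite (ln_div M) in U by lra. lra.
  - intros m Hm HM.
    assert (U : m / r ^ p <= Cmod (g (RtoC 0)) * r ^ length zs).
    { apply blaschke_lower;
        [lra|apply Rdiv_lt_0_compat; lra
        |apply has_pseries_C1 with b; [exact Hg|lra]|exact Hgn| |].
      (* A zero on the circle itself would violate the positive lower bound [m]. *)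
      - intros w Hin. destruct (Hw w Hin) as [_ [Hlt|Heq]]; [exact Hlt|exfalso].
        specialize (HM w Heq). rewrite Eh, E, !Cmod_mult in HM by lra.
        replace (Cmod (cprod zs w)) with 0 in HM; [lra|].
        symmetry. rewrite <- Cmod_0. f_equal.
        clear - Hin. induction zs as [|v l IH]; [contradiction|]. simpl.
        destruct Hin as [->|Hin]; [ring|]. rewrite IH by exact Hin. ring.
      - intros z Hz. rewrite EF by exact Hz.
        apply Rmult_le_compat_r; [left; apply Rinv_0_lt_compat, Hrp|apply HM, Hz]. }
    apply ln_le in U; [|apply Rdiv_lt_0_compat; lra].
    rewrite (ln_div m) in U by lra. lra.
Qed.

Lemma N_count_jensen (f : C -> C) (a : nat -> C) (c : C) :
  has_pseries f a -> (exists k, (0 < k)%nat /\ a k <> RtoC 0) ->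
  exists A, forall r, 0 < r < 1 ->
    (forall M, (forall z, Cmod z = r -> Cmod (f z - c) <= M) ->
       N_count r f c <= ln M + A) /\
    (forall m, 0 < m -> (forall z, Cmod z = r -> m <= Cmod (f z - c)) ->
       ln m + A <= N_count r f c).
Proof.
  intros Hf Ha. destruct (counting_structure f a c Hf Ha) as [K [HK H]].
  exists (- ln K). intros r Hr.
  destruct (H r Hr) as [p [zs [_ [_ [_ [HU HL]]]]]]. split; [exact HU|exact HL].
Qed.

(** The zeros listed for [s] describe both radii, so the increment is compared zero by zero; those
    at the origin contribute p ln(s / r) exactly. *)
Lemma n_count_le_N_increment (f : C -> C) (a : nat -> C) (c : C) (r s : R) :
  has_pseries f a -> (exists k, (0 < k)%nat /\ a k <> RtoC 0) ->
  0 < r <= s -> s < 1 ->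
  exists n : nat, n_count r f c = Finite (INR n) /\
    INR n * ln (s / r) <= N_count s f c - N_count r f c.
Proof.
  intros Hf Ha Hr Hs. destruct (counting_structure f a c Hf Ha) as [K [HK H]].
  destruct (H s) as [p [zs [Hw [Hn [HN _]]]]]; [lra|].
  exists (p + n_le r zs)%nat. split; [apply Hn; lra|].
  rewrite !HN by lra.
  pose proof (ln_sum_increment r s zs Hr (fun w Hin => proj1 (Hw w Hin))).
  rewrite plus_INR, Rmult_plus_distr_r, (ln_div s r) in * by lra. lra.
Qed.

Lemma N_count_mono (f : C -> C) (a : nat -> C) (c : C) (r s : R) :
  has_pseries f a -> (exists k, (0 < k)%nat /\ a k <> RtoC 0) ->
  0 < r <= s -> s < 1 -> N_count r f c <= N_count s f c.
Proof.
  intros Hf Ha Hr Hs.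
  destruct (n_count_le_N_increment f a c r s Hf Ha Hr Hs) as [n [_ H]].
  assert (0 <= INR n * ln (s / r)); [|lra].
  apply Rmult_le_pos; [apply pos_INR|].
  rewrite ln_div by lra. pose proof (ln_le r s). lra.
Qed.

(** * Circular means *)

Lemma circle_pt_pow (r t : R) (n : nat) :
  (circle_pt r t ^ n)%C = circle_pt (r ^ n) (INR n * t).
Proof.
  induction n as [|n IH].
  - unfold circle_pt. simpl. rewrite Rmult_0_l, cos_0, sin_0.
    apply injective_projections; simpl; ring.
  - rewrite Cpow_S, IH, S_INR.
    replace ((INR n + 1) * t) with (t + INR n * t) by ring.
    unfold circle_pt. rewrite cos_plus, sin_plus.
    apply injective_projections; simpl; ring.
Qed.

Lemma is_RInt_trig (x y : R) (k : nat) : (0 < k)%nat ->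
  is_RInt (fun t => x * cos (INR k * t) + y * sin (INR k * t)) 0 (2 * PI) 0.
Proof.
  intros Hk. assert (Hk' : 0 < INR k) by (apply lt_0_INR; exact Hk).
  set (F := fun t => x * (sin (INR k * t) / INR k) - y * (cos (INR k * t) / INR k)).
  assert (E : minus (F (2 * PI)) (F 0) = 0).
  { unfold F, minus, plus, opp; simpl.
    replace (INR k * (2 * PI)) with (0 + 2 * INR k * PI) by ring.
    rewrite sin_period, cos_period, Rmult_0_r, cos_0, sin_0. field. lra. }
  replace 0 with (minus (F (2 * PI)) (F 0)) at 2 by exact E.
  apply (is_RInt_derive (V := R_CompleteNormedModule) F).
  - intros t _. unfold F. auto_derive; [trivial|]. field. lra.
  - intros t _. apply (ex_derive_continuous (K := R_AbsRing) (V := R_NormedModule)).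
    auto_derive. trivial.
Qed.

(** After multiplication by e^(-int), the terms of index below n keep a nonzero frequency and have
    mean zero. *)
Lemma is_RInt_low_terms (a : nat -> C) (r : R) (n N : nat) : (N <= n)%nat ->
  is_RInt (fun t => Re (psum a (circle_pt r t) N * circle_pt 1 (- (INR n * t))))
    0 (2 * PI) 0.
Proof.
  induction N as [|N IH]; intros HN.
  - apply is_RInt_ext with (fun _ => 0).
    + intros t _. simpl. ring.
    + apply is_RInt_zero.
  - specialize (IH ltac:(lia)).
    pose proof (is_RInt_trig (fst (a N) * r ^ N) (snd (a N) * r ^ N) (n - N)
                  ltac:(lia)) as HT.
    pose proof (is_RInt_plus (V := R_NormedModule) _ _ _ _ _ _ IH HT) as H.
    unfold plus in H; simpl in H. rewrite Rplus_0_l in H.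
    eapply is_RInt_ext; [|exact H].
    intros t _. cbn [psum]. rewrite circle_pt_pow.
    rewrite minus_INR by lia.
    replace ((INR n - INR N) * t) with (INR n * t - INR N * t) by ring.
    rewrite cos_minus, sin_minus. unfold circle_pt, Re. rewrite cos_neg, sin_neg.
    simpl. ring.
Qed.

Lemma continuous_Cmod_circle (h : C -> C) (r t : R) :
  ccont h (circle_pt r t) -> continuous (fun t => Cmod (h (circle_pt r t))) t.
Proof.
  intros H. destruct (continuity_2d_circle r t) as [H1 H2].
  destruct (ccont_2d (fun z => RtoC (Cmod (h z)))
              (fun u v => u * cos v) (fun u v => u * sin v) r t) as [H3 _];
    try assumption.
  - intros e He. destruct (H e He) as [d [Hd K]]. exists d. split; [exact Hd|].
    intros w Hw. rewrite <- RtoC_minus, Cmod_R.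
    eapply Rle_lt_trans; [|apply (K w Hw)].
    pose proof (Cmod_triangle_rev (h w) (h (circle_pt r t))).
    pose proof (Cmod_triangle_rev (h (circle_pt r t)) (h w)).
    rewrite Cmod_minus_sym in H3.
    apply Rabs_le. unfold circle_pt in *. lra.
  - apply (continuity_2d_pt_snd _ r t H3).
Qed.

Lemma has_pseries_ccont (f : C -> C) (a : nat -> C) (z : C) :
  has_pseries f a -> Cmod z < 1 -> ccont f z.
Proof.
  intros Hf Hz. destruct (has_pseries_C1 f a (Cmod z) Hf Hz) as [f' H].
  apply cder_cont with (f' z). apply H. lra.
Qed.

(** Cauchy's estimate without termwise integration: f = (terms below n) + z^n g with g(0) = a_n.
    After multiplication by e^(-int) the first part has mean zero and the second becomes r^n g, to
    which the mean value property applies. *)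
Lemma coef_le_mean (f : C -> C) (a : nat -> C) (r : R) (n : nat) :
  has_pseries f a -> 0 < r < 1 ->
  2 * PI * (Re (a n) * r ^ n)
    <= RInt (fun t => Cmod (f (circle_pt r t))) 0 (2 * PI).
Proof.
  intros Hf Hr.
  destruct (has_pseries_shift f a n Hf) as [g [Hg E]].
  pose proof (has_pseries_0 _ _ Hg) as Hg0. simpl in Hg0.
  pose proof (mean_value g r ltac:(lra)
                (has_pseries_C1 g _ r Hg ltac:(lra))) as HI.
  apply (is_RInt_scal (V := R_NormedModule) _ _ _ (r ^ n)) in HI.
  pose proof (is_RInt_plus (V := R_NormedModule) _ _ _ _ _ _
    (is_RInt_low_terms a r n n (Nat.le_refl n)) HI) as HS.
  assert (Hcirc : forall t, Cmod (circle_pt r t) < 1)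
    by (intros t; rewrite Cmod_circle_pt, Rabs_pos_eq; lra).
  assert (HM : is_RInt (fun t => Cmod (f (circle_pt r t))) 0 (2 * PI)
     (RInt (fun t => Cmod (f (circle_pt r t))) 0 (2 * PI))).
  { apply (RInt_correct (V := R_CompleteNormedModule)).
    apply (ex_RInt_continuous (V := R_CompleteNormedModule)). intros t _.
    apply continuous_Cmod_circle, has_pseries_ccont with a; auto. }
  rewrite Hg0 in HS.
  replace (2 * PI * (Re (a n) * r ^ n))
    with (plus 0 (scal (r ^ n) (2 * PI * Re (a n))))
    by (unfold plus, scal; simpl; unfold mult; simpl; ring).
  eapply is_RInt_le; [|exact HS|exact HM|]; [generalize PI_RGT_0; lra|].
  intros t _. cbv beta. rewrite E by apply Hcirc.
  set (z := circle_pt r t).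
  assert (Hu : Cmod (circle_pt 1 (- (INR n * t))) = 1)
    by (rewrite Cmod_circle_pt, Rabs_R1; reflexivity).
  replace (Cmod (psum a z n + z ^ n * g z))
    with (Cmod ((psum a z n + z ^ n * g z) * circle_pt 1 (- (INR n * t))))
    by (rewrite Cmod_mult, Hu; ring).
  eapply Rle_trans; [|apply Re_le_Cmod]. right.
  replace (z ^ n)%C with (circle_pt (r ^ n) (INR n * t))
    by (symmetry; apply circle_pt_pow).
  unfold plus, scal; simpl; unfold mult; simpl.
  unfold circle_pt, Re. rewrite cos_neg, sin_neg. simpl.
  pose proof (sin2_cos2 (INR n * t)) as Hsc. unfold Rsqr in Hsc.
  set (cs := cos (INR n * t)) in *. set (sn := sin (INR n * t)) in *.
  set (G1 := fst (g z)). set (G2 := snd (g z)).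
  replace (r ^ n * G1) with (r ^ n * G1 * (sn * sn + cs * cs))
    by (rewrite Hsc; ring).
  ring.
Qed.

(* Integrate [phi t >= phi (m / 2) (t - m / 2) / M], which holds by monotonicity
   if [t >= m / 2] and has a negative right-hand side otherwise. *)
Lemma mean_monotone_lower (phi t : R -> R) (m M : R) :
  (forall x y, 0 <= x <= y -> phi x <= phi y) ->
  (forall x, 0 <= x -> 0 <= phi x) ->
  0 <= m -> 0 < M -> (forall x, 0 <= t x <= M) ->
  ex_RInt t 0 (2 * PI) -> ex_RInt (fun x => phi (t x)) 0 (2 * PI) ->
  2 * PI * m <= RInt t 0 (2 * PI) ->
  phi (m / 2) * (m / 2) / M <= / (2 * PI) * RInt (fun x => phi (t x)) 0 (2 * PI).
Proof.
  intros Hmono Hpos Hm HM Ht It Ip Hmean. pose proof PI_RGT_0 as HPI.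
  set (L := fun x => scal (phi (m / 2) / M) (minus (t x) (m / 2))).
  assert (HL : is_RInt L 0 (2 * PI)
    (scal (phi (m / 2) / M) (minus (RInt t 0 (2 * PI)) ((2 * PI - 0) * (m / 2))))).
  { apply (is_RInt_scal (V := R_NormedModule)).
    apply (is_RInt_minus (V := R_NormedModule)).
    - apply (RInt_correct (V := R_CompleteNormedModule)), It.
    - apply (is_RInt_const (V := R_NormedModule)). }
  pose proof (Hpos (m / 2) ltac:(lra)) as Hphi.
  assert (HR : scal (phi (m / 2) / M)
                 (minus (RInt t 0 (2 * PI)) ((2 * PI - 0) * (m / 2)))
               <= RInt (fun x => phi (t x)) 0 (2 * PI)).
  { eapply is_RInt_le; [|exact HL| |]; [lra| |].
    - apply (RInt_correct (V := R_CompleteNormedModule)), Ip.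
    - intros x _. unfold L, scal, minus, plus, opp; simpl; unfold mult; simpl.
      destruct (Ht x) as [Ht0 HtM].
      replace (phi (m / 2) / M * (t x + - (m / 2)))
        with (phi (m / 2) * ((t x - m / 2) / M)) by (field; lra).
      destruct (Rle_dec (m / 2) (t x)) as [Hc|Hc].
      + apply Rle_trans with (phi (m / 2)); [|apply Hmono; lra].
        rewrite <- (Rmult_1_r (phi (m / 2))) at 2.
        apply Rmult_le_compat_l; [exact Hphi|].
        apply Rmult_le_reg_r with M; [exact HM|]. unfold Rdiv.
        rewrite Rmult_assoc, Rinv_l by lra. lra.
      + apply Rle_trans with 0; [|apply Hpos, Ht0].
        assert (0 <= (m / 2 - t x) / M) by (apply Rdiv_le_0_compat; lra).
        replace ((t x - m / 2) / M) with (- ((m / 2 - t x) / M)) by (field; lra).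
        nra. }
  unfold scal, minus, plus, opp in HR; simpl in HR; unfold mult in HR; simpl in HR.
  apply Rmult_le_reg_l with (2 * PI); [lra|].
  rewrite <- (Rmult_assoc (2 * PI) (/ (2 * PI))), Rinv_r, Rmult_1_l by lra.
  eapply Rle_trans; [|exact HR].
  replace (2 * PI * (phi (m / 2) * (m / 2) / M))
    with (phi (m / 2) / M * (2 * PI * (m / 2))) by (field; lra).
  apply Rmult_le_compat_l; [apply Rdiv_le_0_compat; lra|]. lra.
Qed.

Lemma mean_monotone_upper (phi t : R -> R) (M : R) :
  (forall x y, 0 <= x <= y -> phi x <= phi y) ->
  (forall x, 0 <= t x <= M) -> ex_RInt (fun x => phi (t x)) 0 (2 * PI) ->
  / (2 * PI) * RInt (fun x => phi (t x)) 0 (2 * PI) <= phi M.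
Proof.
  intros Hmono Ht Ip. pose proof PI_RGT_0 as HPI.
  assert (HR : RInt (fun x => phi (t x)) 0 (2 * PI) <= (2 * PI - 0) * phi M).
  { eapply is_RInt_le; [| |apply (is_RInt_const (V := R_NormedModule))|]; [lra| |].
    - apply (RInt_correct (V := R_CompleteNormedModule)), Ip.
    - intros x _. apply Hmono, Ht. }
  apply Rmult_le_reg_l with (2 * PI); [lra|].
  rewrite <- Rmult_assoc, Rinv_r, Rmult_1_l by lra. lra.
Qed.

(** * Monotonicity and continuity of powers and of log^+ *)

Lemma rpow_nonneg (x q : R) : 0 <= rpow x q.
Proof.
  unfold rpow. destruct (Req_EM_T x 0); [lra|]. left. apply exp_pos.
Qed.

Lemma rpow_pos (x q : R) : 0 < x -> rpow x q = Rpower x q.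
Proof. intros H. unfold rpow. destruct (Req_EM_T x 0); [lra|reflexivity]. Qed.

Lemma rpow_mono (q x y : R) : 0 < q -> 0 <= x <= y -> rpow x q <= rpow y q.
Proof.
  intros Hq [Hx Hxy]. destruct (Req_dec x 0) as [->|Hx0].
  - unfold rpow at 1. destruct (Req_EM_T 0 0); [apply rpow_nonneg|lra].
  - rewrite !rpow_pos by lra. apply Rle_Rpower_l; lra.
Qed.

(** The exponential formula for the power fails where g vanishes, and the series may vanish on
    circles; such points are treated directly. *)
Lemma continuous_rpow_comp (g : R -> R) (q x : R) :
  0 < q -> (forall y, 0 <= g y) -> continuous g x ->
  continuous (fun y => rpow (g y) q) x.
Proof.
  intros Hq Hg Hc. destruct (Req_dec (g x) 0) as [E|E].
  - apply continuity_pt_filterlim. apply continuity_pt_filterlim in Hc.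
    (* The tolerance e^(1/q) for g becomes [e] after raising to the power [q]. *)
    intros e He. destruct (Hc (Rpower e (/ q)) (exp_pos _)) as [d [Hd H]].
    exists d. split; [exact Hd|]. intros y Hy. specialize (H y Hy).
    simpl in *. unfold Rdist in *. rewrite E in *.
    replace (rpow 0 q) with 0
      by (unfold rpow; destruct (Req_EM_T 0 0); [reflexivity|lra]).
    rewrite Rminus_0_r in *. rewrite Rabs_pos_eq by apply rpow_nonneg.
    rewrite Rabs_pos_eq in H by apply Hg.
    unfold rpow. destruct (Req_EM_T (g y) 0) as [|Hn]; [exact He|].
    assert (0 < g y) by (generalize (Hg y); lra).
    replace e with (Rpower (Rpower e (/ q)) q).
    + apply Rlt_Rpower_l; [exact Hq|]. lra.
    + rewrite Rpower_mult, Rinv_l, Rpower_1; lra.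
  - assert (Hp : 0 < g x) by (generalize (Hg x); lra).
    apply continuous_ext_loc with (fun y => exp (q * ln (g y))).
    + apply continuity_pt_filterlim in Hc.
      destruct (Hc (g x) Hp) as [d [Hd H]].
      exists (mkposreal d Hd). intros y Hy.
      destruct (Req_dec y x) as [->|Hne]; [now rewrite rpow_pos|].
      assert (Hl : Rabs (g y - g x) < g x)
        by (apply H; split; [split; [exact I|congruence]|exact Hy]).
      apply Rabs_def2 in Hl. rewrite rpow_pos by lra. reflexivity.
    + apply (continuous_comp (fun y => q * ln (g y)) exp).
      * apply (continuous_scal_r q (fun y => ln (g y))).
        apply (continuous_comp g ln); [exact Hc|].
        apply continuity_pt_filterlim.
        apply derivable_continuous_pt. exists (/ g x). apply derivable_pt_lim_ln, Hp.
      * apply continuity_pt_filterlim, derivable_continuous_pt, derivable_pt_exp.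
Qed.

(** The argument of ln is now at least 1, away from the convention that [ln] is 0 on nonpositive
    numbers. *)
Lemma log_plus_Rmax (x : R) : log_plus x = ln (Rmax x 1).
Proof.
  unfold log_plus. destruct (Rle_dec x 0) as [Hx|Hx].
  - rewrite (Rmax_right x) by lra. rewrite ln_1.
    unfold ln. destruct (Rlt_dec 0 x); [exfalso; lra|]. apply Rmax_right. lra.
  - destruct (Rle_dec x 1) as [H1|H1].
    + rewrite (Rmax_right x 1), ln_1 by lra. apply Rmax_right.
      rewrite <- ln_1. apply ln_le; lra.
    + rewrite (Rmax_left x 1) by lra. apply Rmax_left.
      rewrite <- ln_1. apply ln_le; lra.
Qed.

Lemma log_plus_nonneg (x : R) : 0 <= log_plus x.
Proof. apply Rmax_r. Qed.

Lemma log_plus_mono (x y : R) : x <= y -> log_plus x <= log_plus y.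
Proof.
  intros H. rewrite !log_plus_Rmax. apply ln_le.
  - generalize (Rmax_r x 1); lra.
  - apply Rmax_lub; [|apply Rmax_r]. eapply Rle_trans; [exact H|apply Rmax_l].
Qed.

Lemma continuous_log_plus_comp (g : R -> R) (x : R) :
  continuous g x -> continuous (fun y => log_plus (g y)) x.
Proof.
  intros Hc. apply continuous_ext with (fun y => ln ((g y + 1 + Rabs (g y - 1)) / 2)).
  { intros y. rewrite log_plus_Rmax. f_equal.
    unfold Rmax. destruct (Rle_dec (g y) 1); unfold Rabs; destruct (Rcase_abs _); lra. }
  apply (continuous_comp (fun y => (g y + 1 + Rabs (g y - 1)) / 2) ln).
  - apply (continuous_scal_l (fun y => g y + 1 + Rabs (g y - 1)) (/ 2)).
    apply (continuous_plus (fun y => g y + 1) (fun y => Rabs (g y - 1))).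
    + apply (continuous_plus g (fun _ => 1)); [exact Hc|apply continuous_const].
    + apply (continuous_comp (fun y => g y - 1) Rabs); [|apply continuous_Rabs].
      apply (continuous_minus g (fun _ => 1)); [exact Hc|apply continuous_const].
  - apply continuity_pt_filterlim, derivable_continuous_pt.
    eexists. apply derivable_pt_lim_ln.
    unfold Rabs; destruct (Rcase_abs _); lra.
Qed.

(** * A growth criterion *)

Lemma at_left_1_intro (P : R -> Prop) :
  (exists r0, r0 < 1 /\ forall r, r0 <= r < 1 -> P r) -> at_left 1 P.
Proof.
  intros [r0 [Hr0 H]]. assert (Hp : 0 < 1 - r0) by lra.
  exists (mkposreal _ Hp). intros r Hr Hr1. apply H. split; [|exact Hr1].
  apply Rabs_def2 in Hr. unfold minus, plus, opp in Hr; simpl in Hr. lra.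
Qed.

Lemma doubling_large (omega : R -> R) (M : R) : doubling omega ->
  exists r0, 0 < r0 < 1 /\ forall r, r0 <= r < 1 -> M < omega r.
Proof.
  intros [_ [Hmono [_ [Hunb _]]]]. destruct (Hunb M) as [r1 [Hr1 HM]].
  exists (Rmax r1 (1 / 2)). split.
  - split; [eapply Rlt_le_trans; [|apply Rmax_r]; lra|apply Rmax_lub_lt; lra].
  - intros r Hr. eapply Rlt_le_trans; [exact HM|].
    generalize (Rmax_l r1 (1 / 2)). intros. apply Hmono; lra.
Qed.

Lemma doubling_pow (omega : R -> R) (B : R) :
  0 <= B -> (forall r, 0 < r <= 1 -> omega (1 - r / 2) <= B * omega (1 - r)) ->
  forall k r, 0 < r <= 1 -> omega (1 - r / 2 ^ k) <= B ^ k * omega (1 - r).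
Proof.
  intros HB H. induction k as [|k IH]; intros r Hr.
  - simpl. unfold Rdiv. rewrite Rinv_1, Rmult_1_r. lra.
  - assert (H2 : 1 <= 2 ^ k) by (apply pow_R1_Rle; lra).
    replace (r / 2 ^ S k) with (r / 2 ^ k / 2) by (simpl; field; lra).
    eapply Rle_trans; [apply H|].
    + split; [apply Rdiv_lt_0_compat; lra|].
      apply Rmult_le_reg_r with (2 ^ k); [lra|]. unfold Rdiv.
      rewrite Rmult_assoc, Rinv_l; lra.
    + simpl. rewrite Rmult_assoc. apply Rmult_le_compat_l; [exact HB|].
      apply IH, Hr.
Qed.

Definition bounded_by_weight (omega : R -> R) (f : C -> C) : Prop :=
  exists K, 0 < K /\ forall z, Cmod z < 1 -> Cmod (f z) <= K * omega (Cmod z).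

(** Supplies the lower bound on |f - c| needed for N. The comparison of 1 - s with 1 - r limits how
    many doublings separate the two radii. *)
Definition large_on_circles (omega : R -> R) (f : C -> C) : Prop :=
  exists d c r0, 0 < d /\ 0 < c /\ r0 < 1 /\ forall r, r0 <= r < 1 ->
    exists s, r <= s < 1 /\ d * (1 - r) <= 1 - s /\
      forall z, Cmod z = s -> c * omega s <= Cmod (f z).

(** Stated for real parts as [coef_le_mean] is; the lacunary coefficients are nonnegative reals. *)
Definition large_coefficients (omega : R -> R) (a : nat -> C) : Prop :=
  exists c r0, 0 < c /\ r0 < 1 /\ forall r, r0 <= r < 1 ->
    exists n, c * omega r <= Re (a n) * r ^ n.

Section Criterion.
Variables (omega : R -> R) (f : C -> C) (a : nat -> C).
Hypothesis Hom : doubling omega.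
Hypothesis Hf : has_pseries f a.
Hypothesis Hup : bounded_by_weight omega f.
Hypothesis Hcirc : large_on_circles omega f.
Hypothesis Hcoef : large_coefficients omega a.

Lemma omega_pos r : 0 <= r < 1 -> 0 < omega r.
Proof. apply Hom. Qed.

Lemma nonconstant : exists k, (0 < k)%nat /\ a k <> RtoC 0.
Proof.
  destruct Hcoef as [c [r0 [Hc [Hr0 H]]]].
  destruct (doubling_large omega (Rabs (Re (a 0%nat)) / c) Hom) as [r1 [Hr1 HL]].
  pose proof (Rmax_l r0 r1). pose proof (Rmax_r r0 r1).
  assert (Hr : Rmax r0 r1 < 1) by (apply Rmax_lub_lt; lra).
  specialize (HL (Rmax r0 r1) ltac:(lra)).
  destruct (H (Rmax r0 r1) ltac:(lra)) as [n Hn].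
  assert (Hlt : Rabs (Re (a 0%nat)) < c * omega (Rmax r0 r1)).
  { replace (Rabs (Re (a 0%nat))) with (c * (Rabs (Re (a 0%nat)) / c))
      by (field; lra).
    apply Rmult_lt_compat_l; lra. }
  exists n. destruct n as [|n].
  - simpl in Hn. pose proof (Rle_abs (Re (a 0%nat))). lra.
  - split; [lia|]. intros E. rewrite E in Hn. simpl in Hn.
    pose proof (Rabs_pos (Re (a 0%nat))). lra.
Qed.

(** An additive error O(1) is kept here, rather than a comparison up to factors, because the bound
    on n(r,f,0) subtracts two values of N. *)
Lemma N_count_near (c : C) : exists A r1, 0 < r1 < 1 /\
  (forall r, 0 < r < 1 -> N_count r f c <= ln (omega r) + A) /\
  (forall r, r1 <= r < 1 -> ln (omega r) - A <= N_count r f c).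
Proof.
  destruct (N_count_jensen f a c Hf nonconstant) as [A HJ].
  destruct Hup as [K [HK HU]].
  destruct Hcirc as [d [c0 [r0 [Hd [Hc0 [Hr0 HC]]]]]].
  pose proof Hom as [Hpos [Hmono [_ [_ [B [HB Hdoub]]]]]].
  assert (H00 : 0 < omega 0) by (apply Hpos; lra).
  (* The constant |c| is absorbed by omega >= omega(0). *)
  set (K' := K + Cmod c / omega 0).
  assert (HK' : 0 < K').
  { unfold K'. assert (0 <= Cmod c / omega 0)
      by (apply Rdiv_le_0_compat; [apply Cmod_ge_0|lra]). lra. }
  assert (Hupper : forall r, 0 < r < 1 -> N_count r f c <= ln (omega r) + (ln K' + A)).
  { intros r Hr. destruct (HJ r Hr) as [HJu _].
    pose proof (Hpos r ltac:(lra)) as Hor.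
    replace (ln (omega r) + (ln K' + A)) with (ln (K' * omega r) + A)
      by (rewrite ln_mult by lra; ring).
    apply HJu. intros z Hz. eapply Rle_trans; [apply Cmod_triangle_minus|].
    specialize (HU z ltac:(lra)). rewrite Hz in HU.
    unfold K'. rewrite Rmult_plus_distr_r.
    apply Rplus_le_compat; [exact HU|].
    replace (Cmod c) with (Cmod c / omega 0 * omega 0) at 1 by (field; lra).
    apply Rmult_le_compat_l; [apply Rdiv_le_0_compat; [apply Cmod_ge_0|lra]|].
    apply Hmono; lra. }
  (* Starting at distance 2^k (1 - r) from the boundary, the good circle obtained has radius at most
     r; N is monotone, and k doublings cost the factor B^k. *)
  assert (Hk : exists k, 1 <= d * 2 ^ k).
  { destruct (Pow_x_infinity 2 ltac:(rewrite Rabs_pos_eq; lra) (/ d)) as [k Hk].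
    exists k. specialize (Hk k (Nat.le_refl k)).
    rewrite Rabs_pos_eq in Hk by (apply pow_le; lra).
    replace 1 with (d * / d) by (field; lra).
    apply Rmult_le_compat_l; lra. }
  destruct Hk as [k Hk].
  assert (H2k : 1 <= 2 ^ k) by (apply pow_R1_Rle; lra).
  assert (HBk : 1 <= B ^ k) by (apply pow_R1_Rle; lra).
  set (c1 := c0 / B ^ k).
  assert (Hc1 : 0 < c1) by (apply Rdiv_lt_0_compat; lra).
  (* From here on |c| is at most half of c1 omega(r), so subtracting c loses at most a factor 2. *)
  destruct (doubling_large omega (2 * Cmod c / c1) Hom) as [r2 [Hr2 Hlarge]].
  (* Keeps the starting radius 1 - 2^k (1 - r) above both [r0] and 1/2. *)
  set (r1 := Rmax r2 (1 - (1 - Rmax r0 (1 / 2)) / 2 ^ k)).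
  assert (Hm0 : Rmax r0 (1 / 2) < 1) by (apply Rmax_lub_lt; lra).
  assert (Hr1 : 0 < r1 < 1).
  { unfold r1. split; [eapply Rlt_le_trans; [|apply Rmax_l]; lra|].
    apply Rmax_lub_lt; [lra|].
    assert (0 < (1 - Rmax r0 (1 / 2)) / 2 ^ k) by (apply Rdiv_lt_0_compat; lra).
    lra. }
  assert (Hlower : forall r, r1 <= r < 1 ->
            ln (omega r) + (ln (c1 / 2) + A) <= N_count r f c).
  { intros r Hr.
    assert (Hra : r2 <= r) by (pose proof (Rmax_l r2 (1 - (1 - Rmax r0 (1 / 2)) / 2 ^ k));
                               unfold r1 in Hr; lra).
    assert (Hrb : 1 - (1 - Rmax r0 (1 / 2)) / 2 ^ k <= r)
      by (pose proof (Rmax_r r2 (1 - (1 - Rmax r0 (1 / 2)) / 2 ^ k));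
          unfold r1 in Hr; lra).
    set (x := 2 ^ k * (1 - r)).
    assert (Hx0 : 0 < x) by (apply Rmult_lt_0_compat; lra).
    assert (Hx : x <= 1 - Rmax r0 (1 / 2)).
    { unfold x. replace (1 - Rmax r0 (1 / 2))
        with (2 ^ k * ((1 - Rmax r0 (1 / 2)) / 2 ^ k)) by (field; lra).
      apply Rmult_le_compat_l; lra. }
    pose proof (Rmax_l r0 (1 / 2)). pose proof (Rmax_r r0 (1 / 2)).
    destruct (HC (1 - x)) as [s [Hs [Hds Hbig]]]; [lra|].
    assert (Hsr : s <= r).
    { replace (d * (1 - (1 - x))) with (d * 2 ^ k * (1 - r)) in Hds by (unfold x; ring).
      assert (1 * (1 - r) <= d * 2 ^ k * (1 - r))
        by (apply Rmult_le_compat_r; lra). lra. }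
    apply Rle_trans with (N_count s f c);
      [|apply (N_count_mono f a c s r Hf nonconstant); lra].
    assert (Hos : omega r <= B ^ k * omega s).
    { pose proof (doubling_pow omega B ltac:(lra) Hdoub k x ltac:(lra)) as HD.
      replace (1 - x / 2 ^ k) with r in HD by (unfold x; field; lra).
      eapply Rle_trans; [exact HD|]. apply Rmult_le_compat_l; [lra|].
      apply Hmono; lra. }
    specialize (Hlarge r ltac:(lra)).
    assert (Hor : 0 < omega r) by (apply Hpos; lra).
    destruct (HJ s ltac:(lra)) as [_ HJl].
    replace (ln (omega r) + (ln (c1 / 2) + A)) with (ln (c1 / 2 * omega r) + A)
      by (rewrite ln_mult by lra; ring).
    apply HJl; [apply Rmult_lt_0_compat; lra|].
    intros z Hz. specialize (Hbig z Hz).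
    assert (c1 * omega r <= c0 * omega s).
    { unfold c1. replace (c0 / B ^ k * omega r) with (c0 * (omega r / B ^ k))
        by (field; lra).
      apply Rmult_le_compat_l; [lra|].
      apply Rmult_le_reg_r with (B ^ k); [lra|]. unfold Rdiv.
      rewrite Rmult_assoc, Rinv_l by lra. lra. }
    assert (2 * Cmod c <= c1 * omega r).
    { replace (2 * Cmod c) with (c1 * (2 * Cmod c / c1)) by (field; lra).
      apply Rmult_le_compat_l; lra. }
    pose proof (Cmod_triangle_rev (f z) c). lra. }
  exists (Rmax (ln K' + A) (- (ln (c1 / 2) + A))), r1. split; [exact Hr1|].
  pose proof (Rmax_l (ln K' + A) (- (ln (c1 / 2) + A))).
  pose proof (Rmax_r (ln K' + A) (- (ln (c1 / 2) + A))).
  split; intros r Hr.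
  - specialize (Hupper r Hr). lra.
  - specialize (Hlower r Hr). lra.
Qed.

Lemma zero_counting_bound : exists K, 0 < K /\ at_left 1 (fun r =>
  Rbar_le (n_count r f (RtoC 0)) (Finite (K * / (1 - r)))).
Proof.
  destruct (N_count_near (RtoC 0)) as [A [r1 [Hr1 [HU HL]]]].
  pose proof Hom as [Hpos [Hmono [_ [_ [B [HB Hdoub]]]]]].
  (* Bounds N(s) - N(r): doubling contributes ln B, and each of the two values of N an error [A]. *)
  set (D := ln B + A + A).
  assert (G : forall r, r1 <= r < 1 -> exists n : nat,
    n_count r f (RtoC 0) = Finite (INR n) /\ INR n * (1 - r) <= 2 * D).
  { intros r Hr. set (s := (1 + r) / 2).
    assert (Hs : r < s < 1) by (unfold s; lra).
    destruct (n_count_le_N_increment f a (RtoC 0) r s Hf nonconstant)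
      as [n [En Hn]]; [lra|lra|].
    exists n. split; [exact En|].
    specialize (HU s ltac:(lra)). specialize (HL r Hr).
    assert (Hor : 0 < omega r) by (apply Hpos; lra).
    assert (Hos : ln (omega s) <= ln B + ln (omega r)).
    { rewrite <- ln_mult by lra. apply ln_le; [apply Hpos; lra|].
      specialize (Hdoub (1 - r) ltac:(lra)).
      replace (1 - (1 - r) / 2) with s in Hdoub by (unfold s; field).
      replace (1 - (1 - r)) with r in Hdoub by ring. exact Hdoub. }
    (* From ln x <= x - 1 at x = r / s, then (s - r) / s >= s - r = (1 - r) / 2. *)
    assert (Hln : (1 - r) / 2 <= ln (s / r)).
    { assert (Hln2 : ln (r / s) <= r / s - 1).
      { assert (Hq : 0 < r / s) by (apply Rdiv_lt_0_compat; lra).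
        pose proof (exp_ineq1_le (ln (r / s))) as He.
        rewrite exp_ln in He by exact Hq. lra. }
      replace (ln (s / r)) with (- ln (r / s)) by (rewrite !ln_div by lra; ring).
      assert (1 - r / s >= (1 - r) / 2); [|lra].
      replace (1 - r / s) with ((s - r) / s) by (field; lra).
      replace ((1 - r) / 2) with (s - r) by (unfold s; field).
      apply Rle_ge. apply Rmult_le_reg_r with s; [lra|]. unfold Rdiv.
      rewrite Rmult_assoc, Rinv_l by lra. nra. }
    pose proof (pos_INR n). unfold D.
    assert (INR n * ((1 - r) / 2) <= INR n * ln (s / r))
      by (apply Rmult_le_compat_l; lra).
    lra. }
  exists (2 * Rabs D + 1). pose proof (Rabs_pos D). split; [lra|].
  apply at_left_1_intro. exists r1. split; [lra|]. intros r Hr.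
  destruct (G r Hr) as [n [En Hn]]. rewrite En. simpl.
  pose proof (Rle_abs D).
  apply Rmult_le_reg_r with (1 - r); [lra|].
  rewrite Rmult_assoc, Rinv_l by lra. lra.
Qed.

Lemma large_ln (M : R) : exists r0, 0 < r0 < 1 /\
  forall r, r0 <= r < 1 -> M < ln (omega r).
Proof.
  destruct (doubling_large omega (exp M) Hom) as [r0 [Hr0 H]].
  exists r0. split; [exact Hr0|]. intros r Hr. specialize (H r Hr).
  rewrite <- (ln_exp M). apply ln_increasing; [apply exp_pos|exact H].
Qed.

(** Where ln omega >= 2 |A|, the additive error costs at most a factor 2. *)
Lemma N_count_asymp (c : C) :
  asymp_near1 (fun r => N_count r f c) (fun r => ln (omega r)).
Proof.
  destruct (N_count_near c) as [A [r1 [Hr1 [HU HL]]]].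
  destruct (large_ln (2 * Rabs A)) as [r2 [Hr2 HA]].
  pose proof (Rle_abs A). pose proof (Rabs_pos A).
  assert (Hm : Rmax r1 r2 < 1) by (apply Rmax_lub_lt; lra).
  pose proof (Rmax_l r1 r2). pose proof (Rmax_r r1 r2).
  split; exists 2; (split; [lra|]); apply at_left_1_intro;
    exists (Rmax r1 r2); (split; [exact Hm|]); intros r Hr;
    specialize (HA r ltac:(lra)).
  - specialize (HU r ltac:(lra)). lra.
  - specialize (HL r ltac:(lra)). lra.
Qed.

Lemma circle_mean : exists K c r0, 0 < K /\ 0 < c /\ 0 < r0 < 1 /\
  forall r, r0 <= r < 1 ->
    (forall t, 0 <= Cmod (f (circle_pt r t)) <= K * omega r) /\
    (forall t, continuous (fun t => Cmod (f (circle_pt r t))) t) /\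
    2 * PI * (c * omega r) <= RInt (fun t => Cmod (f (circle_pt r t))) 0 (2 * PI).
Proof.
  destruct Hup as [K [HK HU]]. destruct Hcoef as [c [r0 [Hc [Hr0 H]]]].
  pose proof (Rmax_l r0 (1 / 2)). pose proof (Rmax_r r0 (1 / 2)).
  exists K, c, (Rmax r0 (1 / 2)). split; [exact HK|]. split; [exact Hc|].
  split; [split; [lra|apply Rmax_lub_lt; lra]|]. intros r Hr.
  assert (Hm : forall t, Cmod (circle_pt r t) = r)
    by (intros t; rewrite Cmod_circle_pt, Rabs_pos_eq; lra).
  split; [|split].
  - intros t. split; [apply Cmod_ge_0|]. rewrite <- (Hm t) at 2.
    apply HU. rewrite Hm. lra.
  - intros t. apply continuous_Cmod_circle, has_pseries_ccont with a; [exact Hf|].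
    rewrite Hm. lra.
  - destruct (H r ltac:(lra)) as [n Hn].
    eapply Rle_trans; [|apply (coef_le_mean f a r n Hf ltac:(lra))].
    apply Rmult_le_compat_l; [generalize PI_RGT_0; lra|exact Hn].
Qed.

Lemma ex_RInt_cont (g : R -> R) : (forall t, continuous g t) -> ex_RInt g 0 (2 * PI).
Proof.
  intros H. apply (ex_RInt_continuous (V := R_CompleteNormedModule)).
  intros t _. apply H.
Qed.

(** The mean c omega and the bound K omega have a ratio independent of r, so [mean_monotone_lower]
    retains a fixed fraction of log^+ (c omega / 2). *)
Lemma T_char_asymp : asymp_near1 (fun r => T_char r f) (fun r => ln (omega r)).
Proof.
  destruct circle_mean as [K [c [r0 [HK [Hc [Hr0 H]]]]]].
  assert (G : forall r, r0 <= r < 1 -> 0 < omega r /\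
    T_char r f <= log_plus (K * omega r) /\
    (ln (omega r) + ln (c / 2)) * (c / (2 * K)) <= T_char r f).
  { intros r Hr. destruct (H r Hr) as [Hb [Hcont Hm]].
    assert (Ho : 0 < omega r) by (apply omega_pos; lra).
    assert (HKo : 0 < K * omega r) by (apply Rmult_lt_0_compat; lra).
    assert (Hco : 0 < c * omega r) by (apply Rmult_lt_0_compat; lra).
    assert (Ip : ex_RInt (fun t => log_plus (Cmod (f (circle_pt r t)))) 0 (2 * PI))
      by (apply ex_RInt_cont; intros t; apply continuous_log_plus_comp, Hcont).
    split; [exact Ho|]. split.
    - apply (mean_monotone_upper log_plus (fun t => Cmod (f (circle_pt r t)))).
      + intros x y Hxy. apply log_plus_mono. lra.
      + exact Hb.
      + exact Ip.
    - eapply Rle_trans;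
        [|apply (mean_monotone_lower log_plus (fun t => Cmod (f (circle_pt r t)))
                   (c * omega r) (K * omega r)); try assumption; try lra].
      + replace (log_plus (c * omega r / 2) * (c * omega r / 2) / (K * omega r))
          with (log_plus (c * omega r / 2) * (c / (2 * K))) by (field; lra).
        apply Rmult_le_compat_r; [apply Rdiv_le_0_compat; lra|].
        rewrite <- ln_mult by lra.
        replace (omega r * (c / 2)) with (c * omega r / 2) by field.
        apply Rmax_l.
      + intros x y Hxy. apply log_plus_mono. lra.
      + intros x _. apply log_plus_nonneg.
      + apply ex_RInt_cont, Hcont. }
  split.
  - destruct (large_ln (Rabs (ln K))) as [r2 [Hr2 HL]].
    pose proof (Rmax_l r0 r2). pose proof (Rmax_r r0 r2).
    exists 2. split; [lra|]. apply at_left_1_intro.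
    exists (Rmax r0 r2). split; [apply Rmax_lub_lt; lra|]. intros r Hr.
    destruct (G r ltac:(lra)) as [Ho [HT _]]. specialize (HL r ltac:(lra)).
    eapply Rle_trans; [exact HT|]. unfold log_plus.
    rewrite ln_mult by lra. pose proof (Rle_abs (ln K)). pose proof (Rabs_pos (ln K)).
    apply Rmax_lub; lra.
  - destruct (large_ln (2 * Rabs (ln (c / 2)))) as [r2 [Hr2 HL]].
    pose proof (Rmax_l r0 r2). pose proof (Rmax_r r0 r2).
    set (k := c / (2 * K)) in *.
    assert (Hk : 0 < k) by (apply Rdiv_lt_0_compat; lra).
    exists (2 / k). split; [apply Rdiv_lt_0_compat; lra|]. apply at_left_1_intro.
    exists (Rmax r0 r2). split; [apply Rmax_lub_lt; lra|]. intros r Hr.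
    destruct (G r ltac:(lra)) as [Ho [_ HT]]. specialize (HL r ltac:(lra)).
    pose proof (Rcomplements.Rabs_maj2 (ln (c / 2))).
    apply Rle_trans with (2 / k * ((ln (omega r) + ln (c / 2)) * k)).
    + replace (2 / k * ((ln (omega r) + ln (c / 2)) * k))
        with (2 * (ln (omega r) + ln (c / 2))) by (field; lra). lra.
    + apply Rmult_le_compat_l; [left; apply Rdiv_lt_0_compat; lra|exact HT].
Qed.

Lemma M_infty_asymp : asymp_near1 (fun r => M_infty r f) omega.
Proof.
  destruct circle_mean as [K [c [r0 [HK [Hc [Hr0 H]]]]]].
  destruct Hup as [K2 [HK2 HU]].
  assert (G : forall r, r0 <= r < 1 ->
    M_infty r f <= K2 * omega r /\ c * omega r <= M_infty r f).
  { intros r Hr. destruct (H r Hr) as [_ [Hcont Hm]].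
    unfold M_infty.
    destruct (Lub_Rbar_correct (fun x => exists z : C, Cmod z = r /\ x = Cmod (f z)))
      as [HL1 HL2].
    set (S := Lub_Rbar _) in *.
    assert (HS1 : Rbar_le S (Finite (K2 * omega r))).
    { apply HL2. intros x [z [Hz ->]]. simpl. rewrite <- Hz. apply HU. lra. }
    assert (HS2 : forall t, Rbar_le (Finite (Cmod (f (circle_pt r t)))) S).
    { intros t. apply HL1. exists (circle_pt r t). split; [|reflexivity].
      rewrite Cmod_circle_pt, Rabs_pos_eq; lra. }
    (* The supremum is finite: it is bounded by the weight, and the circle supplies at least one
       value. *)
    destruct S as [S| |]; simpl in *; [|contradiction|contradiction (HS2 0)].
    split; [exact HS1|].
    assert (RInt (fun t => Cmod (f (circle_pt r t))) 0 (2 * PI) <= (2 * PI - 0) * S).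
    { pose proof PI_RGT_0.
      eapply is_RInt_le; [| |apply (is_RInt_const (V := R_NormedModule))|]; [lra| |].
      - apply (RInt_correct (V := R_CompleteNormedModule)), ex_RInt_cont, Hcont.
      - intros t _. apply HS2. }
    apply Rmult_le_reg_l with (2 * PI); [generalize PI_RGT_0; lra|]. lra. }
  split.
  - exists K2. split; [exact HK2|]. apply at_left_1_intro. exists r0.
    split; [lra|]. intros r Hr. apply G, Hr.
  - exists (/ c). split; [apply Rinv_0_lt_compat, Hc|]. apply at_left_1_intro.
    exists r0. split; [lra|]. intros r Hr. destruct (G r Hr) as [_ G2].
    replace (omega r) with (/ c * (c * omega r)) by (field; lra).
    apply Rmult_le_compat_l; [left; apply Rinv_0_lt_compat, Hc|exact G2].
Qed.

Lemma M_mean_finite_asymp (q : R) : 0 < q -> asymp_near1 (fun r => M_mean q r f) omega.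
Proof.
  intros Hq. destruct circle_mean as [K [c [r0 [HK [Hc [Hr0 H]]]]]].
  (* The q-th root of the lower bound (c omega / 2)^q c / (2K) from [mean_monotone_lower], divided
     by omega. *)
  set (k := c / 2 * Rpower (c / (2 * K)) (/ q)).
  assert (Hk : 0 < k) by (apply Rmult_lt_0_compat; [lra|apply exp_pos]).
  assert (Hiq : 0 < / q) by (apply Rinv_0_lt_compat, Hq).
  assert (G : forall r, r0 <= r < 1 ->
    M_mean q r f <= K * omega r /\ k * omega r <= M_mean q r f).
  { intros r Hr. destruct (H r Hr) as [Hb [Hcont Hm]].
    assert (Ho : 0 < omega r) by (apply omega_pos; lra).
    assert (HKo : 0 < K * omega r) by (apply Rmult_lt_0_compat; lra).
    assert (Hco : 0 < c * omega r / 2)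
      by (apply Rdiv_lt_0_compat; [apply Rmult_lt_0_compat|]; lra).
    set (phi := fun x => rpow x q).
    assert (Hmono : forall x y, 0 <= x <= y -> phi x <= phi y)
      by (intros x y Hxy; apply rpow_mono; assumption).
    assert (Ip : ex_RInt (fun t => phi (Cmod (f (circle_pt r t)))) 0 (2 * PI)).
    { apply ex_RInt_cont. intros t. apply continuous_rpow_comp; [exact Hq| |apply Hcont].
      intros y. apply Cmod_ge_0. }
    pose proof (mean_monotone_upper phi (fun t => Cmod (f (circle_pt r t)))
                  (K * omega r) Hmono Hb Ip) as HU.
    pose proof (mean_monotone_lower phi (fun t => Cmod (f (circle_pt r t)))
                  (c * omega r) (K * omega r) Hmono
                  (fun x _ => rpow_nonneg x q) ltac:(lra) HKo Hb
                  (ex_RInt_cont _ Hcont) Ip Hm) as HL.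
    change (M_mean q r f) with
      (rpow (/ (2 * PI) * RInt (fun t => phi (Cmod (f (circle_pt r t)))) 0 (2 * PI))
         (/ q)).
    set (I := / (2 * PI) * RInt _ 0 (2 * PI)) in *.
    assert (HI : Rpower (c * omega r / 2) q * (c / (2 * K)) <= I).
    { eapply Rle_trans; [|exact HL]. right. unfold phi. rewrite rpow_pos by exact Hco.
      field. lra. }
    assert (HI0 : 0 < I).
    { eapply Rlt_le_trans; [|exact HI].
      apply Rmult_lt_0_compat; [apply exp_pos|apply Rdiv_lt_0_compat; lra]. }
    split.
    - replace (K * omega r) with (rpow (Rpower (K * omega r) q) (/ q)).
      + apply rpow_mono; [exact Hiq|]. split; [lra|].
        unfold phi in HU. rewrite (rpow_pos (K * omega r)) in HU by exact HKo. exact HU.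
      + rewrite rpow_pos by apply exp_pos.
        rewrite Rpower_mult, Rinv_r, Rpower_1; lra.
    - replace (k * omega r)
        with (rpow (Rpower (c * omega r / 2) q * (c / (2 * K))) (/ q)).
      + apply rpow_mono; [exact Hiq|]. split; [|exact HI].
        left. apply Rmult_lt_0_compat; [apply exp_pos|apply Rdiv_lt_0_compat; lra].
      + assert (Hck : 0 < c / (2 * K)) by (apply Rdiv_lt_0_compat; lra).
        rewrite rpow_pos by (apply Rmult_lt_0_compat; [apply exp_pos|exact Hck]).
        rewrite <- Rpower_mult_distr by (try apply exp_pos; exact Hck).
        rewrite Rpower_mult, Rinv_r, Rpower_1 by lra. unfold k. field. }
  split.
  - exists K. split; [exact HK|]. apply at_left_1_intro. exists r0.
    split; [lra|]. intros r Hr. apply G, Hr.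
  - exists (/ k). split; [apply Rinv_0_lt_compat, Hk|]. apply at_left_1_intro.
    exists r0. split; [lra|]. intros r Hr. destruct (G r Hr) as [_ G2].
    replace (omega r) with (/ k * (k * omega r)) by (field; lra).
    apply Rmult_le_compat_l; [left; apply Rinv_0_lt_compat, Hk|exact G2].
Qed.

Lemma growth_criterion :
  (exists K : R, 0 < K /\
     at_left 1 (fun r =>
       Rbar_le (n_count r f (RtoC 0)) (Finite (K * / (1 - r))))) /\
  (forall p : Rbar, Rbar_lt (Finite 0) p ->
     asymp_near1 (fun r => M_mean p r f) omega) /\
  (forall c : C,
     asymp_near1 (fun r => T_char r f) (fun r => N_count r f c) /\
     asymp_near1 (fun r => N_count r f c) (fun r => ln (omega r))).
Proof.
  split; [apply zero_counting_bound|]. split.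
  - intros [q| |] Hp.
    + apply M_mean_finite_asymp. exact Hp.
    + apply M_infty_asymp.
    + contradiction.
  - intros c. split; [|apply N_count_asymp].
    destruct T_char_asymp as [[K1 [HK1 H1]] [K2 [HK2 H2]]].
    destruct (N_count_asymp c) as [[K3 [HK3 H3]] [K4 [HK4 H4]]].
    split.
    + exists (K1 * K4). split; [nra|].
      apply (filter_imp (F := at_left 1)
        (fun r => T_char r f <= K1 * ln (omega r) /\
                  ln (omega r) <= K4 * N_count r f c));
        [|apply filter_and; assumption].
      intros r [Ha Hb]. rewrite Rmult_assoc.
      eapply Rle_trans; [exact Ha|]. apply Rmult_le_compat_l; lra.
    + exists (K3 * K2). split; [nra|].
      apply (filter_imp (F := at_left 1)
        (fun r => N_count r f c <= K3 * ln (omega r) /\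
                  ln (omega r) <= K2 * T_char r f));
        [|apply filter_and; assumption].
      intros r [Ha Hb]. rewrite Rmult_assoc.
      eapply Rle_trans; [exact Ha|]. apply Rmult_le_compat_l; lra.
Qed.

End Criterion.

(** * Lacunary series *)

Lemma bernoulli_le (x : R) (n : nat) : 0 <= x <= 1 -> 1 - INR n * (1 - x) <= x ^ n.
Proof.
  intros Hx. induction n as [|n IH]; [simpl; lra|].
  rewrite S_INR. simpl.
  assert (H : x ^ n <= 1) by (rewrite <- (pow1 n); apply pow_incr; lra).
  assert (H' : 0 <= x ^ n) by (apply pow_le; lra). nra.
Qed.

Lemma pow_le_pow (x : R) (m n : nat) : 0 <= x <= 1 -> (m <= n)%nat -> x ^ n <= x ^ m.
Proof.
  intros Hx H. replace n with (m + (n - m))%nat by lia. rewrite pow_add.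
  rewrite <- (Rmult_1_r (x ^ m)) at 2. apply Rmult_le_compat_l; [apply pow_le; lra|].
  rewrite <- (pow1 (n - m)). apply pow_incr; lra.
Qed.

(** If r < 1 - 1/n <= e^(-1/n), then r^n <= 1/e < 1/2. *)
Lemma pow_half_bound (n : nat) (r : R) :
  (0 < n)%nat -> 0 <= r -> / 2 <= r ^ n -> 1 - / INR n <= r.
Proof.
  intros Hn Hr H. assert (Hn' : 0 < INR n) by (apply lt_0_INR; exact Hn).
  destruct (Rle_dec (1 - / INR n) r) as [|Hc]; [assumption|exfalso].
  assert (E : r ^ n <= exp (- / INR n) ^ n).
  { apply pow_incr. split; [exact Hr|].
    pose proof (exp_ineq1_le (- / INR n)). lra. }
  replace (exp (- / INR n) ^ n) with (/ exp 1) in E.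
  - assert (/ exp 1 < / 2); [|lra].
    apply Rinv_lt_contravar; [|pose proof (exp_ineq1 1 ltac:(lra)); lra].
    pose proof (exp_pos 1). lra.
  - rewrite <- Rpower_pow by apply exp_pos. unfold Rpower. rewrite ln_exp.
    replace (INR n * - / INR n) with (- (1)) by (field; lra).
    now rewrite exp_Ropp.
Qed.

Lemma INR_pow2 (m : nat) : INR (2 ^ m) = 2 ^ m.
Proof. rewrite pow_INR. reflexivity. Qed.

(** * Choice of the frequencies *)

(* Frequencies [n k] placed so that [omega] has grown by the factor [lam ^ k]
   at distance [1 / n k] from the boundary; since [omega] is doubling, a large
   [lam] forces gaps so large that a term below 1/2 makes all later ones
   negligible. *)
Record frequencies (omega : R -> R) (lam eps B : R) (q : nat) (n : nat -> nat) : Prop := {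
  freq_lam : 10 <= lam;
  freq_eps : 0 < eps;
  freq_small : lam * lam * eps <= / 100;
  freq_B : 0 < B;
  freq_q_pos : (0 < q)%nat;
  freq_q : (1 / 2) ^ q <= eps;
  freq_0 : n 0%nat = 0%nat;
  freq_lt : forall k, (n k < n (S k))%nat;
  freq_gap : forall k x, (0 < k)%nat -> 0 <= x <= 1 -> x ^ n k <= / 2 ->
    x ^ n (S k) <= eps * x ^ n k;
  freq_lower : forall k r, 0 <= r < 1 -> / 2 <= r ^ n k -> lam ^ k * omega 0 <= omega r;
  freq_upper : forall k r, (0 < k)%nat -> 0 <= r < 1 -> r ^ n k < / 2 ->
    omega r <= B * lam ^ k
}.

(** With t = 2b + 8 this is 2b(t + 1) + 7 <= 2^t - 1, hence 100 lam^2 <= 2^7 * 2^(2b(t+1)) <= 2^q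
    for lam = 2^(b(t+1)) and q = 2^t - 1. *)
Lemma exponent_gap (b : nat) :
  (8 + 2 * b * (2 * b + 9) <= 2 ^ (2 * b + 8))%nat.
Proof.
  assert (H : (b + 1 <= 2 ^ b)%nat)
    by (induction b as [|b IH]; [simpl; lia|rewrite Nat.pow_succ_r'; lia]).
  replace (2 ^ (2 * b + 8))%nat with (2 ^ b * 2 ^ b * 256)%nat.
  - nia.
  - rewrite Nat.pow_add_r, Nat.mul_comm. replace (2 * b)%nat with (b + b)%nat by lia.
    rewrite Nat.pow_add_r. change (2 ^ 8)%nat with 256%nat. lia.
Qed.

Lemma least_nat (P : nat -> Prop) : (exists m, P m) ->
  exists m, P m /\ forall j, (j < m)%nat -> ~ P j.
Proof.
  intros [m Hm]. induction m as [m IH] using (well_founded_induction Wf_nat.lt_wf).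
  destruct (classic (exists j, (j < m)%nat /\ P j)) as [[j [Hj Hn]]|Hno].
  - apply (IH j Hj Hn).
  - exists m. split; [exact Hm|]. intros j Hj Hp. apply Hno. exists j. auto.
Qed.

(** Work on the dyadic radii 1 - 2^(-m): let m_k be the first level where omega reaches lam^k
    omega(0), and n_k = 2^(m_k) for k > 0. One level multiplies omega by at most B, which bounds the
    overshoot at m_k and forces m_(k+1) >= m_k + t. *)
Lemma frequencies_exist (omega : R -> R) : doubling omega ->
  exists lam eps B q n, frequencies omega lam eps B q n.
Proof.
  intros Hom. pose proof Hom as [Hpos [Hmono [_ [Hunb [B0 [HB0 Hdoub0]]]]]].
  assert (Hb : exists b, (0 < b)%nat /\ B0 <= 2 ^ b).
  { destruct (Pow_x_infinity 2 ltac:(rewrite Rabs_pos_eq; lra) B0) as [N HN].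
    exists (S N). split; [lia|]. specialize (HN (S N) ltac:(lia)).
    rewrite Rabs_pos_eq in HN by (apply pow_le; lra). lra. }
  destruct Hb as [b [Hb HbB]].
  set (B := 2 ^ b) in *. set (t := (2 * b + 8)%nat).
  (* The factor B beyond B^t compensates the overshoot of omega at level m_k. Since n_(k+1) >= 2^t
     n_k = (1 + q) n_k, a power below 1/2 gains the factor (1/2)^q. *)
  set (lam := B ^ (t + 1)). set (q := (2 ^ t - 1)%nat).
  assert (HB : 2 <= B).
  { unfold B. rewrite <- (pow_1 2) at 1. apply Rle_pow; [lra|lia]. }
  assert (Hdoub : forall r, 0 < r <= 1 -> omega (1 - r / 2) <= B * omega (1 - r)).
  { intros r Hr. eapply Rle_trans; [apply Hdoub0, Hr|].
    apply Rmult_le_compat_r; [|exact HbB]. left. apply Hpos. lra. }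
  assert (Hlam : 10 <= lam).
  { apply Rle_trans with (2 ^ (t + 1)); [|apply pow_incr; lra].
    apply Rle_trans with (2 ^ 4); [lra|]. apply Rle_pow; [lra|unfold t; lia]. }
  pose proof (exponent_gap b) as Hgap. fold t in Hgap.
  replace (2 * b * (2 * b + 9))%nat with (b * (t + 1) + b * (t + 1))%nat in Hgap
    by (unfold t; lia).
  set (w := fun m : nat => omega (1 - / 2 ^ m)).
  assert (H2m : forall m, 1 <= 2 ^ m) by (intros m; apply pow_R1_Rle; lra).
  assert (Hinv : forall m, 0 < / 2 ^ m <= 1).
  { intros m. specialize (H2m m). split; [apply Rinv_0_lt_compat; lra|].
    rewrite <- Rinv_1. apply Rinv_le_contravar; lra. }
  assert (Hinvle : forall m m', (m <= m')%nat -> / 2 ^ m' <= / 2 ^ m).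
  { intros m m' H. apply Rinv_le_contravar; [specialize (H2m m); lra|].
    apply Rle_pow; [lra|exact H]. }
  assert (Hw0 : w 0%nat = omega 0) by (unfold w; f_equal; simpl; field).
  assert (Hw0p : 0 < omega 0) by (apply Hpos; lra).
  assert (Hwmono : forall m m', (m <= m')%nat -> w m <= w m').
  { intros m m' H. apply Hmono; pose proof (Hinv m); pose proof (Hinv m');
      pose proof (Hinvle m m' H); lra. }
  assert (Hwpow : forall i m, w (m + i)%nat <= B ^ i * w m).
  { intros i m. unfold w.
    replace (/ 2 ^ (m + i)) with (/ 2 ^ m / 2 ^ i)
      by (rewrite pow_add; pose proof (H2m m); pose proof (H2m i); field; lra).
    apply doubling_pow; [lra|exact Hdoub|apply Hinv]. }
  assert (Hwunb : forall M, exists m, M <= w m).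
  { intros M. destruct (Hunb M) as [r [Hr HM]].
    destruct (Pow_x_infinity 2 ltac:(rewrite Rabs_pos_eq; lra) (/ (1 - r)))
      as [m Hm].
    exists m. specialize (Hm m (Nat.le_refl m)).
    rewrite Rabs_pos_eq in Hm by (apply pow_le; lra).
    left. eapply Rlt_le_trans; [exact HM|]. apply Hmono; [lra| |].
    - assert (/ 2 ^ m <= 1 - r); [|lra].
      rewrite <- (Rinv_inv (1 - r)). apply Rinv_le_contravar; [|lra].
      apply Rinv_0_lt_compat; lra.
    - specialize (Hinv m). lra. }
  assert (Hex : forall k, exists m, lam ^ k * omega 0 <= w m /\
            forall j, (j < m)%nat -> ~ lam ^ k * omega 0 <= w j)
    by (intros k; apply (least_nat (fun m => lam ^ k * omega 0 <= w m)), Hwunb).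
  set (m := fun k => proj1_sig (constructive_indefinite_description _ (Hex k))).
  assert (Hm : forall k, lam ^ k * omega 0 <= w (m k) /\
            forall j, (j < m k)%nat -> ~ lam ^ k * omega 0 <= w j)
    by (intros k; exact (proj2_sig (constructive_indefinite_description _ (Hex k)))).
  clearbody m.
  assert (Hlk : forall k, 1 <= lam ^ k) by (intros k; apply pow_R1_Rle; lra).
  (* By minimality the preceding level is still below lam^k omega(0), and one doubling bridges the
     last step. *)
  assert (Hmup : forall k, w (m k) <= B * (lam ^ k * omega 0)).
  { intros k. destruct (m k) as [|j] eqn:E.
    - rewrite Hw0. specialize (Hlk k).
      assert (1 * 1 <= B * lam ^ k) by (apply Rmult_le_compat; lra).
      rewrite <- Rmult_assoc. rewrite <- (Rmult_1_l (omega 0)) at 1.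
      apply Rmult_le_compat_r; lra.
    - destruct (Hm k) as [_ Hmin]. rewrite E in Hmin.
      specialize (Hmin j ltac:(lia)). apply Rnot_le_lt in Hmin.
      pose proof (Hwpow 1%nat j) as Hs. rewrite Nat.add_1_r, pow_1 in Hs.
      eapply Rle_trans; [exact Hs|]. apply Rmult_le_compat_l; lra. }
  assert (Hmgap : forall k, (m k + t <= m (S k))%nat).
  { intros k. destruct (Nat.le_gt_cases (m k + t) (m (S k))) as [|Hc];
      [assumption|exfalso].
    destruct (Hm (S k)) as [HS _].
    assert (H1 : w (m (S k)) <= B ^ t * (lam ^ k * omega 0)).
    { eapply Rle_trans; [apply (Hwmono _ (m k + (t - 1))%nat); lia|].
      eapply Rle_trans; [apply Hwpow|].
      replace (B ^ t) with (B ^ (t - 1) * B)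
        by (rewrite <- (pow_1 B) at 2; rewrite <- pow_add; f_equal; unfold t; lia).
      rewrite Rmult_assoc. apply Rmult_le_compat_l; [apply pow_le; lra|apply Hmup]. }
    assert (H2 : lam ^ S k * omega 0 = B * (B ^ t * (lam ^ k * omega 0))).
    { simpl. unfold lam at 1. rewrite Nat.add_1_r. simpl. ring. }
    assert (0 < B ^ t * (lam ^ k * omega 0)).
    { apply Rmult_lt_0_compat; [apply pow_lt; lra|].
      apply Rmult_lt_0_compat; [specialize (Hlk k); lra|lra]. }
    nra. }
  (* The frequency 0 at index 0 gives r^(n_0) = 1, so every r, including 0, has a threshold
     index. *)
  set (n := fun k => match k with O => O | S _ => (2 ^ m k)%nat end).
  assert (Hn : forall k, (0 < k)%nat -> n k = (2 ^ m k)%nat)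
    by (intros [|k] Hk; [lia|reflexivity]).
  assert (H2t : (2 ^ t >= 1)%nat) by (apply (Nat.pow_le_mono_r 2 0 t); lia).
  assert (Hngap : forall k, (0 < k)%nat -> (n k + n k * q <= n (S k))%nat).
  { intros k Hk. rewrite !Hn by lia.
    replace (2 ^ m k + 2 ^ m k * q)%nat with (2 ^ (m k + t))%nat.
    - apply Nat.pow_le_mono_r; [lia|apply Hmgap].
    - rewrite Nat.pow_add_r. unfold q. nia. }
  assert (Hnpos : forall k, (0 < k)%nat -> (0 < n k)%nat).
  { intros k Hk. rewrite Hn by exact Hk. pose proof (Nat.pow_nonzero 2 (m k)). lia. }
  assert (Hq : (0 < q)%nat) by (unfold q; lia).
  exists lam, ((1 / 2) ^ q), (B * B * omega 0), q, n.
  constructor.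
  - exact Hlam.
  - apply pow_lt. lra.
  - assert (E : lam * lam = 2 ^ (b * (t + 1) + b * (t + 1))).
    { unfold lam, B. rewrite <- !pow_mult, <- pow_add. reflexivity. }
    rewrite E. unfold Rdiv. rewrite Rmult_1_l, pow_inv.
    assert (G : 2 ^ (b * (t + 1) + b * (t + 1)) * 100 <= 2 ^ q).
    { apply Rle_trans with (2 ^ (b * (t + 1) + b * (t + 1)) * 2 ^ 7).
      - apply Rmult_le_compat_l; [apply pow_le; lra|lra].
      - rewrite <- pow_add. apply Rle_pow; [lra|]. unfold q. lia. }
    assert (Hqp : 0 < 2 ^ q) by (apply pow_lt; lra).
    apply Rmult_le_reg_r with (2 ^ q * 100); [lra|].
    replace (2 ^ (b * (t + 1) + b * (t + 1)) * / 2 ^ q * (2 ^ q * 100))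
      with (2 ^ (b * (t + 1) + b * (t + 1)) * 100) by (field; lra).
    replace (/ 100 * (2 ^ q * 100)) with (2 ^ q) by field. exact G.
  - apply Rmult_lt_0_compat; [nra|exact Hw0p].
  - exact Hq.
  - lra.
  - reflexivity.
  - intros [|k].
    + apply (Hnpos 1%nat). lia.
    + specialize (Hngap (S k) ltac:(lia)). specialize (Hnpos (S k) ltac:(lia)). nia.
  - intros k x Hk Hx H.
    eapply Rle_trans; [apply (pow_le_pow x (n k + n k * q)); [exact Hx|apply Hngap, Hk]|].
    rewrite pow_add, pow_mult, Rmult_comm.
    apply Rmult_le_compat_r; [apply pow_le; lra|].
    apply pow_incr. split; [apply pow_le; lra|lra].
  - intros [|k] r Hr H.
    + simpl. rewrite Rmult_1_l. apply Hmono; lra.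
    + eapply Rle_trans; [apply Hm|].
      apply pow_half_bound in H; [|apply Hnpos; lia|lra].
      rewrite Hn, INR_pow2 in H by lia.
      apply Hmono; [specialize (Hinv (m (S k))); lra|exact H|lra].
  - intros k r Hk Hr H.
    (* Closer to the boundary, Bernoulli's inequality would give r^(n_k) > 1/2. The extra level
       costs one more factor B. *)
    assert (Hr2 : r <= 1 - / 2 ^ (m k + 1)).
    { destruct (Rle_dec r (1 - / 2 ^ (m k + 1))) as [|Hc]; [assumption|exfalso].
      pose proof (bernoulli_le r (n k) ltac:(lra)) as Hbn.
      rewrite Hn, INR_pow2 in Hbn by exact Hk. rewrite Hn in H by exact Hk.
      assert (2 ^ m k * (1 - r) < / 2); [|lra].
      replace (/ 2) with (2 ^ m k * / 2 ^ (m k + 1))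
        by (rewrite pow_add, pow_1; field; specialize (H2m (m k)); lra).
      apply Rmult_lt_compat_l; [specialize (H2m (m k)); lra|lra]. }
    apply Rle_trans with (w (m k + 1)%nat).
    + apply Hmono; [lra|exact Hr2|specialize (Hinv (m k + 1)%nat); lra].
    + eapply Rle_trans; [apply Hwpow|]. rewrite pow_1.
      replace (B * B * omega 0 * lam ^ k) with (B * (B * (lam ^ k * omega 0))) by ring.
      apply Rmult_le_compat_l; [lra|apply Hmup].
Qed.

(** * Estimates for the even and the odd lacunary series *)

Section Lacunary.
Variables (omega : R -> R) (lam eps B : R) (q : nat) (n : nat -> nat).
Hypothesis F : frequencies omega lam eps B q n.
Hypothesis Hom : doubling omega.

Definition lac_weight (beta : bool) (k : nat) : R :=
  if eqb (Nat.even k) beta then lam ^ k else 0.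

(** The index k with n k = j is recovered by choice; it is unique because the frequencies increase
    strictly. *)
Definition lac_coef (beta : bool) (j : nat) : C :=
  match excluded_middle_informative (exists k, n k = j) with
  | left H => RtoC (lac_weight beta (proj1_sig (constructive_indefinite_description _ H)))
  | right _ => 0
  end.

Lemma freq_mono k l : (k < l)%nat -> (n k < n l)%nat.
Proof.
  induction l as [|l IH]; intros H; [lia|].
  pose proof (freq_lt _ _ _ _ _ _ F l).
  destruct (Nat.eq_dec k l) as [->|]; [lia|]. specialize (IH ltac:(lia)). lia.
Qed.

Lemma freq_ge k : (k <= n k)%nat.
Proof.
  induction k as [|k IH]; [lia|]. pose proof (freq_lt _ _ _ _ _ _ F k). lia.
Qed.

Lemma lac_coef_at beta k : lac_coef beta (n k) = RtoC (lac_weight beta k).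
Proof.
  unfold lac_coef. destruct (excluded_middle_informative _) as [H|H].
  - destruct (constructive_indefinite_description _ H) as [l Hl]. simpl.
    do 2 f_equal. destruct (Nat.lt_trichotomy l k) as [C|[C|C]]; [|exact C|];
      apply freq_mono in C; lia.
  - exfalso. apply H. now exists k.
Qed.

Lemma lac_coef_between beta k j :
  (n k < j < n (S k))%nat -> lac_coef beta j = RtoC 0.
Proof.
  intros Hj. unfold lac_coef. destruct (excluded_middle_informative _) as [[l Hl]|H];
    [exfalso|reflexivity].
  destruct (Nat.le_gt_cases l k) as [C|C].
  - destruct (Nat.eq_dec l k) as [->|]; [lia|].
    pose proof (freq_mono l k ltac:(lia)). lia.
  - destruct (Nat.eq_dec l (S k)) as [->|]; [lia|].
    pose proof (freq_mono (S k) l ltac:(lia)). lia.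
Qed.

Lemma lac_weight_bounds beta k : 0 <= lac_weight beta k <= lam ^ k.
Proof.
  pose proof (freq_lam _ _ _ _ _ _ F).
  assert (0 <= lam ^ k) by (apply pow_le; lra).
  unfold lac_weight. destruct (eqb _ _); lra.
Qed.

Lemma lac_psum_succ beta z k :
  psum (lac_coef beta) z (n (S k)) =
  (psum (lac_coef beta) z (n k) + lac_weight beta k * z ^ n k)%C.
Proof.
  pose proof (freq_lt _ _ _ _ _ _ F k) as Hlt.
  assert (G : forall i, (n k + S i <= n (S k))%nat ->
    psum (lac_coef beta) z (n k + S i) =
    (psum (lac_coef beta) z (n k) + lac_weight beta k * z ^ n k)%C).
  { induction i as [|i IH]; intros Hi.
    - rewrite Nat.add_1_r. cbn [psum]. now rewrite lac_coef_at.
    - rewrite Nat.add_succ_r. cbn [psum]. rewrite IH by lia.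
      rewrite (lac_coef_between beta k) by lia. ring. }
  specialize (G (n (S k) - n k - 1)%nat).
  replace (n k + S (n (S k) - n k - 1))%nat with (n (S k)) in G by lia.
  apply G. lia.
Qed.

Definition threshold (r : R) (K : nat) : Prop :=
  / 2 <= r ^ n K /\ r ^ n (S K) < / 2.

Lemma threshold_exists r : 0 <= r < 1 -> exists K, threshold r K.
Proof.
  intros Hr.
  destruct (least_nat (fun k => r ^ n k < / 2)) as [k [Hk Hmin]].
  { destruct (pow_lt_1_zero r ltac:(rewrite Rabs_pos_eq; lra) (/ 2) ltac:(lra)) as [N HN].
    exists N. specialize (HN (n N)). pose proof (freq_ge N).
    specialize (HN ltac:(lia)). rewrite Rabs_pos_eq in HN by (apply pow_le; lra).
    exact HN. }
  destruct k as [|K].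
  - rewrite (freq_0 _ _ _ _ _ _ F) in Hk. simpl in Hk. lra.
  - exists K. split; [|exact Hk]. apply Rnot_lt_le, Hmin. lia.
Qed.

Lemma eps_lt : 0 < eps /\ 0 < lam * eps <= / 1000.
Proof.
  pose proof (freq_lam _ _ _ _ _ _ F). pose proof (freq_eps _ _ _ _ _ _ F).
  pose proof (freq_small _ _ _ _ _ _ F). split; [assumption|].
  assert (0 < lam * eps) by (apply Rmult_lt_0_compat; lra). split; [assumption|].
  assert (10 * (lam * eps) <= lam * (lam * eps)) by (apply Rmult_le_compat_r; lra).
  lra.
Qed.

(** Each further gap gains a factor eps. The count starts at K+1, whose power is only known to be
    below 1/2. *)
Lemma threshold_tail r K i : 0 <= r < 1 -> threshold r K ->
  r ^ n (S K + i) <= eps ^ i * r ^ n (S K).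
Proof.
  intros Hr [_ HK]. destruct eps_lt as [He _].
  pose proof (freq_lam _ _ _ _ _ _ F). pose proof (freq_small _ _ _ _ _ _ F).
  assert (He1 : eps <= 1) by nra.
  induction i as [|i IH]; [rewrite Nat.add_0_r; simpl; lra|].
  rewrite Nat.add_succ_r.
  assert (Hei : 0 <= eps ^ i <= 1)
    by (split; [apply pow_le; lra|rewrite <- (pow1 i); apply pow_incr; lra]).
  assert (0 <= r ^ n (S K)) by (apply pow_le; lra).
  eapply Rle_trans.
  - apply (freq_gap _ _ _ _ _ _ F); [lia|lra|].
    assert (eps ^ i * r ^ n (S K) <= 1 * r ^ n (S K))
      by (apply Rmult_le_compat_r; lra).
    lra.
  - change (eps ^ S i) with (eps * eps ^ i). rewrite Rmult_assoc.
    apply Rmult_le_compat_l; lra.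
Qed.

Lemma lac_term_bound beta z k :
  Cmod (lac_weight beta k * z ^ n k) <= lam ^ k * Cmod z ^ n k.
Proof.
  pose proof (lac_weight_bounds beta k).
  rewrite Cmod_mult, Cmod_pow, Cmod_R, Rabs_pos_eq by lra.
  apply Rmult_le_compat_r; [apply pow_le, Cmod_ge_0|lra].
Qed.

(** As lam >= 10, the sum 1 + lam + ... + lam^(k-1) is at most lam^k / (lam - 1) <= lam^k / 9. *)
Lemma lac_partial_bound beta z k : Cmod z < 1 ->
  Cmod (psum (lac_coef beta) z (n k)) <= lam ^ k / 9.
Proof.
  intros Hz. pose proof (freq_lam _ _ _ _ _ _ F) as Hl.
  pose proof (Cmod_ge_0 z) as Hz0.
  induction k as [|k IH].
  - rewrite (freq_0 _ _ _ _ _ _ F). simpl. rewrite Cmod_0. lra.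
  - rewrite lac_psum_succ. eapply Rle_trans; [apply Cmod_triangle|].
    pose proof (lac_term_bound beta z k) as HT.
    assert (Cmod z ^ n k <= 1)
      by (rewrite <- (pow1 (n k)); apply pow_incr; lra).
    assert (0 < lam ^ k) by (apply pow_lt; lra). simpl. nra.
Qed.

Lemma lac_coef_bd beta : coef_bd (lac_coef beta).
Proof.
  intros s Hs. destruct (threshold_exists s ltac:(lra)) as [K HK].
  pose proof (freq_lam _ _ _ _ _ _ F) as Hl. destruct eps_lt as [He [Hu0 Hle]].
  assert (HK0 : 0 < lam ^ S K) by (apply pow_lt; lra).
  exists (lam ^ S K). split; [lra|]. intros j.
  unfold lac_coef. destruct (excluded_middle_informative _) as [H|H].
  2:{ rewrite Cmod_0. lra. }
  destruct (constructive_indefinite_description _ H) as [k Hk]. cbn [proj1_sig].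
  rewrite Cmod_R, Rabs_pos_eq by apply lac_weight_bounds. rewrite <- Hk.
  apply Rle_trans with (lam ^ k * s ^ n k).
  { apply Rmult_le_compat_r; [apply pow_le; lra|apply lac_weight_bounds]. }
  destruct (Nat.le_gt_cases k (S K)) as [Hc|Hc].
  - assert (s ^ n k <= 1) by (rewrite <- (pow1 (n k)); apply pow_incr; lra).
    assert (lam ^ k <= lam ^ S K) by (apply Rle_pow; [lra|lia]).
    assert (0 <= lam ^ k) by (apply pow_le; lra).
    apply Rle_trans with (lam ^ k * 1); [apply Rmult_le_compat_l|]; lra.
  - replace k with (S K + (k - S K))%nat by lia.
    set (i := (k - S K)%nat). rewrite pow_add, Rmult_assoc.
    rewrite <- (Rmult_1_r (lam ^ S K)) at 2. apply Rmult_le_compat_l; [lra|].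
    eapply Rle_trans.
    + apply Rmult_le_compat_l; [apply pow_le; lra|].
      apply (threshold_tail s K i); [lra|exact HK].
    + rewrite <- Rmult_assoc, <- Rpow_mult_distr.
      assert (0 <= (lam * eps) ^ i <= 1).
      { split; [apply pow_le; lra|]. rewrite <- (pow1 i). apply pow_incr. lra. }
      assert (0 <= s ^ n (S K)) by (apply pow_le; lra).
      destruct HK. nra.
Qed.

Lemma threshold_weight r K : 0 <= r < 1 -> threshold r K ->
  lam ^ K * omega 0 <= omega r <= B * lam ^ S K.
Proof.
  intros Hr [H1 H2]. split.
  - apply (freq_lower _ _ _ _ _ _ F); assumption.
  - apply (freq_upper _ _ _ _ _ _ F); [lia|assumption|assumption].
Qed.

Lemma lac_upper f beta z K : has_pseries f (lac_coef beta) -> Cmod z < 1 ->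
  threshold (Cmod z) K -> Cmod (f z) <= 2 * lam ^ S K.
Proof.
  intros [_ Hf] Hz HK. pose proof (Cmod_ge_0 z) as Hz0.
  pose proof (freq_lam _ _ _ _ _ _ F) as Hl. destruct eps_lt as [He [Hu0 Hu]].
  set (u := lam * eps) in *. set (L := lam ^ S K).
  assert (HL : 0 < L) by (apply pow_lt; lra).
  (* The share 1/9 covers the terms up to K. The later ones are at most L u^i, and 3/2 (1 - u^i)
     dominates their partial sums since 3u <= 1; in total 1/9 + 3/2 < 2. *)
  assert (G : forall i, Cmod (psum (lac_coef beta) z (n (S K + i)))
                        <= L * (/ 9 + 3 / 2 * (1 - u ^ i))).
  { induction i as [|i IH].
    - rewrite Nat.add_0_r. simpl (u ^ 0).
      replace (L * (/ 9 + 3 / 2 * (1 - 1))) with (L / 9) by field.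
      apply lac_partial_bound, Hz.
    - rewrite Nat.add_succ_r, lac_psum_succ.
      eapply Rle_trans; [apply Cmod_triangle|].
      pose proof (lac_term_bound beta z (S K + i)) as HT.
      assert (HT2 : lam ^ (S K + i) * Cmod z ^ n (S K + i) <= L * u ^ i).
      { rewrite pow_add, Rmult_assoc. apply Rmult_le_compat_l; [lra|].
        unfold u. rewrite Rpow_mult_distr.
        apply Rmult_le_compat_l; [apply pow_le; lra|].
        eapply Rle_trans; [apply threshold_tail; [lra|exact HK]|].
        destruct HK as [_ HK]. assert (0 <= eps ^ i) by (apply pow_le; lra). nra. }
      assert (0 <= u ^ i) by (apply pow_le; lra).
      assert (0 <= L * u ^ i * (1 - 3 * u))
        by (apply Rmult_le_pos; [apply Rmult_le_pos|]; lra).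
      simpl (u ^ S i). lra. }
  replace (f z) with (f z - 0)%C by ring.
  apply (clim_bound (fun k => psum (lac_coef beta) z (n k)) _ _ _ (S K)).
  - apply (clim_subseq (psum (lac_coef beta) z)); [apply (freq_lt _ _ _ _ _ _ F)|].
    apply Hf, Hz.
  - intros k Hk. replace k with (S K + (k - S K))%nat by lia.
    set (i := (k - S K)%nat). specialize (G i).
    replace (psum (lac_coef beta) z (n (S K + i)) - 0)%C
      with (psum (lac_coef beta) z (n (S K + i))) by ring.
    assert (0 <= u ^ i) by (apply pow_le; lra). nra.
Qed.

(** The tail bound is a hypothesis so that k may be the threshold index or the index before it. The
    other terms amount to at most L/90 + 3L/200 <= L/10, against L/2 for the term k. *)
Lemma lac_dominant f k z : has_pseries f (lac_coef (Nat.even k)) -> Cmod z < 1 ->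
  / 2 <= Cmod z ^ n k -> (forall i, Cmod z ^ n (k + 2 + i) <= eps ^ S i) ->
  lam ^ k / 4 <= Cmod (f z).
Proof.
  intros [_ Hf] Hz Hk Htail. pose proof (Cmod_ge_0 z) as Hz0.
  pose proof (freq_lam _ _ _ _ _ _ F) as Hl. destruct eps_lt as [He [Hu0 Hu]].
  pose proof (freq_small _ _ _ _ _ _ F) as Hsm.
  set (u := lam * eps) in *. set (L := lam ^ k).
  assert (HL : 0 < L) by (apply pow_lt; lra).
  set (beta := Nat.even k) in *.
  assert (W0 : lac_weight beta k = L)
    by (unfold lac_weight, beta; now rewrite eqb_reflx).
  assert (Hodd : forall j, Nat.even j = negb beta -> lac_weight beta j = 0).
  { intros j Hj. unfold lac_weight. rewrite Hj. now destruct beta. }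
  (* Parity removes the index k-1, so only lam^(k-1) / 9 remains, which is at most L/90. *)
  assert (P0 : Cmod (psum (lac_coef beta) z (n k)) <= L * / 90).
  { destruct k as [|k'] eqn:Ek.
    - rewrite (freq_0 _ _ _ _ _ _ F). simpl. rewrite Cmod_0. lra.
    - rewrite lac_psum_succ, Hodd.
      + replace (psum (lac_coef beta) z (n k') + 0 * z ^ n k')%C
          with (psum (lac_coef beta) z (n k')) by ring.
        pose proof (lac_partial_bound beta z k' Hz).
        assert (0 < lam ^ k') by (apply pow_lt; lra).
        unfold L. simpl. nra.
      + unfold beta. rewrite Nat.even_succ, <- Nat.negb_even.
        now rewrite negb_involutive. }
  set (T := (RtoC L * z ^ n k)%C).
  assert (G : forall i, Cmod (psum (lac_coef beta) z (n (k + 2 + i)) - T)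
                        <= L * (/ 90 + 3 / 200 * (1 - u ^ i))).
  { induction i as [|i IH].
    - rewrite Nat.add_0_r. replace (k + 2)%nat with (S (S k)) by lia.
      rewrite !lac_psum_succ, W0, (Hodd (S k)).
      + replace (psum (lac_coef beta) z (n k) + L * z ^ n k + 0 * z ^ n (S k) - T)%C
          with (psum (lac_coef beta) z (n k)) by (unfold T; ring).
        simpl. lra.
      + unfold beta. now rewrite Nat.even_succ, <- Nat.negb_even.
    - rewrite Nat.add_succ_r, lac_psum_succ.
      replace (psum (lac_coef beta) z (n (k + 2 + i))
               + lac_weight beta (k + 2 + i) * z ^ n (k + 2 + i) - T)%C
        with ((psum (lac_coef beta) z (n (k + 2 + i)) - T)
              + lac_weight beta (k + 2 + i) * z ^ n (k + 2 + i))%C by ring.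
      eapply Rle_trans; [apply Cmod_triangle|].
      pose proof (lac_term_bound beta z (k + 2 + i)) as HT.
      assert (Hui : 0 <= u ^ i) by (apply pow_le; lra).
      assert (HT2 : lam ^ (k + 2 + i) * Cmod z ^ n (k + 2 + i) <= L * (/ 100 * u ^ i)).
      { rewrite !pow_add. fold L. rewrite !Rmult_assoc.
        apply Rmult_le_compat_l; [lra|].
        apply Rle_trans with (lam ^ 2 * (lam ^ i * eps ^ S i)).
        - apply Rmult_le_compat_l; [apply pow_le; lra|].
          apply Rmult_le_compat_l; [apply pow_le; lra|apply Htail].
        - replace (lam ^ 2 * (lam ^ i * eps ^ S i))
            with (lam * lam * eps * u ^ i)
            by (unfold u; rewrite Rpow_mult_distr; simpl; ring).
          apply Rmult_le_compat_r; lra. }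
      assert (0 <= L * u ^ i * (1 - 3 * u))
        by (apply Rmult_le_pos; [apply Rmult_le_pos|]; lra).
      simpl (u ^ S i). lra. }
  assert (D : Cmod (f z - T) <= L * / 10).
  { apply (clim_bound (fun k => psum (lac_coef beta) z (n k)) _ _ _ (k + 2)).
    - apply (clim_subseq (psum (lac_coef beta) z)); [apply (freq_lt _ _ _ _ _ _ F)|].
      apply Hf, Hz.
    - intros j Hj. replace j with (k + 2 + (j - (k + 2)))%nat by lia.
      set (i := (j - (k + 2))%nat). specialize (G i).
      assert (0 <= u ^ i) by (apply pow_le; lra). nra. }
  assert (HT : L * / 2 <= Cmod T).
  { unfold T. rewrite Cmod_mult, Cmod_pow, Cmod_R, Rabs_pos_eq by lra.
    apply Rmult_le_compat_l; lra. }
  rewrite Cmod_minus_sym in D.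
  pose proof (Cmod_triangle_rev T (f z)). lra.
Qed.

Lemma lac_dominant_at_threshold f K z :
  has_pseries f (lac_coef (Nat.even K)) -> Cmod z < 1 -> threshold (Cmod z) K ->
  lam ^ K / 4 <= Cmod (f z).
Proof.
  intros Hf Hz HK. pose proof (Cmod_ge_0 z). apply lac_dominant; try assumption.
  - apply HK.
  - intros i. replace (K + 2 + i)%nat with (S K + S i)%nat by lia.
    eapply Rle_trans; [apply threshold_tail; [lra|exact HK]|].
    destruct HK as [_ HK]. destruct eps_lt as [He _].
    assert (0 <= eps ^ S i) by (apply pow_le; lra). nra.
Qed.

Lemma lac_bounded_by_weight f beta : has_pseries f (lac_coef beta) ->
  bounded_by_weight omega f.
Proof.
  intros Hf. assert (H0 : 0 < omega 0) by (apply Hom; lra).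
  pose proof (freq_lam _ _ _ _ _ _ F) as Hl.
  exists (2 * lam / omega 0). split; [apply Rdiv_lt_0_compat; lra|].
  intros z Hz. pose proof (Cmod_ge_0 z).
  destruct (threshold_exists (Cmod z)) as [K HK]; [lra|].
  eapply Rle_trans; [apply (lac_upper f beta z K Hf Hz HK)|].
  destruct (threshold_weight (Cmod z) K ltac:(lra) HK) as [H1 _].
  replace (2 * lam ^ S K) with (2 * lam / omega 0 * (lam ^ K * omega 0))
    by (simpl; field; lra).
  apply Rmult_le_compat_l; [left; apply Rdiv_lt_0_compat; lra|exact H1].
Qed.

(** Near the boundary the threshold index is positive, so an index before it exists. For 1 - r <= 1
    / (2 n_1), Bernoulli's inequality gives r^(n_1) >= 1/2. *)
Lemma eventually_threshold : exists r0, 0 <= r0 < 1 /\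
  forall r, r0 <= r < 1 -> exists K, threshold r (S K).
Proof.
  assert (Hn1 : 1 <= INR (n 1)).
  { pose proof (freq_ge 1). apply (le_INR 1). exact H. }
  exists (1 - / (2 * INR (n 1))).
  assert (Hi : 0 < / (2 * INR (n 1)) <= / 2).
  { split; [apply Rinv_0_lt_compat; lra|apply Rinv_le_contravar; lra]. }
  split; [lra|]. intros r Hr.
  destruct (threshold_exists r ltac:(lra)) as [[|K] HK]; [exfalso|now exists K].
  destruct HK as [_ HK].
  pose proof (bernoulli_le r (n 1) ltac:(lra)) as Hb.
  assert (INR (n 1) * (1 - r) <= / 2); [|lra].
  replace (/ 2) with (INR (n 1) * / (2 * INR (n 1))) by (field; lra).
  apply Rmult_le_compat_l; lra.
Qed.

(** With threshold K+1 at r, the circle |z| = r itself works unless the series lacks that index and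
    the power r^(n_(K+2)) is neither below eps nor at least 1/2. *)
Lemma lac_large_on_circles f beta : has_pseries f (lac_coef beta) ->
  large_on_circles omega f.
Proof.
  intros Hf. pose proof (freq_lam _ _ _ _ _ _ F) as Hl.
  pose proof (freq_B _ _ _ _ _ _ F) as HB. destruct eps_lt as [He [_ Hle]].
  assert (Hq : 1 <= INR q) by (apply (le_INR 1), (freq_q_pos _ _ _ _ _ _ F)).
  destruct eventually_threshold as [r0 [Hr0 HT]].
  (* The dominant index may be one below the threshold K+1, while omega is bounded by B lam^(K+2):
     hence two factors lam. *)
  set (c := / (4 * B * lam * lam)).
  assert (Hc : 0 < c).
  { apply Rinv_0_lt_compat. repeat apply Rmult_lt_0_compat; lra. }
  assert (Hw : forall r K, 0 <= r < 1 -> threshold r (S K) ->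
            c * omega r <= lam ^ K / 4).
  { intros r K Hr HK. destruct (threshold_weight r (S K) Hr HK) as [_ H2].
    replace (lam ^ K / 4) with (c * (B * lam ^ S (S K)))
      by (unfold c; simpl; field; lra).
    apply Rmult_le_compat_l; lra. }
  assert (Hstep : forall K, lam ^ K / 4 <= lam ^ S K / 4).
  { intros K. assert (0 < lam ^ K) by (apply pow_lt; lra). simpl. nra. }
  assert (Hiq : / INR q <= 1)
    by (rewrite <- Rinv_1; apply Rinv_le_contravar; lra).
  exists (/ INR q), c, r0. split; [apply Rinv_0_lt_compat; lra|].
  split; [exact Hc|]. split; [lra|]. intros r Hr.
  destruct (HT r Hr) as [K HK].
  assert (Hrr : r <= r < 1 /\ / INR q * (1 - r) <= 1 - r) by (split; nra).
  destruct (bool_dec (Nat.even (S K)) beta) as [Eb|Eb].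
  { exists r. split; [apply Hrr|]. split; [apply Hrr|]. intros z Hz.
    eapply Rle_trans; [apply (Hw r K); [lra|exact HK]|].
    eapply Rle_trans; [apply Hstep|].
    apply lac_dominant_at_threshold; rewrite ?Eb, ?Hz; try assumption; lra. }
  assert (Eb' : Nat.even K = beta).
  { rewrite Nat.even_succ, <- Nat.negb_even in Eb.
    destruct (Nat.even K), beta; simpl in Eb; congruence. }
  destruct (Rle_dec (r ^ n (S (S K))) eps) as [Hsmall|Hbig].
  - exists r. split; [apply Hrr|]. split; [apply Hrr|]. intros z Hz.
    eapply Rle_trans; [apply (Hw r K); [lra|exact HK]|].
    apply lac_dominant; rewrite ?Eb', ?Hz; try assumption; try lra.
    + eapply Rle_trans; [apply HK|]. apply pow_le_pow; [lra|].
      apply Nat.lt_le_incl, (freq_lt _ _ _ _ _ _ F).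
    + intros i. replace (K + 2 + i)%nat with (S (S K) + i)%nat by lia.
      eapply Rle_trans; [apply threshold_tail; [lra|exact HK]|].
      simpl (eps ^ S i). rewrite (Rmult_comm eps).
      apply Rmult_le_compat_l; [apply pow_le; lra|exact Hsmall].
  (* The terms K and K+2 compete here. Increasing the radius to s with s^N = 1/2 makes K+2 the
     threshold index, and it has the parity of K. *)
  - set (N := n (S (S K))) in *.
    assert (HN : 1 <= INR N).
    { pose proof (freq_ge (S (S K))) as H. fold N in H. apply (le_INR 1). lia. }
    set (s := Rpower (/ 2) (/ INR N)).
    assert (Hs0 : 0 < s) by apply exp_pos.
    assert (HsN : s ^ N = / 2).
    { rewrite <- Rpower_pow by exact Hs0. unfold s.
      rewrite Rpower_mult, Rinv_l, Rpower_1; lra. }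
    assert (Hpow_lt : forall x y, 0 <= x -> 0 <= y -> x ^ N < y ^ N -> x < y).
    { intros x y Hx Hy H. apply Rnot_le_lt. intros Hc'.
      pose proof (pow_incr y x N (conj Hy Hc')). lra. }
    destruct HK as [HK1 HK2]. fold N in HK2.
    assert (Hs1 : s < 1) by (apply Hpow_lt; [lra|lra|rewrite HsN, pow1; lra]).
    assert (Hrs : r < s) by (apply Hpow_lt; [lra|lra|rewrite HsN; exact HK2]).
    assert (HKs : threshold s (S (S K))).
    { split; fold N; [lra|].
      pose proof (freq_gap _ _ _ _ _ _ F (S (S K)) s ltac:(lia) ltac:(lra)) as H.
      fold N in H. rewrite HsN in H. specialize (H ltac:(lra)). nra. }
    exists s. split; [lra|]. split.
    (* Indeed s^(qN) = (1/2)^q <= eps < r^N. Bernoulli's inequality then gives 1 - r < q (1 - s),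
       hence the constant d = 1/q. *)
    + assert (Hsq : s ^ q < r).
      { apply Hpow_lt; [apply pow_le; lra|lra|].
        rewrite <- pow_mult, Nat.mul_comm, pow_mult, HsN.
        pose proof (freq_q _ _ _ _ _ _ F) as H.
        replace (1 / 2) with (/ 2) in H by field. lra. }
      pose proof (bernoulli_le s q ltac:(lra)).
      apply Rmult_le_reg_l with (INR q); [lra|].
      rewrite <- Rmult_assoc, Rinv_r by lra. lra.
    + intros z Hz.
      eapply Rle_trans; [apply (Hw s (S K)); [lra|exact HKs]|].
      eapply Rle_trans; [apply Hstep|].
      apply lac_dominant_at_threshold; rewrite ?Hz; try assumption; try lra.
      change (has_pseries f (lac_coef (Nat.even K))). now rewrite Eb'.
Qed.

(** One of the two indices K, K+1 has the parity of the series, and its power at r is at least 1/2.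
    This holds even on circles where the series vanishes somewhere. *)
Lemma lac_large_coefficients beta : large_coefficients omega (lac_coef beta).
Proof.
  pose proof (freq_lam _ _ _ _ _ _ F) as Hl.
  pose proof (freq_B _ _ _ _ _ _ F) as HB.
  destruct eventually_threshold as [r0 [Hr0 HT]].
  exists (/ (2 * B * lam * lam)), r0.
  assert (Hc : 0 < / (2 * B * lam * lam)).
  { apply Rinv_0_lt_compat. repeat apply Rmult_lt_0_compat; lra. }
  split; [exact Hc|]. split; [lra|]. intros r Hr.
  destruct (HT r Hr) as [K HK].
  destruct (threshold_weight r (S K) ltac:(lra) HK) as [_ Hw].
  assert (Hw2 : / (2 * B * lam * lam) * omega r <= lam ^ K * / 2).
  { replace (lam ^ K * / 2) with (/ (2 * B * lam * lam) * (B * lam ^ S (S K)))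
      by (simpl; field; lra).
    apply Rmult_le_compat_l; lra. }
  assert (Hlk : 0 < lam ^ K) by (apply pow_lt; lra).
  assert (Hsel : exists k, (K <= k <= S K)%nat /\ Nat.even k = beta).
  { destruct (bool_dec (Nat.even K) beta) as [E|E]; [exists K; split; [lia|exact E]|].
    exists (S K). split; [lia|]. rewrite Nat.even_succ, <- Nat.negb_even.
    destruct (Nat.even K), beta; simpl; congruence. }
  destruct Hsel as [k [Hk Ek]]. exists (n k). rewrite lac_coef_at.
  unfold lac_weight. rewrite Ek, eqb_reflx. simpl.
  eapply Rle_trans; [exact Hw2|].
  apply Rmult_le_compat; [lra|lra|apply Rle_pow; [lra|lia]|].
  eapply Rle_trans; [apply HK|]. apply pow_le_pow; [lra|].
  destruct (Nat.eq_dec k (S K)) as [->|]; [lia|].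
  pose proof (freq_mono k (S K) ltac:(lia)). lia.
Qed.

Lemma lac_sum_lower f0 f1 :
  has_pseries f0 (lac_coef true) -> has_pseries f1 (lac_coef false) ->
  forall z, Cmod z < 1 ->
  omega (Cmod z) <= 4 * B * lam * (Cmod (f0 z) + Cmod (f1 z)).
Proof.
  intros H0 H1 z Hz. pose proof (Cmod_ge_0 z).
  pose proof (freq_lam _ _ _ _ _ _ F) as Hl.
  pose proof (freq_B _ _ _ _ _ _ F) as HB.
  destruct (threshold_exists (Cmod z)) as [K HK]; [lra|].
  destruct (threshold_weight (Cmod z) K ltac:(lra) HK) as [_ Hw].
  eapply Rle_trans; [exact Hw|].
  replace (B * lam ^ S K) with (4 * B * lam * (lam ^ K / 4)) by (simpl; field).
  apply Rmult_le_compat_l; [repeat apply Rmult_le_pos; lra|].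
  pose proof (Cmod_ge_0 (f0 z)). pose proof (Cmod_ge_0 (f1 z)).
  destruct (Nat.even K) eqn:E.
  - apply Rle_trans with (Cmod (f0 z)); [|lra].
    apply lac_dominant_at_threshold; rewrite ?E; assumption.
  - apply Rle_trans with (Cmod (f1 z)); [|lra].
    apply lac_dominant_at_threshold; rewrite ?E; assumption.
Qed.

End Lacunary.

(** * Assembly of the theorem *)

Lemma has_pseries_analytic (f : C -> C) (a : nat -> C) :
  has_pseries f a -> analytic_on_disc f.
Proof.
  intros Hf z Hz.
  apply (C1_on_is_derive (fun w => Cmod w <= Cmod z));
    [apply has_pseries_C1 with a; [exact Hf|exact Hz]|lra].
Qed.

Theorem theorem1 (omega : R -> R) (homega : doubling omega) :
  exists f0 f1 : C -> C,
    analytic_on_disc f0 /\ analytic_on_disc f1 /\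
    asymp_on unit_disc (fun z => Cmod (f0 z) + Cmod (f1 z))
                       (fun z => omega (Cmod z)) /\
    (forall f : C -> C, f = f0 \/ f = f1 ->
       (exists K : R, 0 < K /\
          at_left 1 (fun r =>
            Rbar_le (n_count r f (RtoC 0)) (Finite (K * / (1 - r))))) /\
       (forall p : Rbar, Rbar_lt (Finite 0) p ->
          asymp_near1 (fun r => M_mean p r f) omega) /\
       (forall a : C,
          asymp_near1 (fun r => T_char r f) (fun r => N_count r f a) /\
          asymp_near1 (fun r => N_count r f a) (fun r => ln (omega r)))).
Proof.
  destruct (frequencies_exist omega homega) as [lam [eps [B [q [n F]]]]].
  pose proof (lac_coef_bd omega lam eps B q n F) as Hbd.
  destruct (has_pseries_exists _ (Hbd true)) as [f0 H0].
  destruct (has_pseries_exists _ (Hbd false)) as [f1 H1].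
  exists f0, f1.
  split; [eapply has_pseries_analytic, H0|].
  split; [eapply has_pseries_analytic, H1|]. split.
  - split.
    + destruct (lac_bounded_by_weight omega lam eps B q n F homega f0 true H0)
        as [K0 [HK0 U0]].
      destruct (lac_bounded_by_weight omega lam eps B q n F homega f1 false H1)
        as [K1 [HK1 U1]].
      exists (K0 + K1). split; [lra|]. intros z Hz.
      specialize (U0 z Hz). specialize (U1 z Hz). lra.
    + exists (4 * B * lam). split.
      * pose proof (freq_lam _ _ _ _ _ _ F). pose proof (freq_B _ _ _ _ _ _ F).
        repeat apply Rmult_lt_0_compat; lra.
      * exact (lac_sum_lower omega lam eps B q n F f0 f1 H0 H1).
  - assert (G : forall beta f, has_pseries f (lac_coef lam n beta) -> _)
      by (intros beta f Hf;
          exact (growth_criterion omega f _ homega Hf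
            (lac_bounded_by_weight omega lam eps B q n F homega f beta Hf)
            (lac_large_on_circles omega lam eps B q n F f beta Hf)
            (lac_large_coefficients omega lam eps B q n F beta))).
    intros f [->| ->]; [exact (G true f0 H0)|exact (G false f1 H1)].
Qed.
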